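(* Let $K$ be a simplicial complex on $[m]$. There exists a natural epimorphism of multi-graded abelian groups $$f:A=\operatorname{Ext}_{\wedge(K)}^{*,\bar *}(\mathbb{Z},\mathbb{Z})\to B=\operatorname{Ext}_{\mathbb{Z}(K)}^{*,\bar *}(\mathbb{Z},\mathbb{Z})$$ such that (1) $f(y\cdot y')=(-1)^{\epsilon}f(y)\cdot f(y')$, where $y\in A_{n,I}$, $y'\in A_{n',I'}$, $I=(i_1,\dots,i_m)$, $I'=(i_1',\dots,i_m')$ and $\epsilon=\sum_{j\le k}i_ji_k'-n'\sum_j i_j$; (2) $\operatorname{Ker} f|_{A_{n,I}}=\sum_{j,k}\mu_{j,k}(A_{n,I-e_j})$, the sum running over $j\in[m]$ with $i_j\ge 2$ and $1\le k\le i_j-1$.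
   Context: $[m]=\{1,\dots,m\}$; $\mathbb{N}$ denotes the non-negative integers; $e_j$ is the $j$-th unit vector of $\mathbb{N}^m$; $|I|=i_1+\dots+i_m$. A simplicial complex $K$ on $[m]$ is a collection of subsets of $[m]$ containing $\emptyset$ and closed under taking subsets; $\bar K$ is the set of non-empty simplices. $I_{SR}(K)$ is the ideal generated by the monomials $v_{i_1}\cdots v_{i_s}$ (square-free) with $\{i_1,\dots,i_s\}\notin K$; $\mathbb{Z}(K)=\mathbb{Z}[v_1,\dots,v_m]/I_{SR}(K)$ and $\wedge(K)=\wedge[v_1,\dots,v_m]/I_{SR}(K)$ over $\mathbb{Z}$. Both are multigraded by $\mathbb{N}^m$ with $v_i$ in multi-degree $e_i$ and degree 1. The Ext groups are bigraded by homological degree and internal multi-degree $I\in\mathbb{N}^m$, with the usual product; $A_{n,I}$ denotes the part of homological degree $|I|-n$ and internal multi-degree $I$. Operations $\mu_{j,k}$: let $T_K$ be the free tensor algebra over $\mathbb{Z}$ (product written $|$) on $\bar K$, with $\deg\sigma=|\sigma|-1$ and derivation $d\sigma=\sum(-1)^{\epsilon(\sigma_1,\sigma_2)+|\sigma_1|}(\sigma_1|\sigma_2)$, summed over ordered pairs of non-empty sets with $\sigma=\sigma_1\sqcup\sigma_2$, where $\epsilon(\sigma_1,\sigma_2)=\#\{(i,j)\in\sigma_1\times\sigma_2: i>j\}$. $T_K=\bigoplus_I T_K(I)$ is graded by the number of occurrences of each vertex; it is the cobar construction of the coalgebra dual to $\wedge(K)$, so $A_{n,I}\cong H_n(T_K(I))$.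 For $j\in[m]$, $1\le k\le i_j$ and a basis element $(\sigma(1)|\dots|\sigma(r))\in T_K(I)$ let $q$ be minimal such that exactly $k$ of $\sigma(1),\dots,\sigma(q)$ contain $j$; put $$\mu^T_{j,k}(\sigma(1)|\dots|\sigma(r))=\sum_{\tau_1\sqcup\tau_2=\sigma(q)\setminus\{j\}}(-1)^{\epsilon(\tau_1,\tau_2)}(\sigma(1)|\dots|\{j\}\sqcup\tau_1|\{j\}\sqcup\tau_2|\dots|\sigma(r)),$$ over ordered pairs of possibly empty sets. This commutes with $d$ and induces $\mu_{j,k}:A_{n,I}\to A_{n,I+e_j}$. *)

(* Defs.v *)
From HB Require Import structures.
From mathcomp Require Import all_boot all_order all_algebra.
From mathcomp Require Import generic_quotient ring_quotient.
From mathcomp Require Import mpoly freeg boolp functions zify ring.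

Set Implicit Arguments.
Unset Strict Implicit.
Unset Printing Implicit Defensive.

Import GRing.Theory.

Local Open Scope ring_scope.
Local Open Scope quotient_scope.

(** * Quotient of a ring by the two-sided ideal generated by a family

    The library's ideal quotients are limited to commutative rings, whereas the
    exterior face ring is not commutative. *)

Section RingQuotient.
Variables (R : pzRingType) (G : R -> Prop).

Definition ideal_gen : {pred R} := fun x => `[< exists t : seq (R * R * R),
  (forall u, u \in t -> G u.1.2) /\ x = \sum_(u <- t) u.1.1 * u.1.2 * u.2 >].

Lemma ideal_genP x : reflect (exists t : seq (R * R * R),
  (forall u, u \in t -> G u.1.2) /\ x = \sum_(u <- t) u.1.1 * u.1.2 * u.2)
  (x \in ideal_gen).
Proof. exact: asboolP. Qed.

Lemma ideal_genMl a x : x \in ideal_gen -> a * x \in ideal_gen.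
Proof.
move=> /ideal_genP[t [Gt ->]]; apply/ideal_genP.
exists [seq (a * u.1.1, u.1.2, u.2) | u <- t]; split.
  by move=> _ /mapP[u /Gt Gu ->].
by rewrite big_map mulr_sumr; apply: eq_bigr => u _; rewrite !mulrA.
Qed.

Lemma ideal_genMr a x : x \in ideal_gen -> x * a \in ideal_gen.
Proof.
move=> /ideal_genP[t [Gt ->]]; apply/ideal_genP.
exists [seq (u.1.1, u.1.2, u.2 * a) | u <- t]; split.
  by move=> _ /mapP[u /Gt Gu ->].
by rewrite big_map mulr_suml; apply: eq_bigr => u _; rewrite !mulrA.
Qed.

Lemma ideal_gen_in x : G x -> x \in ideal_gen.
Proof.
move=> Gx; apply/ideal_genP; exists [:: (1, x, 1)]; split.
  by move=> u; rewrite inE => /eqP ->.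
by rewrite big_seq1 /= mul1r mulr1.
Qed.

Fact ideal_gen_zmod : zmod_closed ideal_gen.
Proof.
split=> [|x y Ix Iy].
  by apply/ideal_genP; exists [::]; rewrite big_nil.
have /ideal_genP[t' [Gt' ->]] : - y \in ideal_gen.
  by rewrite -mulN1r ideal_genMl.
have /ideal_genP[t [Gt ->]] := Ix; apply/ideal_genP.
exists (t ++ t'); split; last by rewrite big_cat.
by move=> u; rewrite mem_cat => /orP[/Gt|/Gt'].
Qed.

HB.instance Definition _ := GRing.isZmodClosed.Build R ideal_gen ideal_gen_zmod.

Definition ring_quot : Type := {ideal_quot ideal_gen}.
HB.instance Definition _ := GRing.Zmodule.on ring_quot.

Definition rq_repr (x : ring_quot) : R := repr (x : {ideal_quot ideal_gen}).
Definition rq_pi : R -> ring_quot := \pi_{ideal_quot ideal_gen}.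

Lemma rq_piE x y : (rq_pi x == rq_pi y) = (x - y \in ideal_gen).
Proof. by rewrite Quotient.idealrBE. Qed.

Lemma rq_reprK x : rq_pi (rq_repr x) = x.
Proof. exact: reprK. Qed.

Lemma rq_piD x y : rq_pi (x + y) = rq_pi x + rq_pi y.
Proof. exact: raddfD. Qed.

Lemma rq_piB x y : rq_pi (x - y) = rq_pi x - rq_pi y.
Proof. exact: raddfB. Qed.

Definition rq_one : ring_quot := rq_pi 1.
Definition rq_mul (x y : ring_quot) : ring_quot := rq_pi (rq_repr x * rq_repr y).

Lemma rq_piM x y : rq_pi (x * y) = rq_mul (rq_pi x) (rq_pi y).
Proof.
apply/eqP; rewrite rq_piE.
set x' := rq_repr _; set y' := rq_repr _.
have Ix : x - x' \in ideal_gen by rewrite -rq_piE rq_reprK.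
have Iy : y - y' \in ideal_gen by rewrite -rq_piE rq_reprK.
have -> : x * y - x' * y' = (x - x') * y + x' * (y - y').
  by rewrite mulrBl mulrBr addrA subrK.
by apply: rpredD; [exact: ideal_genMr | exact: ideal_genMl].
Qed.

Lemma rq_ind (P : ring_quot -> Prop) : (forall x, P (rq_pi x)) -> forall x, P x.
Proof. by move=> Ppi x; rewrite -(rq_reprK x); apply: Ppi. Qed.

Fact rq_mulA : associative rq_mul.
Proof.
move=> x y z; elim/rq_ind: x => x; elim/rq_ind: y => y; elim/rq_ind: z => z.
by rewrite -!rq_piM mulrA.
Qed.
Fact rq_mul1 : left_id rq_one rq_mul.
Proof. by move=> x; elim/rq_ind: x => x; rewrite -rq_piM mul1r. Qed.
Fact rq_mulr1 : right_id rq_one rq_mul.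
Proof. by move=> x; elim/rq_ind: x => x; rewrite -rq_piM mulr1. Qed.
Fact rq_mulDl : left_distributive rq_mul +%R.
Proof.
move=> x y z; elim/rq_ind: x => x; elim/rq_ind: y => y; elim/rq_ind: z => z.
by rewrite -rq_piD -!rq_piM mulrDl rq_piD.
Qed.
Fact rq_mulDr : right_distributive rq_mul +%R.
Proof.
move=> x y z; elim/rq_ind: x => x; elim/rq_ind: y => y; elim/rq_ind: z => z.
by rewrite -rq_piD -!rq_piM mulrDr rq_piD.
Qed.

HB.instance Definition _ := GRing.Zmodule_isPzRing.Build ring_quot
  rq_mulA rq_mul1 rq_mulr1 rq_mulDl rq_mulDr.

Fact rq_pi_zmod : zmod_morphism rq_pi. Proof. exact: rq_piB. Qed.
HB.instance Definition _ := GRing.isZmodMorphism.Build R ring_quot rq_pi rq_pi_zmod.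
Fact rq_pi_monoid : monoid_morphism rq_pi.
Proof. by split=> // x y; rewrite rq_piM. Qed.
HB.instance Definition _ := GRing.isMonoidMorphism.Build R ring_quot rq_pi rq_pi_monoid.

Section Lift.
Variables (S : pzRingType) (f : {rmorphism R -> S}).
Hypothesis fG : forall x, G x -> f x = 0.

Definition rq_lift of (forall x, G x -> f x = 0) : ring_quot -> S :=
  f \o @rq_repr.

Local Notation lift := (rq_lift fG).

Lemma rq_lift_pi x : lift (rq_pi x) = f x.
Proof.
apply/eqP; rewrite -subr_eq0 -rmorphB /=; apply/eqP.
have /ideal_genP[t [Gt ->]] :
  rq_repr (rq_pi x) - x \in ideal_gen by rewrite -rq_piE rq_reprK.
rewrite rmorph_sum big_seq big1 //= => u /Gt Gu.
by rewrite !rmorphM /= (fG Gu) mulr0 mul0r.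
Qed.

Fact rq_lift_zmod : zmod_morphism lift.
Proof.
move=> x y; elim/rq_ind: x => x; elim/rq_ind: y => y.
by rewrite -rmorphB /= !rq_lift_pi rmorphB.
Qed.
HB.instance Definition _ := GRing.isZmodMorphism.Build ring_quot S lift rq_lift_zmod.
Fact rq_lift_monoid : monoid_morphism lift.
Proof.
split; first by rewrite -(rmorph1 rq_pi) rq_lift_pi rmorph1.
move=> x y; elim/rq_ind: x => x; elim/rq_ind: y => y.
by rewrite -rmorphM /= !rq_lift_pi rmorphM.
Qed.
HB.instance Definition _ := GRing.isMonoidMorphism.Build ring_quot S lift rq_lift_monoid.
End Lift.

End RingQuotient.

(** * The integral exterior algebra *)

(* The number of pairs of S x T that are in the wrong order. *)
Definition eps m (S T : {set 'I_m}) : nat :=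
  #|[set p in setX S T | (p.2 < p.1)%N]|.

Lemma epsE m (S T : {set 'I_m}) :
  eps S T = (\sum_(i in S) \sum_(j in T) (j < i)%N)%N.
Proof.
rewrite /eps -sum1_card pair_big /= big_mkcond [RHS]big_mkcond /=.
apply: eq_bigr => -[i j] _; rewrite !inE /=.
by case: (i \in S); case: (j \in T); case: (j < i)%N.
Qed.

(* Free on the monomials v_S, the function x being the sum of the x S v_S;
   v_S * v_T is zero unless S and T are disjoint, and then it is
   (-1)^(eps S T) v_(S :|: T). *)
Definition extalg (m : nat) : Type := {ffun {set 'I_m} -> int}.
HB.instance Definition _ m := GRing.Zmodule.on (extalg m).

Section ExteriorAlgebra.
Variable m : nat.
Implicit Types (x y z : extalg m) (S T U V : {set 'I_m}).

Definition extalg_mon S : extalg m := [ffun T => (T == S)%:R].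
Definition extalg_one : extalg m := extalg_mon set0.
Definition extalg_mul x y : extalg m := [ffun U : {set 'I_m} =>
  \sum_(S : {set 'I_m} | S \subset U) (-1) ^+ eps S (U :\: S) * (x S * y (U :\: S))].

Lemma eps0l S : eps set0 S = 0%N.
Proof. by rewrite epsE big_set0. Qed.
Lemma eps0r S : eps S set0 = 0%N.
Proof. by rewrite epsE big1 // => i _; rewrite big_set0. Qed.

Lemma epsUl S T U : [disjoint S & T] -> eps (S :|: T) U = (eps S U + eps T U)%N.
Proof.
move=> dST; rewrite !epsE -bigU //.
by apply: eq_bigl => i; rewrite !inE.
Qed.

Lemma epsUr S T U : [disjoint S & T] -> eps U (S :|: T) = (eps U S + eps U T)%N.
Proof.
move=> dST; rewrite !epsE -big_split; apply: eq_bigr => i _ /=.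
rewrite -bigU //.
by apply: eq_bigl => j; rewrite !inE.
Qed.

Fact extalg_mulA : associative extalg_mul.
Proof.
move=> x y z; apply/ffunP => U; rewrite !ffunE.
have -> : \sum_(S : {set 'I_m} | S \subset U)
    (-1) ^+ eps S (U :\: S) * (extalg_mul x y S * z (U :\: S)) =
  \sum_(S : {set 'I_m} | S \subset U) \sum_(T : {set 'I_m} | T \subset S)
    (-1) ^+ eps S (U :\: S) * ((-1) ^+ eps T (S :\: T) *
      (x T * y (S :\: T)) * z (U :\: S)).
  by apply: eq_bigr => S _; rewrite ffunE mulr_suml mulr_sumr.
rewrite (exchange_big_dep (fun T : {set 'I_m} => T \subset U)) /=; last first.
  by move=> S T SU TS; apply: subset_trans SU.
apply: eq_bigr => T TU; rewrite ffunE !mulr_sumr.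
rewrite (reindex_onto (fun S : {set 'I_m} => S :\: T)
  (fun V : {set 'I_m} => T :|: V)) /=; last first.
  move=> V; rewrite subsetD => /andP[_ dVT].
  by rewrite setDUl setDv set0U; apply/setDidPl.
apply: esym; apply: eq_big => [S|S /andP[SU TS]].
  apply/idP/idP => [/andP[SU TS]|/andP[SU /eqP <-]].
    by rewrite setSD //= setUC setDE setUIl (setUC (~: _)) setUCr setIT (setUidPl TS).
  rewrite subsetUl andbT subUset TU.
  by apply: subset_trans SU _; apply: subsetDl.
have US : (U :\: T) :\: (S :\: T) = U :\: S.
  apply/setP => i; rewrite !inE; case: (boolP (i \in T)) => //= iT.
  by rewrite (subsetP TS).
have UTE : U :\: T = (S :\: T) :|: (U :\: S).
  apply/setP => i; rewrite !inE.
  case iT: (i \in T) => /=; first by rewrite (subsetP TS) ?iT.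
  by case iS: (i \in S) => //=; rewrite (subsetP SU).
rewrite US.
have dUS (W : {set 'I_m}) : W \subset S -> [disjoint W & U :\: S].
  move=> WS; rewrite -setI_eq0; apply/eqP/setP => i; rewrite !inE.
  by case: (boolP (i \in W)) => //= iW; rewrite (subsetP WS).
have -> : eps S (U :\: S) = (eps T (U :\: S) + eps (S :\: T) (U :\: S))%N.
  rewrite -epsUl ?setUDr; last by rewrite -setI_eq0 setIDA setIC setDIl setDv setI0.
  by congr eps; apply/setP => i; rewrite !inE; case: (boolP (i \in T)) => //= /(subsetP TS).
have -> : eps T (U :\: T) = (eps T (S :\: T) + eps T (U :\: S))%N.
  by rewrite -epsUr -?UTE // dUS // subsetDl.
rewrite !exprD; set a := _ ^+ _; set b := _ ^+ _; set c := _ ^+ _.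
by rewrite !mulrA; congr (_ * _); rewrite -!mulrA; lia.
Qed.

Fact extalg_mul1 : left_id extalg_one extalg_mul.
Proof.
move=> x; apply/ffunP => U; rewrite ffunE (bigD1 set0) ?sub0set //= big1.
  by rewrite ffunE eqxx eps0l setD0 !mul1r addr0.
by move=> S /andP[_ /negPf S0]; rewrite ffunE S0 mul0r mulr0.
Qed.

Fact extalg_mulr1 : right_id extalg_one extalg_mul.
Proof.
move=> x; apply/ffunP => U; rewrite ffunE (bigD1 U) //= big1.
  by rewrite setDv ffunE eqxx eps0r mulr1 mul1r addr0.
move=> S /andP[SU nSU]; rewrite ffunE setD_eq0.
suff -> : (U \subset S) = false by rewrite !mulr0.
by apply: contraNF nSU => US; rewrite eqEsubset SU.
Qed.

Fact extalg_mulDl : left_distributive extalg_mul +%R.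
Proof.
move=> x y z; apply/ffunP => U; rewrite !ffunE -big_split /=.
by apply: eq_bigr => S _; rewrite ffunE mulrDl mulrDr.
Qed.

Fact extalg_mulDr : right_distributive extalg_mul +%R.
Proof.
move=> x y z; apply/ffunP => U; rewrite !ffunE -big_split /=.
by apply: eq_bigr => S _; rewrite ffunE !mulrDr.
Qed.

HB.instance Definition _ := GRing.Zmodule_isPzRing.Build (extalg m)
  extalg_mulA extalg_mul1 extalg_mulr1 extalg_mulDl extalg_mulDr.

Lemma extalgME x y U : (x * y) U =
  \sum_(S : {set 'I_m} | S \subset U) (-1) ^+ eps S (U :\: S) * (x S * y (U :\: S)).
Proof. exact: ffunE. Qed.

Definition extalg_gen (i : 'I_m) : extalg m := extalg_mon [set i].

(* The ring morphism with v_i |-> 0. *)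
Definition extalg_aug (x : extalg m) : int := x set0.

Fact extalg_aug_zmod : zmod_morphism extalg_aug.
Proof. by move=> x y; rewrite /extalg_aug !ffunE. Qed.
HB.instance Definition _ := GRing.isZmodMorphism.Build (extalg m) int extalg_aug extalg_aug_zmod.

Fact extalg_aug_monoid : monoid_morphism extalg_aug.
Proof.
split=> [|x y]; first by rewrite /extalg_aug ffunE eqxx.
rewrite /extalg_aug extalgME (bigD1 set0) //= big1.
  by rewrite setD0 eps0l mul1r addr0.
by move=> S; rewrite subset0 => /andP[->].
Qed.
HB.instance Definition _ := GRing.isMonoidMorphism.Build (extalg m) int extalg_aug extalg_aug_monoid.

(* The ring morphism with v_i |-> - v_i. *)
Definition extalg_par (x : extalg m) : extalg m := [ffun S : {set 'I_m} => (-1) ^+ #|S| * x S].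

Fact extalg_par_zmod : zmod_morphism extalg_par.
Proof. by move=> x y; apply/ffunP => S; rewrite !ffunE mulrBr. Qed.
HB.instance Definition _ :=
  GRing.isZmodMorphism.Build (extalg m) (extalg m) extalg_par extalg_par_zmod.

Fact extalg_par_monoid : monoid_morphism extalg_par.
Proof.
split=> [|x y]; apply/ffunP => S; rewrite !ffunE.
  by case: eqP => [->|_]; rewrite ?mulr0 // cards0 mulr1.
rewrite mulr_sumr; apply: eq_bigr => T TS; rewrite !ffunE.
have -> : #|S| = (#|T| + #|S :\: T|)%N by rewrite -(cardsID T S) (setIidPr TS).
by rewrite exprD; set a := _ ^+ _; set b := _ ^+ _; set c := _ ^+ _; lia.
Qed.
HB.instance Definition _ :=
  GRing.isMonoidMorphism.Build (extalg m) (extalg m) extalg_par extalg_par_monoid.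

Lemma extalg_aug_gen i : extalg_aug (extalg_gen i) = 0.
Proof.
rewrite /extalg_aug ffunE; case: eqP => // /setP/(_ i).
by rewrite !inE eqxx.
Qed.

Lemma extalg_par_gen i : extalg_par (extalg_gen i) = - extalg_gen i.
Proof.
apply/ffunP => S; rewrite !ffunE; case: eqP => [->|_]; last by rewrite mulr0 oppr0.
by rewrite cards1 mulr1.
Qed.

End ExteriorAlgebra.

(** * Face rings *)

(* A ring generated by v_1, ..., v_m, with its augmentation and with the sign
   involution x |-> (-1)^|x| x of the internal degree; mg_odd tells whether the
   generators are odd or even. *)
Record mgalg (m : nat) := MGAlg {
  mg_ring :> pzRingType;
  mg_gen : 'I_m -> mg_ring;
  mg_odd : bool;
  mg_aug : {rmorphism mg_ring -> int};
  mg_par : {rmorphism mg_ring -> mg_ring};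
  mg_augE : forall i, mg_aug (mg_gen i) = 0;
  mg_parE : forall i, mg_par (mg_gen i) = (-1) ^+ mg_odd * mg_gen i }.

(* The monomial v_1 ^ d_1 ... v_m ^ d_m. *)
Definition mg_mon m (R : mgalg m) (d : 'X_{1..m}) : R :=
  \prod_(i < m) mg_gen R i ^+ d i.
(* The square-free monomial of S, the factors being in increasing order. *)
Definition mg_sqf m (R : mgalg m) (S : {set 'I_m}) : R :=
  \prod_(i in S) mg_gen R i.

Fact exterior_parE m i : extalg_par (extalg_gen i) = (-1) ^+ true * extalg_gen i :> extalg m.
Proof. by rewrite mulN1r; apply: extalg_par_gen. Qed.

Definition exterior_alg m : mgalg m :=
  @MGAlg m (extalg m) (@extalg_gen m) true (@extalg_aug m) (@extalg_par m)
    (@extalg_aug_gen m) (@exterior_parE m).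

Fact polynomial_augE m i : meval (fun=> 0) ('X_i : {mpoly int[m]}) = 0.
Proof. exact: mevalXU. Qed.
Fact polynomial_parE m i : 'X_i = (-1) ^+ false * 'X_i :> {mpoly int[m]}.
Proof. by rewrite mul1r. Qed.

(* The polynomial ring is commutative without signs, so its generators are even
   for the signs of the bar construction. *)
Definition polynomial_alg m : mgalg m :=
  @MGAlg m {mpoly int[m]} (fun i => 'X_i) false (meval (fun=> 0)) idfun
    (@polynomial_augE m) (@polynomial_parE m).

Record scomplex (m : nat) := SComplex {
  sc_faces :> {set {set 'I_m}};
  sc_set0 : set0 \in sc_faces;
  sc_down : forall S T : {set 'I_m}, S \in sc_faces -> T \subset S -> T \in sc_faces }.

Section FaceRing.
Variables (m : nat) (R : mgalg m).
Implicit Types K L : scomplex m.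

Definition sr_mon K (x : R) : Prop := exists2 S, S \notin sc_faces K & x = mg_sqf R S.

Definition face_ring K := ring_quot (sr_mon K).

Lemma sr_aug K x : sr_mon K x -> mg_aug R x = 0.
Proof.
case=> S SK ->; case: (set_0Vmem S) => [S0|[i iS]].
  by rewrite S0 sc_set0 in SK.
rewrite /mg_sqf rmorph_prod; under eq_bigr do rewrite mg_augE.
by rewrite (bigD1 i) //= mul0r.
Qed.

Lemma sr_sub K L (KL : sc_faces K \subset sc_faces L) x :
  sr_mon L x -> rq_pi (sr_mon K) x = 0.
Proof.
case=> S SL ->; apply/eqP; rewrite -(rmorph0 (rq_pi (sr_mon K))) rq_piE subr0.
apply: ideal_gen_in; exists S => //.
by apply: contraNN SL => /(subsetP KL).
Qed.

Lemma sr_par K x : sr_mon K x -> (rq_pi (sr_mon K) \o mg_par R) x = 0.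
Proof.
case=> S SK -> /=; rewrite /mg_sqf rmorph_prod.
have -> : \prod_(i in S) mg_par R (mg_gen R i) =
    (-1) ^+ (mg_odd R * #|S|) * mg_sqf R S.
  rewrite (eq_bigr (fun i => (-1) ^+ mg_odd R * mg_gen R i)); last first.
    by move=> i _; rewrite mg_parE.
  case: (mg_odd R) => /=.
    rewrite mul1n -prodrN; apply: eq_bigr => i _; exact: mulN1r.
  by rewrite mul1r; apply: eq_bigr => i _; rewrite mul1r.
have /(sr_sub (subxx _)) S0 : sr_mon K (mg_sqf R S) by exists S.
by rewrite rmorphM /= S0 mulr0.
Qed.

Fact face_augE K i : rq_lift (@sr_aug K) (rq_pi (sr_mon K) (mg_gen R i)) = 0.
Proof. by rewrite rq_lift_pi mg_augE. Qed.

Fact face_parE K i : rq_lift (@sr_par K) (rq_pi (sr_mon K) (mg_gen R i)) =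
  (-1) ^+ mg_odd R * rq_pi (sr_mon K) (mg_gen R i).
Proof. by rewrite rq_lift_pi /= mg_parE rmorphM rmorph_sign. Qed.

(* R / I_SR(K); the ideal is two-sided, R being the exterior or polynomial ring. *)
Definition face_alg K : mgalg m :=
  @MGAlg m (face_ring K) (fun i => rq_pi (sr_mon K) (mg_gen R i)) (mg_odd R)
    (rq_lift (@sr_aug K)) (rq_lift (@sr_par K)) (face_augE K) (face_parE K).

(* The projection R / I_SR(L) -> R / I_SR(K). *)
Definition face_proj K L (KL : sc_faces K \subset sc_faces L) :
  {rmorphism face_alg L -> face_alg K} := rq_lift (sr_sub KL).
End FaceRing.

Definition exterior_face m (K : scomplex m) : mgalg m := face_alg (exterior_alg m) K.
Definition polynomial_face m (K : scomplex m) : mgalg m := face_alg (polynomial_alg m) K.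

(** * Ext of the trivial module *)

Section Ext.
Variables (m : nat) (R : mgalg m).
Implicit Types (s t : nat) (I J : 'X_{1..m}) (phi psi : seq R -> int).

(* R is spanned by its monomials, so that its part of multi-degree d is
   spanned by mg_mon R d. *)
Definition mg_homog (d : 'X_{1..m}) (x : R) : Prop :=
  exists c : int, x = mg_mon R d *~ c.

(* The normalised bar resolution of Z over R is R (x) Rbar^(x)s in homological
   degree s, where Rbar = R / Z. The group Hom_R(R (x) Rbar^(x)s, Z) is that of
   the s-additive maps R^s -> Z which vanish as soon as an argument is 1. A map
   of s variables is encoded as a function on sequences that is zero outside of
   the sequences of size s. It is of multi-degree I when it is zero on the
   homogeneous tuples of total multi-degree other than I. *)
Record is_cochain s I (phi : seq R -> int) : Prop := IsCochain {
  coch_size : forall a, size a != s -> phi a = 0;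
  coch_add : forall a b x y,
    phi (a ++ x + y :: b) = phi (a ++ x :: b) + phi (a ++ y :: b);
  coch_norm : forall a b, phi (a ++ 1 :: b) = 0;
  coch_deg : forall u : seq ('X_{1..m} * R),
    (forall p, p \in u -> mg_homog p.1 p.2) ->
    \big[+%MM/0%MM]_(p <- u) p.1 != I -> phi [seq p.2 | p <- u] = 0 }.

(* The dual of the bar differential, with the signs of the bar construction of a
   ring whose elements have the parity recorded by mg_par. On arguments in the
   augmentation ideal only the middle sum remains, and there
   phi(.., x_i x_(i+1), ..) has the sign
   (-1) ^ ((|x_0| - 1) + ... + (|x_(i-1)| - 1) + |x_i|). *)
Definition cobound phi : seq R -> int := fun a =>
  if a is a0 :: a' then
    - (mg_aug R a0 * phi a')
    + \sum_(i < size a') (-1) ^+ i *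
        phi (map (mg_par R) (take i a) ++
             mg_par R (nth 0 a i) * nth 0 a i.+1 :: drop i.+2 a)
    + (-1) ^+ size a' * (phi (map (mg_par R) (belast a0 a')) * mg_aug R (last a0 a'))
  else 0.

Lemma is_cochain0 s I : is_cochain s I 0.
Proof. by split=> // *; rewrite addr0. Qed.

Lemma is_cochainB s I phi psi :
  is_cochain s I phi -> is_cochain s I psi -> is_cochain s I (phi - psi).
Proof.
move=> [p1 p2 p3 p4] [q1 q2 q3 q4]; split.
- by move=> a sa; rewrite !fctE p1 ?q1.
- by move=> a b x y; rewrite !fctE p2 q2 opprD addrACA.
- by move=> a b; rewrite !fctE p3 q3.
- by move=> u hu uI; rewrite !fctE p4 ?q4.
Qed.

Lemma cobound0 : cobound 0 = 0.
Proof.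
apply/funext => -[//|a0 a] /=.
by rewrite big1 => [|i _]; rewrite ?mul0r ?mulr0 ?oppr0 ?addr0.
Qed.

Lemma coboundB phi psi : cobound (phi - psi) = cobound phi - cobound psi.
Proof.
apply/funext => -[//|a0 a]; rewrite !fctE /cobound.
under eq_bigr do rewrite mulrBr.
by rewrite sumrB /=; ring.
Qed.

Definition cocycle_pred s I : {pred seq R -> int} :=
  fun phi => `[< is_cochain s I phi /\ cobound phi = 0 >].

Fact cocycle_zmod s I : zmod_closed (cocycle_pred s I).
Proof.
split=> [|phi psi /asboolP[cphi dphi] /asboolP[cpsi dpsi]]; apply/asboolP.
  by split; [exact: is_cochain0|exact: cobound0].
by split; [exact: is_cochainB|rewrite coboundB dphi dpsi subrr].
Qed.
HB.instance Definition _ s I :=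
  GRing.isZmodClosed.Build (seq R -> int) (cocycle_pred s I) (cocycle_zmod s I).

Record cocycle s I := Cocycle {
  cocycle_val : seq R -> int;
  cocycle_valP : cocycle_val \in cocycle_pred s I }.
HB.instance Definition _ s I := [isSub for @cocycle_val s I].
HB.instance Definition _ s I := [Choice of cocycle s I by <:].
HB.instance Definition _ s I := [SubChoice_isSubZmodule of cocycle s I by <:].

Definition is_prev_cochain s I psi : Prop :=
  if s is t.+1 then is_cochain t I psi else psi = 0.

Definition coboundary s I : {pred cocycle s I} := fun f =>
  `[< exists2 psi, is_prev_cochain s I psi & val f = cobound psi >].

Fact coboundary_zmod s I : zmod_closed (@coboundary s I).
Proof.
split=> [|f g /asboolP[phi cphi fE] /asboolP[psi cpsi gE]]; apply/asboolP.
  exists 0; last by rewrite cobound0.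
  by case: s => //= s; apply: is_cochain0.
exists (phi - psi); last by rewrite raddfB /= fE gE coboundB.
case: s {f g fE gE} cphi cpsi => /= [-> ->|s]; last exact: is_cochainB.
by rewrite subrr.
Qed.
HB.instance Definition _ s I :=
  GRing.isZmodClosed.Build (cocycle s I) (@coboundary s I) (@coboundary_zmod s I).

(* Ext_R^{s,I}(Z, Z) *)
Definition Ext s I : Type := {ideal_quot (@coboundary s I)}.
HB.instance Definition _ s I := GRing.Zmodule.on (Ext s I).

Definition Ext_repr s I (x : Ext s I) : seq R -> int :=
  val (repr (x : {ideal_quot (@coboundary s I)})).

(* The class of the cocycle phi, and a dummy value when phi is not a cocycle. *)
Definition Ext_class s I phi : Ext s I :=
  \pi_{ideal_quot (@coboundary s I)} (insubd 0 phi).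

(* The product of the cobar construction, which is the concatenation of words.
   The cup product of two cocycles is a cocycle, see cocycle_cup. *)
Definition cup s phi psi : seq R -> int := fun a => phi (take s a) * psi (drop s a).

Definition Ext_mul s t I J (x : Ext s I) (y : Ext t J) : Ext (s + t) (I + J)%MM :=
  Ext_class (s + t) (I + J)%MM (cup s (Ext_repr x) (Ext_repr y)).

End Ext.

Section CupCocycle.
Variables (m : nat) (R : mgalg m).
Implicit Types (s t : nat) (I J : 'X_{1..m}) (phi psi : seq R -> int) (a b c : seq R).
Local Notation merge phi i a := ((-1) ^+ i *
        phi (map (mg_par R) (take i a) ++
             mg_par R (nth 0 a i) * nth 0 a i.+1 :: drop i.+2 a)).

Lemma coboundE phi a n : size a = n.+1 -> cobound phi a =
  - (mg_aug R (head 0 a) * phi (behead a)) + \sum_(0 <= i < n) merge phi i a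
  + (-1) ^+ n * (phi (map (mg_par R) (take n a)) * mg_aug R (last 0 a)).
Proof.
case: a => // a0 a [<-]; rewrite /cobound big_mkord.
suff -> : take (size a) (a0 :: a) = belast a0 a by [].
by elim: a a0 => //= a1 a IH a0; rewrite -IH.
Qed.

Lemma cobound_cup phi psi b x c :
  cobound (cup (size b) phi psi) (b ++ x :: c) =
    cobound phi (rcons b x) * psi c
    + (-1) ^+ size b * phi (map (mg_par R) b) * cobound psi (x :: c).
Proof.
set s := size b; set t := size c.
rewrite (@coboundE _ _ (s + t)%N); last by rewrite size_cat /= addnS.
rewrite (@coboundE _ _ s); last by rewrite size_rcons.
rewrite (@coboundE _ (x :: c) t) //.
rewrite last_rcons (_ : take s (rcons b x) = b); last first.
  by rewrite -cats1 take_size_cat.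
have -> : head 0 (b ++ x :: c) = head 0 (rcons b x) by case: (b).
have -> : last 0 (b ++ x :: c) = last 0 (x :: c) by rewrite last_cat.
have -> : cup s phi psi (behead (b ++ x :: c)) = phi (behead (rcons b x)) * psi c.
  rewrite /cup /s; case: (b) => [|b0 b'] /=; first by rewrite take0 drop0.
  by rewrite -cat_rcons take_size_cat ?size_rcons // drop_size_cat ?size_rcons.
have -> : cup s phi psi (map (mg_par R) (take (s + t) (b ++ x :: c))) =
    phi (map (mg_par R) b) * psi (map (mg_par R) (take t (x :: c))).
  rewrite /cup -map_take -map_drop.
  have -> : take (s + t) (b ++ x :: c) = b ++ take t (x :: c).
    by rewrite take_cat ltnNge leq_addr /= addKn.
  by rewrite take_size_cat // drop_size_cat.
rewrite (@big_cat_nat _ _ _ s) ?leq_addr //=.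
have -> : \sum_(0 <= i < s) merge (cup s phi psi) i (b ++ x :: c) =
    (\sum_(0 <= i < s) merge phi i (rcons b x)) * psi c.
  rewrite mulr_suml !big_nat; apply: eq_bigr => i /andP[_ lis].
  rewrite -mulrA; congr (_ * _).
  rewrite -cat_rcons !nth_cat size_rcons ltnS (ltnW lis) ltnS lis.
  rewrite takel_cat ?size_rcons 1?ltnW // 1?ltnW //.
  rewrite drop_cat size_rcons ltnS; case: ltnP => [lis1|lsi1].
    rewrite /cup -cat_cons catA take_size_cat ?drop_size_cat //.
      by rewrite size_cat /= size_map size_drop size_takel size_rcons; lia.
    by rewrite size_cat /= size_map size_drop size_takel size_rcons; lia.
  have -> : (i.+2 - s.+1 = 0)%N by lia.
  rewrite drop0 (@drop_oversize _ i.+2 (rcons b x)) ?size_rcons //.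
  rewrite /cup -cat1s catA take_size_cat ?drop_size_cat //.
    by rewrite size_cat /= size_map size_takel ?size_rcons; lia.
  by rewrite size_cat /= size_map size_takel ?size_rcons; lia.
have -> : \sum_(s <= i < s + t) merge (cup s phi psi) i (b ++ x :: c) =
    (-1) ^+ s * phi (map (mg_par R) b) * \sum_(0 <= i < t) merge psi i (x :: c).
  rewrite -{1}[s]add0n big_addn addKn mulr_sumr.
  apply: eq_bigr => i _; rewrite addnC exprD.
  rewrite !nth_cat -addnS !ltnNge !leq_addr /= !addKn.
  rewrite -!addnS take_cat drop_cat !ltnNge !leq_addr /= !addKn map_cat -catA.
  rewrite /cup take_size_cat ?size_map // drop_size_cat ?size_map //.
  have -> : (s + i.+1 <= size b)%N = false by rewrite /s; lia.
  by rewrite /=; ring.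
by rewrite exprD /=; ring.
Qed.

Lemma is_cochain_cup s t I J phi psi : is_cochain s I phi -> is_cochain t J psi ->
  is_cochain (s + t) (I + J)%MM (cup s phi psi).
Proof.
move=> [p1 p2 p3 p4] [q1 q2 q3 q4].
have cat_cup a x b : cup s phi psi (a ++ x :: b) =
    if (size a < s)%N then phi (a ++ x :: take (s - (size a).+1) b) *
      psi (drop (s - (size a).+1) b)
    else phi (take s a) * psi (drop s a ++ x :: b).
  rewrite /cup take_cat drop_cat.
  case: (ltngtP (size a) s) => [as1|as1|as1].
  - by have -> : (s - size a = (s - (size a).+1).+1)%N by lia.
  - by [].
  - by rewrite -as1 subnn take0 drop0 cats0 take_size drop_size.
split.
- move=> a sa; rewrite /cup; case: (eqVneq (size (take s a)) s) => [e|/p1->].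
    rewrite q1 ?mulr0 // size_drop; apply: contra_neq sa => <-.
    by move: e; rewrite size_take; case: ltnP => // + e; lia.
  by rewrite mul0r.
- move=> a b x y; rewrite !cat_cup; case: ifP => _.
    by rewrite p2 mulrDl.
  by rewrite q2 mulrDr.
- move=> a b; rewrite cat_cup; case: ifP => _; first by rewrite p3 mul0r.
  by rewrite q3 mulr0.
- move=> u hu; rewrite /cup -map_take -map_drop.
  rewrite -[u in X in X -> _](cat_take_drop s) big_cat /= => IJ.
  have [e|nI] := eqVneq (\big[+%MM/0%MM]_(p <- take s u) p.1) I; last first.
    by rewrite p4 ?mul0r // => p /mem_take; apply: hu.
  rewrite q4 ?mulr0 //; first by move=> p /mem_drop; apply: hu.
  by apply: contra_neq IJ => ->; rewrite e.
Qed.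

Lemma cocycle_cup s t I J phi psi :
  phi \in cocycle_pred s I -> psi \in cocycle_pred t J ->
  cup s phi psi \in cocycle_pred (s + t) (I + J)%MM.
Proof.
move=> /asboolP[cphi dphi] /asboolP[cpsi dpsi]; apply/asboolP.
split; first exact: is_cochain_cup.
have {}dphi c : cobound phi c = 0 by rewrite dphi.
have {}dpsi c : cobound psi c = 0 by rewrite dpsi.
apply/funext => a; have [sa|sa] := ltnP s (size a).
  rewrite -(cat_take_drop s a) (drop_nth 0) //.
  by rewrite -{1}(size_takel (ltnW sa)) cobound_cup dphi dpsi mul0r mulr0.
case: a sa => // a0 a /= sa.
have c0 c : (size c < s)%N -> cup s phi psi c = 0.
  move=> cs; rewrite /cup take_oversize 1?ltnW // (coch_size cphi) ?mul0r //.
  by rewrite neq_ltn cs.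
rewrite /cobound !c0 //=; last by rewrite size_map size_belast; lia.
rewrite big1 => [|i _]; first by rewrite mulr0 mul0r mulr0 oppr0 !addr0.
have ia := ltn_ord i.
rewrite c0 ?mulr0 // size_cat size_map /= size_drop size_takel /=; last by move: (ltn_ord i); lia.
by move: ia sa; clear; lia.
Qed.
End CupCocycle.

(** * Functoriality *)

(* The map induced by a morphism g of augmented multigraded rings; the pull-back of
   a cocycle is a cocycle, see cocycle_pullback and cocycle_face_proj. *)
Definition Ext_map m (R R' : mgalg m) (g : {rmorphism R' -> R}) s I
    (x : Ext R s I) : Ext R' s I :=
  Ext_class s I (fun a => Ext_repr x (map g a)).

Section Pullback.
Variables (m : nat) (R R' : mgalg m) (g : {rmorphism R' -> R}).
Hypotheses (g_gen : forall i, g (mg_gen R' i) = mg_gen R i)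
  (g_aug : forall x, mg_aug R (g x) = mg_aug R' x)
  (g_par : forall x, mg_par R (g x) = g (mg_par R' x)).

Lemma cocycle_pullback s I (phi : seq R -> int) : phi \in cocycle_pred s I ->
  (fun a => phi (map g a)) \in cocycle_pred s I.
Proof.
move=> /asboolP[[p1 p2 p3 p4] dphi]; apply/asboolP; split.
  split=> [a sa|a b x y|a b|u hu uI].
  - by rewrite p1 ?size_map.
  - by rewrite !map_cat /= rmorphD p2.
  - by rewrite map_cat /= rmorph1 p3.
  - rewrite -map_comp -[RHS](p4 [seq (p.1, g p.2) | p <- u]) ?big_map //.
      by rewrite -map_comp.
    move=> _ /mapP[p pu ->] /=; have [c ->] := hu p pu; exists c.
    rewrite rmorphMz /mg_mon rmorph_prod; congr (_ *~ c).
    by apply: eq_bigr => i _; rewrite rmorphXn /= g_gen.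
apply/funext => -[//|a0 a].
transitivity (cobound phi (map g (a0 :: a))); last by rewrite dphi.
have parC b : map (mg_par R) (map g b) = map g (map (mg_par R') b).
  by rewrite -!map_comp; apply: eq_map => x /=; rewrite g_par.
rewrite /cobound /= !size_map !g_aug last_map g_aug.
congr (_ + _ + _ * (phi _ * _)); last first.
  by rewrite -parC; congr map; elim: (a) (a0) => //= a1 b IH b0; rewrite IH.
apply: eq_bigr => i _; congr (_ * phi _).
rewrite -[g a0 :: map g a]/(map g (a0 :: a)) -map_take -map_drop parC.
have ia : (i < size (a0 :: a))%N by rewrite /= ltnW // ltnS.
by rewrite (nth_map 0 0 g ia) (nth_map 0) // map_cat /= rmorphM /= g_par.
Qed.
End Pullback.

Lemma cocycle_face_proj m (R : mgalg m) (K L : scomplex m)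
    (KL : sc_faces K \subset sc_faces L) s I (phi : seq (face_alg R K) -> int) :
  phi \in cocycle_pred s I ->
  (fun a => phi (map (face_proj R KL) a)) \in cocycle_pred s I.
Proof.
have projE x : face_proj R KL (rq_pi (sr_mon L) x) = rq_pi (sr_mon K) x.
  exact: rq_lift_pi.
have parE M y : mg_par (face_alg R M) (rq_pi (sr_mon M) y) =
    rq_pi (sr_mon M) (mg_par R y) by exact: rq_lift_pi.
apply: cocycle_pullback => [i|x|x]; first exact: projE.
- by elim/rq_ind: x => x; rewrite projE /= !rq_lift_pi.
- by elim/rq_ind: x => x; rewrite projE !parE projE.
Qed.

(** * The operations mu_(j,k) *)

Section Mu.
Variables (m : nat) (K : scomplex m).
Local Notation wK := (exterior_face K).
Implicit Types (S T : {set 'I_m}) (w : seq {set 'I_m}) (j : 'I_m).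

Definition simplex S : bool := (S \in sc_faces K) && (S != set0).

(* The letters of w are numbered from 1, and q is the smallest number such that
   exactly k of the q first letters contain j. *)
Definition mu_word j (k : nat) w : {freeg (seq {set 'I_m}) / int} :=
  let q := find (fun p => count (fun S : {set 'I_m} => j \in S) (take p w) == k)
             (iota 0 (size w).+1) in
  let S := nth set0 w q.-1 :\ j in
  \sum_(T in powerset S)
    << (-1) ^+ eps T (S :\: T) *g
       take q.-1 w ++ [:: j |: T; j |: (S :\: T)] ++ drop q w >>.

Definition mu_T j k : {freeg (seq {set 'I_m}) / int} -> {freeg (seq {set 'I_m}) / int} :=
  fglift (mu_word j k).

(* The complex of the cochains of multi-degree I for the exterior face ring is
   T_K(I), the cochain phi being the sum of the phi(v_sigma(1), .., v_sigma(s))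
   (sigma(1)| .. |sigma(s)) over the words in the non-empty simplices; the
   inverse isomorphism is cochain_of_T. *)
Definition T_of_cochain s (phi : seq wK -> int) : {freeg (seq {set 'I_m}) / int} :=
  \sum_(w : s.-tuple {set 'I_m} | all simplex w)
    << phi (map (@mg_sqf m wK) w) *g (w : seq {set 'I_m}) >>.

(* The coefficient of v_S, which is well defined on the exterior face ring when S
   is a simplex, see face_coef_pi. *)
Definition face_coef S (x : wK) : int := (rq_repr x : extalg m) S.

Definition cochain_of_T (t : {freeg (seq {set 'I_m}) / int}) : seq wK -> int :=
  fun a => \sum_(w <- dom t | size w == size a)
    coeff w t * \prod_(p <- zip w a) face_coef p.1 p.2.

(* mu_(j,k) : A_{n,I-e_j} -> A_{n,I}, of use for 1 <= k < i_j only. As n is |I|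
   minus the homological degree, the latter is raised by one. Since mu_T commutes
   with the differential of T_K, Ext_class is applied to a cocycle. *)
Definition Ext_mu s (I : 'X_{1..m}) j k (x : Ext wK s (I - U_(j))%MM) : Ext wK s.+1 I :=
  Ext_class s.+1 I (cochain_of_T (mu_T j k (T_of_cochain s (Ext_repr x)))).

(* The sum of the mu_(j,k)(A_{n,I-e_j}) for i_j >= 2 and 1 <= k <= i_j - 1. For s = 0 the groups
   A_{n,I-e_j} are in homological degree -1 and therefore zero. *)
Definition in_mu_span s : forall I : 'X_{1..m}, Ext wK s I -> Prop :=
  match s with
  | 0 => fun I x => x = 0
  | t.+1 => fun I x => exists y : forall (j : 'I_m) (k : nat), Ext wK t (I - U_(j))%MM,
      x = \sum_(j < m | (1 < I j)%N) \sum_(1 <= k < I j) Ext_mu k (y j k)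
  end.
End Mu.

Lemma face_coef_pi m (K : scomplex m) (S : {set 'I_m}) (x : extalg m) :
  S \in sc_faces K ->
  face_coef S (rq_pi (sr_mon (R := exterior_alg m) K) x : exterior_face K) = x S.
Proof.
have mulS (T U : {set 'I_m}) (y z : extalg m) :
    (forall V : {set 'I_m}, y V != 0 -> T \subset V) ->
    (forall V : {set 'I_m}, z V != 0 -> U \subset V) ->
    forall V : {set 'I_m}, (y * z) V != 0 -> T :|: U \subset V.
  move=> hy hz V; apply: contraNT => nTU; rewrite extalgME big1 // => W WV.
  have [/eqP->|/hy TW] := boolP (y W == 0); first by rewrite mul0r mulr0.
  have [/eqP->|/hz UW] := boolP (z (V :\: W) == 0); first by rewrite !mulr0.
  case/negP: nTU; rewrite subUset (subset_trans TW WV).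
  exact: subset_trans UW (subsetDl _ _).
have genS i (V : {set 'I_m}) : extalg_gen i V != 0 -> [set i] \subset V.
  by rewrite ffunE; case: (V =P [set i]) => [->|_]; rewrite ?subxx ?eqxx.
have sqfS (T V : {set 'I_m}) : (mg_sqf (exterior_alg m) T : extalg m) V != 0 -> T \subset V.
  suff h (r : seq 'I_m) W : (\prod_(i <- r) extalg_gen i : extalg m) W != 0 ->
      [set i in r] \subset W.
    rewrite /mg_sqf -big_filter => /h hV; apply: subset_trans hV; apply/subsetP => i iT.
    by rewrite inE mem_filter iT mem_index_enum andbT.
  elim: r W => [|i r IH] W; first by rewrite set_nil sub0set.
  rewrite big_cons set_cons => h; exact: (mulS _ _ _ _ (genS i) IH W h).
move=> SK; apply/eqP; rewrite -subr_eq0; apply/eqP.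
have : rq_repr (rq_pi (sr_mon (R := exterior_alg m) K) x) - x
    \in ideal_gen (sr_mon (R := exterior_alg m) K).
  by rewrite -rq_piE rq_reprK.
move=> /ideal_genP[t [Gt e]].
transitivity ((\sum_(u <- t) u.1.1 * u.1.2 * u.2 : extalg m) S).
  by rewrite -e !ffunE.
rewrite sum_ffunE big_seq big1 // => u /Gt[T TK ->].
apply/eqP; apply: contraNT TK => h; apply: sc_down SK _.
have all0 (y : extalg m) V : y V != 0 -> set0 \subset V by rewrite sub0set.
have := mulS _ _ _ _ (mulS _ _ _ _ (all0 _) (sqfS T)) (all0 _) S h.
by rewrite set0U setU0.
Qed.

(* Main.v *)
From HB Require Import structures.
Require Import Defs.
From mathcomp Require Import all_boot all_order all_algebra.
From mathcomp Require Import generic_quotient ring_quotient.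
From mathcomp Require Import mpoly freeg boolp functions zify ring.

Set Implicit Arguments.
Unset Strict Implicit.
Unset Printing Implicit Defensive.

Import GRing.Theory.

Local Open Scope ring_scope.

(** Multi-graded cochains of either face ring are integer-valued functions on words
    of monomials. After the sign change [wsign], both bar differentials become
    [sum_i (-1)^i g (.., x_i x_(i+1), ..)], and the exterior cochains are the
    functions that vanish on words with a letter that is not square-free. So the
    exterior complex is a subcomplex of the polynomial one; f is induced by the
    inclusion.

    For c : 'X_{1..m} let C(c) consist of the functions supported on the words
    whose k-th and (k+1)-st occurrences of j lie in different letters for k >= c_j.
    These subcomplexes interpolate between the exterior (c = 0) and the polynomial
    case (c large). If k = c_j > 0, doubling the k-th occurrence of j gives a
    quotient map q from C(c + e_j) in multi-degree I to C(c) in multi-degree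
    I - e_j, whose kernel is C(c) in multi-degree I. Inserting e_j as a letter of its own
    between the k-th and (k+1)-st occurrences of j gives a null-homotopy of q, so the
    long exact sequence splits into short ones: H(C(c)) -> H(C(c + e_j)) is onto, and
    its kernel is the image of the connecting map, which is mu_(j,k) up to sign. *)

(** * Words and their differential *)

(** The connecting map at stage c takes cocycles of C(c) as arguments, whereas mu_(j,k) is defined
    on exterior classes only. In the computation of the kernel, each such cocycle is therefore first
    moved to an exterior one, by the surjectivity already known for the lower stages; this changes
    the result by a coboundary from C(c). For an exterior cocycle z, the lift [secw j k z] is
    supported on words in which at most one letter contains j twice, and its coboundary is again
    exterior. It depends on j and k only, not on the other entries of c.

    Passing from c_j = 0 to c_j = 1 changes nothing, and neither does a step with c_j >= i_j. What
    remains are the values 1 <= k <= i_j - 1 of (2).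

    The sign in (1) measures the failure of [wsign] to be additive under concatenation. It enters on
    the exterior side only, the generators of the polynomial ring being even. *)

Lemma fct_mulrz (T : Type) (V : zmodType) (f : T -> V) (c : int) x :
  (f *~ c) x = f x *~ c.
Proof.
case: c => n; first by rewrite -!pmulrn natmulfctE.
by rewrite !NegzE !mulrNz opprfctE -!pmulrn natmulfctE.
Qed.

Lemma fctB (T : Type) (V : zmodType) (f g : T -> V) x : (f - g) x = f x - g x.
Proof. by []. Qed.

Section Words.
Variable m : nat.
Local Notation mon := 'X_{1..m}.
Local Notation word := (seq mon).
Implicit Types (x y : mon) (u v w : word) (g : word -> int) (j : 'I_m) (k c : nat).

Lemma zero_mnm1 j : (0%MM == U_(j)%MM :> mon) = false.
Proof. by apply/negP => /eqP/mnmP/(_ j); rewrite mnm0E mnm1E eqxx. Qed.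

Lemma zero_mnmD x y : (0%MM == (x + y)%MM :> mon) = (0%MM == x) && (0%MM == y).
Proof.
apply/eqP/andP => [/mnmP h|[/eqP <- /eqP <-]]; last by apply/mnmP => i; rewrite mnmDE !mnm0E.
by split; apply/eqP/mnmP => i; move: (h i); rewrite mnmDE !mnm0E; lia.
Qed.

Definition shift x g : word -> int := fun u => g (x :: u).

Definition merge_head x g : word -> int :=
  fun u => if u is y :: v then g ((x + y)%MM :: v) else 0.

Fixpoint d0 g w : int :=
  if w is x :: u then merge_head x g u - d0 (shift x g) u else 0.

Definition nzw g : word -> int := fun w => if 0%MM \in w then 0 else g w.

(** The two outer terms of [cobound] contribute only on words with the letter 0, where they make the
    total of a normalised cochain vanish. [d0] omits them, so this value is imposed by [nzw]. *)
Definition dw g : word -> int := nzw (d0 g).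

(* insw g w is the alternating sum of the values of g at the words obtained from w by
   inserting the letter U_(j) between the k-th and (k+1)-st occurrences of j, the sign
   being that of the position; dblw g w is the value of g at w with the k-th occurrence
   of j doubled; secw g w is its value at w with the (k+1)-st occurrence of j removed,
   provided that the k-th and (k+1)-st occurrences share a letter, and 0 otherwise. *)
Fixpoint insw j k g w : int :=
  (if k == 0%N then g (U_(j)%MM :: w) else 0) -
  (if w is x :: u then if (x j <= k)%N then insw j (k - x j) (shift x g) u else 0
   else 0).

Fixpoint dblw j k g w : int :=
  if w is x :: u then
    if (0 < k <= x j)%N then g ((x + U_(j))%MM :: u) else dblw j (k - x j) (shift x g) u
  else 0.

Fixpoint secw j k g w : int :=
  if w is x :: u then
    if (0 < k < x j)%N then g ((x - U_(j))%MM :: u) else secw j (k - x j) (shift x g) u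
  else 0.

(** What is left of the homotopy: at each letter x, the inserted letter U_(j) is merged into x from
    the left if exactly k occurrences of j precede x, and from the right, with the opposite sign, if
    exactly k occurrences precede the end of x. *)
Fixpoint defect j k g w : int :=
  if w is x :: u then
    ((k == 0%N)%:R - (x j == k)%:R) * g ((x + U_(j))%MM :: u)
    + (if (x j <= k)%N then defect j (k - x j) (shift x g) u else 0)
  else 0.

Fact shift_zmod x : zmod_morphism (shift x). Proof. by []. Qed.
HB.instance Definition _ x := GRing.isZmodMorphism.Build _ _ (shift x) (shift_zmod x).

Fact merge_head_zmod x : zmod_morphism (merge_head x).
Proof. by move=> g g'; apply/funext => -[|y v] //; rewrite /= subrr. Qed.
HB.instance Definition _ x :=
  GRing.isZmodMorphism.Build _ _ (merge_head x) (merge_head_zmod x).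

Fact d0_zmod : zmod_morphism d0.
Proof.
move=> g g'; apply/funext => w; elim: w g g' => [|x u IH] g g' //.
rewrite [LHS]/= !raddfB IH !fctB /=; ring.
Qed.
HB.instance Definition _ := GRing.isZmodMorphism.Build _ _ d0 d0_zmod.

Fact nzw_zmod : zmod_morphism nzw.
Proof. by move=> g g'; apply/funext => w; rewrite !fctE /nzw; case: ifP; rewrite ?subrr. Qed.
HB.instance Definition _ := GRing.isZmodMorphism.Build _ _ nzw nzw_zmod.

Fact dw_zmod : zmod_morphism dw.
Proof. by move=> g g'; rewrite /dw !raddfB. Qed.
HB.instance Definition _ := GRing.isZmodMorphism.Build _ _ dw dw_zmod.

Fact insw_zmod j k : zmod_morphism (insw j k).
Proof.
move=> g g'; apply/funext => w; elim: w k g g' => [|x u IH] k g g' /=.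
  by rewrite !fctB /=; case: eqP; rewrite ?subr0.
by rewrite raddfB IH !fctB /=; do !case: ifP => _; ring.
Qed.
HB.instance Definition _ j k := GRing.isZmodMorphism.Build _ _ (insw j k) (insw_zmod j k).

Fact dblw_zmod j k : zmod_morphism (dblw j k).
Proof.
move=> g g'; apply/funext => w; elim: w k g g' => [|x u IH] k g g' /=.
  by rewrite fctB subrr.
by rewrite raddfB IH !fctB /=; do !case: ifP => _.
Qed.
HB.instance Definition _ j k := GRing.isZmodMorphism.Build _ _ (dblw j k) (dblw_zmod j k).

Fact secw_zmod j k : zmod_morphism (secw j k).
Proof.
move=> g g'; apply/funext => w; elim: w k g g' => [|x u IH] k g g' /=.
  by rewrite fctB subrr.
by rewrite raddfB IH !fctB /=; do !case: ifP => _.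
Qed.
HB.instance Definition _ j k := GRing.isZmodMorphism.Build _ _ (secw j k) (secw_zmod j k).

Lemma shift_d0 x g : shift x (d0 g) = merge_head x g - d0 (shift x g).
Proof. by []. Qed.

Lemma d0_d0 g : d0 (d0 g) = 0.
Proof.
apply/funext => w; elim: w g => [|x u IH] g //=.
rewrite shift_d0 d0_zmod fctB IH subr0.
case: u {IH} => [|y v] /=; first by rewrite subrr.
suff -> : merge_head y (merge_head x g) = merge_head (x + y)%MM g.
  by rewrite [X in _ - X]/= subrr.
by apply/funext => -[|z t] //=; rewrite addmA.
Qed.

(** A merge of two letters of w commutes with an insertion elsewhere, and the two orders carry
    opposite signs. Only the merges that involve the inserted letter survive. *)
Lemma insw_homotopy j k g : d0 (insw j k g) + insw j k (d0 g) = defect j k g.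
Proof.
apply/funext => w; rewrite fctE.
elim: w k g => [|x u IH] k g; first by rewrite /= subrr; case: ifP; rewrite add0r subr0.
have shift_ins : shift x (insw j k g) =
    (if k == 0%N then shift x (shift U_(j)%MM g) else 0) -
    (if (x j <= k)%N then insw j (k - x j) (shift x g) else 0).
  by apply/funext => v; rewrite !fctB /shift /=; case: ifP => _; case: ifP.
have -> : d0 (insw j k g) (x :: u) = merge_head x (insw j k g) u -
    (if k == 0%N then d0 (shift x (shift U_(j)%MM g)) u else 0) +
    (if (x j <= k)%N then d0 (insw j (k - x j) (shift x g)) u else 0).
  rewrite [LHS]/= shift_ins d0_zmod fctB.
  by case: ifP => _; case: ifP => _; rewrite ?raddf0 /=; ring.
have -> : insw j k (d0 g) (x :: u) =
   (if k == 0%N then g ((U_(j) + x)%MM :: u) - merge_head x (shift U_(j)%MM g) u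
      + d0 (shift x (shift U_(j)%MM g)) u else 0)
   - (if (x j <= k)%N then insw j (k - x j) (merge_head x g) u else 0)
   + (if (x j <= k)%N then insw j (k - x j) (d0 (shift x g)) u else 0).
  rewrite [LHS]/= shift_d0 insw_zmod fctB /=.
  by case: ifP => _; case: ifP => _; ring.
have := IH (k - x j)%N (shift x g).
rewrite [defect j k g _]/= => <-.
(* The correction term removes the insertion between x and the first letter of u, for which the
   merged word has no room. *)
suff e : merge_head x (insw j k g) u =
    (if k == 0%N then merge_head x (shift U_(j)%MM g) u else 0)
    - (x j == k)%:R * g ((x + U_(j))%MM :: u)
    + (if (x j <= k)%N then insw j (k - x j) (merge_head x g) u else 0).
  rewrite e addmC; case: (k == 0%N) => /=; case: (x j == k) => /=; case: ifP => _ /=; ring.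
have xk : (x j <= k)%N && (k - x j == 0)%N = (x j == k) by lia.
case: u {IH} => [|y v] /=.
  by rewrite subr0 -xk; do !case: ifP => _ //=; ring.
have -> : shift y (merge_head x g) = shift (x + y)%MM g by [].
rewrite mnmDE -xk subnDA; case: (leqP (x j) k) => [xk'|kx] /=.
  have -> : (x j + y j <= k)%N = (y j <= k - x j)%N by lia.
  by do !case: ifP => _ //=; ring.
have -> : (x j + y j <= k)%N = false by lia.
by do !case: ifP => _ //=; ring.
Qed.

(** Merging preserves the order of the occurrences of j, so doubling the k-th one in a merged letter
    is doubling it in the factor that contains it. *)
Lemma dblw_d0 j k g : dblw j k (d0 g) = d0 (dblw j k g).
Proof.
apply/funext => w; elim: w k g => [|x u IH] k g //=.
have shift_dbl : shift x (dblw j k g) =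
    if (0 < k <= x j)%N then shift (x + U_(j))%MM g else dblw j (k - x j) (shift x g).
  by apply/funext => v; rewrite /shift /=; case: ifP.
rewrite shift_dbl shift_d0 dblw_zmod fctB IH; case: ifP => kx.
  case: u {IH} => [|y v] //=.
  by rewrite mnmDE -addmA (addmC U_(j)%MM) addmA; case: ifP => //; lia.
congr (_ - _); case: u {IH} => [|y v] //=.
have -> : shift y (merge_head x g) = shift (x + y)%MM g by [].
rewrite mnmDE subnDA addmA.
have -> // : (0 < k - x j <= y j)%N = (0 < k <= x j + y j)%N by lia.
Qed.

Definition cntw j w : nat := \sum_(x <- w) x j.

Lemma cntw_cons j x u : cntw j (x :: u) = (x j + cntw j u)%N.
Proof. exact: big_cons. Qed.

Lemma cntw_cat j u v : cntw j (u ++ v) = (cntw j u + cntw j v)%N.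
Proof. exact: big_cat. Qed.

(** After the doubling, the k-th and (k+1)-st occurrences share a letter, so [secw] is evaluated
    where it is not zero by default. Thus [secw] is a section of the quotient map, though not a
    chain map. *)
Lemma dblw_secw j k g w : (0 < k <= cntw j w)%N -> dblw j k (secw j k g) w = g w.
Proof.
elim: w k g => [|x u IH] k g; first by rewrite /cntw big_nil; lia.
rewrite cntw_cons /= => kx; case: ifP => [kx'|nkx].
  rewrite mnmDE mnm1E eqxx; case: ifP => [_|]; last by lia.
  by rewrite addmK.
have -> : shift x (secw j k g) = secw j (k - x j) (shift x g).
  by apply/funext => v; rewrite /shift /=; case: ifP => //; lia.
by rewrite IH //; lia.
Qed.

Lemma d0_neq0 g w : d0 g w != 0 -> exists u x y v,
  w = u ++ x :: y :: v /\ g (u ++ (x + y)%MM :: v) != 0.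
Proof.
elim: w g => [|x u IH] g //=; case: (eqVneq (d0 (shift x g) u) 0) => [->|/IH].
  by rewrite subr0; case: u {IH} => [|y v] //= gv; exists [::], x, y, v.
by case=> a [z [y [v [-> gn]]]] _; exists (x :: a), z, y, v.
Qed.

Lemma insw_neq0 j k g w : insw j k g w != 0 -> exists u v,
  [/\ w = u ++ v, cntw j u = k & g (u ++ U_(j)%MM :: v) != 0].
Proof.
elim: w k g => [|x u IH] k g /=.
  case: (k =P 0%N) => [-> |_]; rewrite subr0 ?eqxx // => gn; exists [::], [::].
  by split=> //; rewrite /cntw big_nil.
case: (boolP (x j <= k)%N) => xk; last first.
  case: (k =P 0%N) => [-> |_]; rewrite subr0 ?eqxx // => gn; exists [::], (x :: u).
  by split=> //; rewrite /cntw big_nil.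
case: (eqVneq (insw j (k - x j) (shift x g) u) 0) => [->|/IH].
  case: (k =P 0%N) => [-> |_]; rewrite subr0 ?eqxx // => gn; exists [::], (x :: u).
  by split=> //; rewrite /cntw big_nil.
case=> a [v [-> cn gn]] _; exists (x :: a), v; split=> //.
by rewrite cntw_cons cn; lia.
Qed.

Lemma dblw_neq0 j k g w : dblw j k g w != 0 -> exists u x v,
  [/\ w = u ++ x :: v, (cntw j u < k <= cntw j u + x j)%N &
      g (u ++ (x + U_(j))%MM :: v) != 0].
Proof.
elim: w k g => [|x u IH] k g //=; case: ifP => [kx gn|_ /IH].
  by exists [::], x, u; rewrite /cntw big_nil.
case=> a [y [v [-> cn gn]]]; exists (x :: a), y, v; split=> //.
by rewrite cntw_cons; lia.
Qed.

Lemma secw_neq0 j k g w : secw j k g w != 0 -> exists u x v,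
  [/\ w = u ++ x :: v, (cntw j u < k < cntw j u + x j)%N &
      g (u ++ (x - U_(j))%MM :: v) != 0].
Proof.
elim: w k g => [|x u IH] k g //=; case: ifP => [kx gn|_ /IH].
  by exists [::], x, u; rewrite /cntw big_nil.
case=> a [y [v [-> cn gn]]]; exists (x :: a), y, v; split=> //.
by rewrite cntw_cons; lia.
Qed.

Lemma dblw_at j k g u x v : (cntw j u < k <= cntw j u + x j)%N ->
  dblw j k g (u ++ x :: v) = g (u ++ (x + U_(j))%MM :: v).
Proof.
elim: u k g => [|y u IH] k g.
  by rewrite /cntw big_nil /= => ->.
rewrite cntw_cons /= => kx; case: ifP => [|_]; first by lia.
by rewrite IH //; lia.
Qed.

(* The letters that contain j more than once have to lie among the first c
   occurrences of j. *)
Fixpoint adm j c w : bool :=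
  if w is x :: u then ((x j <= 1)%N || (x j <= c)%N) && adm j (c - x j) u else true.

Lemma adm_cat j c u v : adm j c (u ++ v) = adm j c u && adm j (c - cntw j u) v.
Proof.
elim: u c => [|x u IH] c /=; first by rewrite /cntw big_nil subn0.
by rewrite IH cntw_cons subnDA andbA.
Qed.

Lemma adm0 j w : adm j 0 w = all (fun x => (x j <= 1)%N) w.
Proof. by elim: w => //= x u ->; lia. Qed.

Lemma adm1 j w : adm j 1 w = adm j 0 w.
Proof.
elim: w => //= x u IH; case: (leqP (x j) 1) => x1 /=; last by rewrite leqNgt ltnW.
by case: (x j) x1 => [|[|n]].
Qed.

Lemma adm_mono j c c' w : (c <= c')%N -> adm j c w -> adm j c' w.
Proof.
elim: w c c' => //= x u IH c c' cc /andP[xc au].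
by rewrite (IH _ _ _ au) ?andbT; lia.
Qed.

Lemma adm_total j c w : (cntw j w <= c)%N -> adm j c w.
Proof.
elim: w c => //= x u IH c; rewrite cntw_cons => h.
by rewrite IH ?andbT; lia.
Qed.

Lemma adm_merge j c u x y v :
  adm j c (u ++ (x + y)%MM :: v) -> adm j c (u ++ x :: y :: v).
Proof.
rewrite !adm_cat /= mnmDE subnDA => /and3P[-> h ->] /=; lia.
Qed.

(** Merging U_(j) into the letter that starts with occurrence k+1 puts the occurrences k+1 and k+2
    into one letter, which [adm j k.+1] forbids. At letters without j the two contributions cancel.
    There remains the letter that ends with the k-th occurrence, and there merging is doubling. If
    the occurrences k and k+1 share a letter, both sides vanish. *)
Lemma defectE j k g w : (forall w, g w != 0 -> adm j k.+1 w) ->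
  defect j k g w = - dblw j k g w.
Proof.
elim: w k g => [|x u IH] k g ga /=; first by rewrite oppr0.
have gx : (x j > k)%N || ((k == 0%N) && (0 < x j)%N) -> g ((x + U_(j))%MM :: u) = 0.
  move=> h; apply/eqP; apply/negPn/negP => /ga /=.
  by rewrite mnmDE mnm1E eqxx; lia.
have IHx k' : (x j <= k)%N -> (k' = k - x j)%N ->
    defect j k' (shift x g) u = - dblw j k' (shift x g) u.
  move=> xk ->; apply: IH => v /ga /= /andP[_]; rewrite subSn //.
have dbl0 g' v : dblw j 0 g' v = 0 by elim: v g' => //= y v' IHv g'; apply: IHv.
have -> : (0 < k <= x j)%N = (k != 0%N) && (k <= x j)%N by rewrite lt0n.
case: (ltngtP (x j) k) => xk.
- have -> : (k == 0%N) = false by lia.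
  by rewrite subrr mul0r add0r (IHx _ (ltnW xk) erefl).
- rewrite gx ?xk ?orbT // mulr0 addr0 andbT; case: ifP => [_|]; first by rewrite oppr0.
  have -> : (k - x j = 0)%N by lia.
  by rewrite dbl0 oppr0.
- rewrite (IHx (k - x j)%N) ?xk // subnn dbl0 oppr0 addr0 andbT.
  by case: (k =P 0%N) => k0 /=; rewrite ?subrr ?mul0r ?oppr0 //; ring.
Qed.

Lemma nzw_d0 g w : 0%MM \notin w -> d0 (nzw g) w = d0 g w.
Proof.
elim: w g => //= x u IH g; rewrite inE negb_or => /andP[x0 u0]; congr (_ - _).
  case: u u0 {IH} => //= y v; rewrite inE negb_or => /andP[y0 v0].
  by rewrite /nzw inE zero_mnmD (negPf x0) (negPf v0).
have -> : shift x (nzw g) = nzw (shift x g).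
  by apply/funext => v; rewrite /shift /nzw inE (negPf x0).
exact: IH.
Qed.

Lemma dw_dw g : dw (dw g) = 0.
Proof.
apply/funext => w; rewrite /dw /nzw; case: ifP => // /negbT w0.
by have := nzw_d0 (d0 g) w0; rewrite d0_d0.
Qed.

Lemma nzw_shift x g : shift x (nzw g) = if 0%MM == x then 0 else nzw (shift x g).
Proof. by apply/funext => v; rewrite /shift /nzw inE; case: (0%MM =P x). Qed.

Lemma nzw_insw j k g : insw j k (nzw g) = nzw (insw j k g).
Proof.
apply/funext => w; elim: w k g => [|x u IH] k g.
  by rewrite /= /nzw /= inE zero_mnm1.
rewrite [LHS]/= nzw_shift /nzw /= !inE zero_mnm1 /= -/(nzw _).
case: (0%MM =P x) => [_|_] /=.
  by rewrite raddf0; do !case: ifP; rewrite ?subr0.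
by rewrite IH /nzw; do !case: ifP; rewrite ?subr0.
Qed.

Lemma nzw_dblw j k g : dblw j k (nzw g) = nzw (dblw j k g).
Proof.
apply/funext => w; elim: w k g => [|x u IH] k g; first by rewrite /= /nzw.
rewrite [LHS]/= nzw_shift /nzw /= !inE zero_mnmD zero_mnm1 andbF /= -/(nzw _).
case: (0%MM =P x) => [<-|_] /=; last by rewrite IH /nzw; case: ifP => // _; case: ifP.
by rewrite mnm0E raddf0; case: ifP => //; lia.
Qed.

Lemma nzw_homotopy j k g : dw (insw j k g) + insw j k (dw g) = nzw (defect j k g).
Proof. by rewrite nzw_insw -insw_homotopy /dw raddfD. Qed.

Lemma dblw_dw j k g : dblw j k (dw g) = dw (dblw j k g).
Proof. by rewrite nzw_dblw dblw_d0. Qed.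

Lemma dwD g g' : dw (g + g') = dw g + dw g'. Proof. exact: raddfD. Qed.
Lemma dwB g g' : dw (g - g') = dw g - dw g'. Proof. exact: raddfB. Qed.
Lemma dwN g : dw (- g) = - dw g. Proof. exact: raddfN. Qed.
Lemma dw0 : dw 0 = 0. Proof. exact: raddf0. Qed.
Lemma dblwD j k g g' : dblw j k (g + g') = dblw j k g + dblw j k g'.
Proof. exact: raddfD. Qed.
Lemma dblwB j k g g' : dblw j k (g - g') = dblw j k g - dblw j k g'.
Proof. exact: raddfB. Qed.
Lemma secwD j k g g' : secw j k (g + g') = secw j k g + secw j k g'.
Proof. exact: raddfD. Qed.
Lemma secw0 j k : secw j k 0 = 0. Proof. exact: raddf0. Qed.
Lemma insw0 j k : insw j k 0 = 0. Proof. exact: raddf0. Qed.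
Lemma nzwN g : nzw (- g) = - nzw g. Proof. exact: raddfN. Qed.

End Words.

(** * Descent to square-free words *)

Section WordCochains.
Variable m : nat.
Local Notation mon := 'X_{1..m}.
Local Notation word := (seq mon).
(** To be the set of the monomials supported on a face. Square-freeness is left to [adm], so that
    one K serves all stages. *)
Variable K : pred mon.
Hypothesis K_supp : forall x y : mon, (forall j, 0 < x j -> 0 < y j)%N -> K y -> K x.
Implicit Types (x y c I : mon) (u v w : word) (g : word -> int) (j : 'I_m) (k s : nat).

Lemma mnm_subUK x j : (0 < x j)%N -> (x - U_(j) + U_(j))%MM = x.
Proof.
by move=> xj; apply/mnmP => i; rewrite mnmDE mnmBE mnm1E; case: eqP => [<-|_] /=; lia.
Qed.

(* The length is shifted by one, so that there are no cochains for s = 0. *)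
Definition wcoch c s I g := forall w, g w != 0 ->
  [/\ (size w).+1 = s, forall j, cntw j w = I j, 0%MM \notin w, all K w &
      forall j, adm j (c j) w].

Lemma wcoch_sum c s I g g' : wcoch c s I g -> wcoch c s I g' -> wcoch c s I (g + g').
Proof.
move=> cg cg' w; rewrite fctE; case: (eqVneq (g w) 0) => [->|/cg //].
by rewrite add0r => /cg'.
Qed.

Lemma wcochN c s I g : wcoch c s I g -> wcoch c s I (- g).
Proof. by move=> cg w; rewrite fctE oppr_eq0 => /cg. Qed.

Lemma wcochB c s I g g' : wcoch c s I g -> wcoch c s I g' -> wcoch c s I (g - g').
Proof. by move=> cg /wcochN; apply: wcoch_sum. Qed.

Lemma wcoch0 c s I : wcoch c s I 0.
Proof. by move=> w; rewrite eqxx. Qed.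

Lemma wcoch_mono c c' s I g : (forall j, c j <= c' j)%N -> wcoch c s I g -> wcoch c' s I g.
Proof.
by move=> cc cg w /cg[? ? ? ? a]; split=> // j; apply: adm_mono (cc j) (a j).
Qed.

Lemma wcoch_nil c I g : wcoch c 0 I g -> g = 0.
Proof. by move=> cg; apply/funext => w; apply/eqP/negPn/negP => /cg[]. Qed.

Lemma wcoch_nzw c s I g : wcoch c s I g -> nzw g = g.
Proof.
move=> cg; apply/funext => w; rewrite /nzw; case: ifP => // w0.
by apply/esym/eqP/negPn/negP => /cg[_ _ /negP[]].
Qed.

Lemma wcoch_dw c s I g : wcoch c s I g -> wcoch c s.+1 I (dw g).
Proof.
move=> cg w; rewrite /dw /nzw; case: ifP => [|w0]; first by rewrite eqxx.
move=> /d0_neq0[u [x [y [v [ew /cg[gs gI g0 gK ga]]]]]]; split.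
- by rewrite -gs ew !size_cat /=; lia.
- by move=> j; rewrite -gI ew !cntw_cat !cntw_cons mnmDE; lia.
- by [].
- move: gK; rewrite ew !all_cat /= => /and3P[-> h ->]; rewrite andbT /=.
  by apply/andP; split; apply: K_supp h => j; rewrite mnmDE; lia.
- by move=> j; rewrite ew adm_merge.
Qed.

(** The part before the insertion has exactly c_j occurrences of j and is unconstrained by c_j. The
    inserted letter uses up the additional one, so the part behind it is constrained as by 0. *)
Lemma wcoch_insw c s I j g : wcoch (c + U_(j))%MM s.+1 I g ->
  wcoch c s (I - U_(j))%MM (insw j (c j) g).
Proof.
move=> cg w /insw_neq0[u [v [-> cu /cg[gs gI g0 gK ga]]]]; split.
- by move: gs; rewrite !size_cat /=; lia.
- by move=> i; rewrite mnmBE -gI !cntw_cat cntw_cons; lia.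
- by move: g0; rewrite !mem_cat inE; case: (_ \in u) => //=; case: (_ == _).
- by move: gK; rewrite !all_cat /= => /and3P[-> _ ->].
- move=> i; have := ga i; rewrite !adm_cat /= !mnmDE !mnm1E.
  case: eqP => [<-|_] /=; last by rewrite addn0 subn0.
  by rewrite cu addn1 subSnn !subnn => /andP[_ ->]; rewrite adm_total ?cu.
Qed.

Lemma wcoch_dblw c s I j g : wcoch (c + U_(j))%MM s I g ->
  wcoch c s (I - U_(j))%MM (dblw j (c j) g).
Proof.
move=> cg w /dblw_neq0[u [x [v [-> cu /cg[gs gI g0 gK ga]]]]]; split.
- by move: gs; rewrite !size_cat.
- by move=> i; rewrite mnmBE -gI !cntw_cat !cntw_cons mnmDE; lia.
- move: g0; rewrite !mem_cat !inE zero_mnmD zero_mnm1 andbF /= => /norP[/negPf-> /negPf->].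
  by rewrite orbF; apply/eqP => x0; move: cu; rewrite -x0 mnm0E; lia.
- move: gK; rewrite !all_cat /= => /and3P[-> h ->]; rewrite andbT.
  by apply: K_supp h => i; rewrite mnmDE; lia.
- move=> i; have := ga i; rewrite !adm_cat /= !mnmDE !mnm1E.
  case: eqP => [<-|_] /=; last by rewrite !addn0.
  rewrite addn1 => /and3P[_ h1 h2]; rewrite adm_total; last by lia.
  rewrite andTb; apply/andP; split; first by lia.
  by move: h2; apply: adm_mono; lia.
Qed.

Lemma wcoch_secw c s I j g : (0 < I j)%N -> wcoch c s (I - U_(j))%MM g ->
  wcoch (c + U_(j))%MM s I (secw j (c j) g).
Proof.
move=> Ij cg w /secw_neq0[u [x [v [-> cu /cg[gs gI g0 gK ga]]]]]; split.
- by move: gs; rewrite !size_cat.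
- move=> i; have := gI i; rewrite mnmBE !cntw_cat !cntw_cons mnmBE mnm1E.
  by case: eqP => [<-|_] /=; lia.
- move: g0; rewrite !mem_cat !inE => /norP[/negPf-> /norP[_ /negPf->]].
  by rewrite orbF; apply/eqP => x0; move: cu; rewrite -x0 mnm0E; lia.
- move: gK; rewrite !all_cat /= => /and3P[-> h ->]; rewrite andbT.
  apply: K_supp h => i; rewrite mnmBE mnm1E.
  by case: eqP => [<-|_] /=; lia.
- move=> i; have := ga i; rewrite !adm_cat /= !mnmDE !mnmBE !mnm1E.
  case: eqP => [<-|_] /=; last by rewrite !addn0 !subn0.
  rewrite addn1 => /and3P[_ h1 h2]; rewrite adm_total; last by lia.
  rewrite andTb; apply/andP; split; first by lia.
  by move: h2; apply: adm_mono; lia.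
Qed.

Lemma adm_step j k w : adm j k.+1 w -> adm j k w \/
  exists u x v, [/\ w = u ++ x :: v, (cntw j u < k)%N & (cntw j u + x j)%N = k.+1].
Proof.
elim: w k => [|x u IH] k /=; first by left.
have [xk /andP[_]|xk] := leqP (x j) k.
  rewrite subSn // => /IH[->|[a [y [v [-> c1 c2]]]]]; first by left; rewrite orbT.
  by right; exists (x :: a), y, v; rewrite cntw_cons; split=> //; lia.
have [xk'|xk'] := eqVneq (x j) k.+1; last first.
  move=> /andP[h a]; left; move: h a.
  by rewrite (_ : k.+1 - x j = k - x j)%N; [move=> ? ->; lia | lia].
case: k xk xk' {IH} => [|k] xk xk'.
  by rewrite xk' !subnn /= => ->; left.
by right; exists [::], x, u; rewrite /cntw big_nil; split.
Qed.

(** By [adm_step], a word allowed by c + e_j but not by c has a letter ending with the occurrences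
    c_j and c_j + 1. Such a word arises by doubling, so g takes there a value of
    [dblw j (c j) g]. *)
Lemma dblw_eq0_wcoch c s I j g : wcoch (c + U_(j))%MM s I g ->
  dblw j (c j) g = 0 -> wcoch c s I g.
Proof.
move=> cg qg w gw; have [gs gI g0 gK ga] := cg w gw; split=> // i.
have := ga i; rewrite mnmDE mnm1E; case: eqP => [<-|_]; last by rewrite addn0.
rewrite addn1 => /adm_step[//|[u [x [v [ew c1 c2]]]]].
have := congr1 (fun f => f (u ++ (x - U_(j))%MM :: v)) qg.
rewrite dblw_at; last by rewrite mnmBE mnm1E eqxx; lia.
rewrite mnm_subUK; last by lia.
by rewrite -ew => e; rewrite e eqxx in gw.
Qed.

Lemma wcoch_homotopy c s I j g : wcoch (c + U_(j))%MM s I g ->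
  dw (insw j (c j) g) + insw j (c j) (dw g) = - dblw j (c j) g.
Proof.
move=> cg; rewrite nzw_homotopy.
have -> : defect j (c j) g = - dblw j (c j) g.
  apply/funext => w; apply: defectE => v /cg[_ _ _ _ /(_ j)].
  by rewrite mnmDE mnm1E eqxx addn1.
by rewrite nzwN -nzw_dblw (wcoch_nzw cg).
Qed.

Lemma dblw_secw_wcoch c s I j k g : (0 < k < I j)%N -> wcoch c s (I - U_(j))%MM g ->
  dblw j k (secw j k g) = g.
Proof.
move=> kI cg; apply/funext => w.
have [/cg[_ gI _ _ _]|kw] := boolP (g w != 0).
  by rewrite dblw_secw // gI mnmBE mnm1E eqxx; lia.
have gw : g w = 0 by move: kw; rewrite negbK => /eqP.
(* A non-zero value would force k <= [cntw j w], and then [dblw_secw] applies after all. *)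
apply/eqP; apply: contraTT isT; rewrite gw => /dblw_neq0[u [x [v [ew c1 c2]]]].
have kcw : (0 < k <= cntw j w)%N by rewrite ew cntw_cat cntw_cons; lia.
have := dblw_secw g kcw; rewrite {1}ew dblw_at // gw => e.
by rewrite e eqxx in c2.
Qed.

(* For a cocycle g, dblw g is the coboundary of - insw g. *)
Lemma cocycle_descent_step c s I j g : (0 < c j)%N -> wcoch (c + U_(j))%MM s.+1 I g -> dw g = 0 ->
  exists g' h, [/\ wcoch c s.+1 I g', dw g' = 0, wcoch (c + U_(j))%MM s I h & g = g' + dw h].
Proof.
move=> cj cg dg; have [Ic|Ic] := leqP (I j) (c j).
  (* On words of multi-degree I the bound c_j >= I_j is vacuous. *)
  exists g, 0; split=> //; last by rewrite dw0 addr0.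
  move=> w /cg[gs gI g0 gK ga]; split=> // i.
  have := ga i; rewrite mnmDE mnm1E; case: eqP => [<- _|_]; last by rewrite addn0.
  by apply: adm_total; rewrite gI.
have ci := wcoch_insw cg.
(* Since h lifts [insw j (c j) g], its coboundary is mapped by [dblw] to that of [insw j (c j) g],
   which is minus the image of g. Hence g + dw h lies in the kernel of [dblw]. *)
set h := secw j (c j) (insw j (c j) g).
have ch : wcoch (c + U_(j))%MM s I h by apply: wcoch_secw => //; lia.
exists (g + dw h), (- h); split.
- apply: dblw_eq0_wcoch; first exact: wcoch_sum cg (wcoch_dw ch).
  rewrite dblwD dblw_dw (dblw_secw_wcoch _ ci); last by rewrite cj.
  apply/eqP; rewrite -oppr_eq0 opprD -(wcoch_homotopy cg) dg insw0 addr0.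
  by rewrite addrN.
- by rewrite dwD dg add0r dw_dw.
- exact: wcochN.
- by rewrite dwN addrK.
Qed.

(** Exactness at the image of the connecting map: z is the image of h in the quotient. It is a
    cocycle because [dblw] kills y, a letter with occurrences c_j and c_j + 1 being excluded by c.
    Subtracting the lift of z brings h into stage c. *)
Lemma coboundary_descent_step c s I j (y h : word -> int) : (0 < c j < I j)%N ->
  wcoch c s.+1 I y -> wcoch (c + U_(j))%MM s I h -> y = dw h ->
  exists z h', [/\ wcoch c s (I - U_(j))%MM z, dw z = 0, wcoch c s I h' &
    y = dw (secw j (c j) z) + dw h'].
Proof.
move=> cI cy ch yE; set z := dblw j (c j) h.
have cz : wcoch c s (I - U_(j))%MM z by apply: wcoch_dblw.
have Ij : (0 < I j)%N by lia.
exists z, (h - secw j (c j) z); split=> //.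
- rewrite -dblw_dw -yE; apply/funext => w; apply/eqP/negPn/negP.
  move=> /dblw_neq0[u [x [v [_ c1 /cy[_ _ _ _ /(_ j)]]]]].
  rewrite adm_cat /= mnmDE mnm1E eqxx; lia.
- apply: dblw_eq0_wcoch; first exact: wcochB ch (wcoch_secw Ij cz).
  by rewrite dblwB (dblw_secw_wcoch _ cz) // subrr.
- by rewrite dwB addrC subrK.
Qed.

Lemma mnm1_ind (P : mon -> Prop) : P 0%MM ->
  (forall c j, P c -> P (c + U_(j))%MM) -> forall c, P c.
Proof.
move=> P0 PS c; elim: {c}(mdeg c) {-2}c (leqnn (mdeg c)) => [|n IH] c.
  by rewrite leqn0 mdeg_eq0 => /eqP->.
move=> cn; have [->//|] := eqVneq c 0%MM.
move=> c0; have [j cj] : exists j, (0 < c j)%N.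
  apply/not_existsP => h; move/eqP: c0; apply; apply/mnmP => i; rewrite mnm0E.
  by move: (h i); lia.
rewrite -(mnm_subUK cj); apply: PS; apply: IH.
by move: cn; rewrite -{1}(mnm_subUK cj) mdegD mdeg1; lia.
Qed.

(** A letter with j twice takes two occurrences, so the bounds 0 and 1 agree. This covers the step
    at c_j = 0, where there is no k-th occurrence to double. *)
Lemma wcoch_c0 c j s I g : c j = 0%N -> wcoch (c + U_(j))%MM s I g -> wcoch c s I g.
Proof.
move=> c0 cg w /cg[gs gI g0 gK ga]; split=> // i.
have := ga i; rewrite mnmDE mnm1E; case: eqP => [<-|_]; last by rewrite addn0.
by rewrite c0 -adm1.
Qed.

Lemma cocycle_descent c s I g : wcoch c s.+1 I g -> dw g = 0 ->
  exists g' h, [/\ wcoch 0%MM s.+1 I g', dw g' = 0, wcoch c s I h & g = g' + dw h].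
Proof.
elim/mnm1_ind: c g => [|c j IH] g cg dg.
  by exists g, 0; split=> //; rewrite dw0 addr0.
have cc : (forall i, c i <= (c + U_(j))%MM i)%N by move=> i; rewrite mnmDE leq_addr.
have [c0|cj] := posnP (c j).
  have [g' [h [cg' dg' ch e]]] := IH g (wcoch_c0 c0 cg) dg.
  by exists g', h; split=> //; apply: wcoch_mono ch.
have [g1 [h1 [cg1 dg1 ch1 e1]]] := cocycle_descent_step cj cg dg.
have [g' [h [cg' dg' ch e]]] := IH g1 cg1 dg1.
exists g', (h + h1); split=> //; first exact: wcoch_sum (wcoch_mono cc ch) ch1.
by rewrite dwD addrA -e.
Qed.

(* No letter contains two of the first k occurrences of j. *)
Fixpoint late j k w : bool :=
  if w is x :: u then (minn (x j) k <= 1)%N && late j (k - x j) u else true.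

Lemma late_cat j k u v : late j k (u ++ v) = late j k u && late j (k - cntw j u) v.
Proof.
elim: u k => [|x u IH] k /=; first by rewrite /cntw big_nil subn0.
by rewrite IH cntw_cons subnDA andbA.
Qed.

Lemma late_merge j k u x y v :
  late j k (u ++ (x + y)%MM :: v) -> late j k (u ++ x :: y :: v).
Proof.
rewrite !late_cat /= mnmDE subnDA => /and3P[-> h ->] /=; rewrite andbT.
by apply/andP; split; lia.
Qed.

(** The kernel of [dblw] only gives membership in the stage k e_j, which still allows repetitions
    among the first k occurrences; [late] excludes these. *)
Lemma adm_late j k w : adm j k w -> late j k w -> adm j 0 w.
Proof.
elim: w k => //= x u IH k /andP[h1 h2] /andP[h3 h4].
by rewrite sub0n (IH _ h2 h4) andbT; lia.
Qed.

Lemma adm0_late j k w : adm j 0 w -> late j k w.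
Proof.
elim: w k => //= x u IH k; rewrite sub0n => /andP[h1 h2].
by rewrite (IH _ h2) andbT; lia.
Qed.

Lemma secw_late j k g w : (forall v, g v != 0 -> adm j 0 v) ->
  secw j k g w != 0 -> late j k w.
Proof.
move=> hg /secw_neq0[u [x [v [-> c1 /hg]]]].
rewrite adm_cat /= mnmBE mnm1E eqxx !sub0n => /and3P[au ax av].
rewrite late_cat /= (adm0_late _ au) (adm0_late _ av) andbT /=; lia.
Qed.

Lemma dw_late j k g w : (forall v, g v != 0 -> late j k v) -> dw g w != 0 -> late j k w.
Proof.
move=> hg; rewrite /dw /nzw; case: ifP => [|_]; first by rewrite eqxx.
by move=> /d0_neq0[u [x [y [v [-> /hg/late_merge]]]]].
Qed.

Lemma late_wcoch s I j k g : wcoch (U_(j) *+ k)%MM s I g ->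
  (forall w, g w != 0 -> late j k w) -> wcoch 0%MM s I g.
Proof.
move=> cg lg w gw; have [gs gI g0 gK ga] := cg w gw; split=> // i; rewrite mnm0E.
have := ga i; rewrite mulmnE mnm1E; case: eqP => [<-|_]; last by rewrite mul0n.
by rewrite mul1n => aj; apply: adm_late aj (lg _ gw).
Qed.

Lemma wcoch_secw0 s I j k g : (0 < k < I j)%N -> wcoch 0%MM s (I - U_(j))%MM g ->
  wcoch (U_(j) *+ k + U_(j))%MM s I (secw j k g) /\
  forall w, secw j k g w != 0 -> late j k w.
Proof.
move=> kI cg; have Ij : (0 < I j)%N by lia.
have cj : (U_(j) *+ k)%MM j = k by rewrite mulmnE mnm1E eqxx mul1n.
split; last by move=> w; apply: secw_late => v /cg[_ _ _ _ /(_ j)]; rewrite mnm0E.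
have cg' : wcoch (U_(j) *+ k)%MM s (I - U_(j))%MM g.
  by apply: wcoch_mono cg => i; rewrite mnm0E.
by have := wcoch_secw Ij cg'; rewrite cj.
Qed.

Lemma dblw_eq0_late s I j k g : wcoch (U_(j) *+ k + U_(j))%MM s I g ->
  (forall w, g w != 0 -> late j k w) -> dblw j k g = 0 -> wcoch 0%MM s I g.
Proof.
move=> cg lg qg; apply: (late_wcoch _ lg); apply: dblw_eq0_wcoch cg _.
by rewrite mulmnE mnm1E eqxx mul1n.
Qed.

(** The connecting map on exterior cocycles: [dblw] sends the coboundary of the lift to dw z = 0,
    and lateness passes from the lift to its coboundary. *)
Lemma wcoch_dw_secw s I j k z : (0 < k < I j)%N -> wcoch 0%MM s (I - U_(j))%MM z ->
  dw z = 0 -> wcoch 0%MM s.+1 I (dw (secw j k z)).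
Proof.
move=> kI cz dz; have [cD lD] := wcoch_secw0 kI cz.
apply: dblw_eq0_late (wcoch_dw cD) _ _; first by move=> w; apply: dw_late.
by rewrite dblw_dw (dblw_secw_wcoch kI cz) dz.
Qed.

(** Independence of the representative. [secw] does not commute with [dw], but the commutator
    applied to h is killed by [dblw] and late, hence exterior; it serves as h'. *)
Lemma dw_secw_dw s I j k h : (0 < k < I j)%N -> wcoch 0%MM s (I - U_(j))%MM h ->
  exists2 h', wcoch 0%MM s.+1 I h' & dw (secw j k (dw h)) = dw h'.
Proof.
move=> kI ch; have cdh := wcoch_dw ch.
have [cD lD] := wcoch_secw0 kI ch; have [cDd lDd] := wcoch_secw0 kI cdh.
exists (secw j k (dw h) - dw (secw j k h)); last by rewrite dwB dw_dw subr0.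
apply: dblw_eq0_late; first exact: wcochB cDd (wcoch_dw cD).
  move=> w; rewrite fctB; case: (eqVneq (secw j k (dw h) w) 0) => [->|/lDd //].
  by rewrite sub0r oppr_eq0; apply: dw_late.
by rewrite dblwB dblw_dw (dblw_secw_wcoch kI cdh) (dblw_secw_wcoch kI ch) subrr.
Qed.

Lemma coboundary_descent c s I (y h : word -> int) :
  wcoch 0%MM s.+1 I y -> wcoch c s I h -> y = dw h ->
  exists z h', [/\
    forall j k, (0 < k < I j)%N -> wcoch 0%MM s (I - U_(j))%MM (z j k) /\ dw (z j k) = 0,
    wcoch 0%MM s I h' &
    y = \sum_(j < m) \sum_(1 <= k < I j) dw (secw j k (z j k)) + dw h'].
Proof.
elim/mnm1_ind: c y h => [|c j IH] y h cy ch yE.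
  exists (fun _ _ => 0), h; split=> [j k _|//|]; first by split; [exact: wcoch0|rewrite dw0].
  by rewrite big1 ?add0r // => j _; rewrite big1 // => k _; rewrite secw0 dw0.
have cc : (forall i, c i <= (c + U_(j))%MM i)%N by move=> i; rewrite mnmDE leq_addr.
have c0c i : (0%MM i <= c i)%N by rewrite mnm0E.
have [c0|cj] := posnP (c j); first exact: IH (wcoch_c0 c0 ch) yE.
have [Ic|Ic] := leqP (I j) (c j).
  apply: IH yE => // w /ch[gs gI g0 gK ga]; split=> // i.
  have := ga i; rewrite mnmDE mnm1E; case: eqP => [<- _|_]; last by rewrite addn0.
  by apply: adm_total; rewrite gI.
have cI : (0 < c j < I j)%N by rewrite cj.
have [z1 [h1 [cz1 dz1 ch1 e1]]] := coboundary_descent_step cI (wcoch_mono c0c cy) ch yE.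
(* Replace z1 by an exterior cocycle z, where z1 = z + dw t with t in stage c. As in [dw_secw_dw],
   the commutator of [secw] and [dw] at t lies in the kernel of [dblw], hence in stage c. *)
have [z [t1 [cz dz ct1 ez]]] : exists z t1, [/\ wcoch 0%MM s (I - U_(j))%MM z, dw z = 0,
    wcoch c s I t1 & dw (secw j (c j) z1) = dw (secw j (c j) z) + dw t1].
  (* [cocycle_descent] requires a positive index; at index 0 there are no cochains besides 0. *)
  case: s {IH cy ch e1 ch1 yE} cz1 => [|s] cz1.
    exists 0, 0; split; rewrite ?secw0 ?dw0 //.
    by rewrite (wcoch_nil cz1) secw0 dw0 addr0.
  have [z [t [cz dz ct ->]]] := cocycle_descent cz1 dz1.
  have Ij : (0 < I j)%N by lia.
  exists z, (secw j (c j) (dw t) - dw (secw j (c j) t)); split=> //.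
    apply: (@dblw_eq0_wcoch _ _ _ j).
      by apply: wcochB; [apply/wcoch_secw/wcoch_dw|apply/wcoch_dw/wcoch_secw].
    rewrite dblwB (dblw_secw_wcoch cI (wcoch_dw ct)) dblw_dw.
    by rewrite (dblw_secw_wcoch cI ct) subrr.
  by rewrite dwB dw_dw subr0 secwD dwD.
have cy' : wcoch 0%MM s.+1 I (y - dw (secw j (c j) z)).
  by apply: wcochB => //; apply: wcoch_dw_secw.
have [|z' [h' [cz' ch' e']]] := IH _ _ cy' (wcoch_sum ct1 ch1).
  by rewrite e1 ez dwD -(addrA (dw _)) [LHS]addrC addKr.
(* The cocycle found at this stage joins the summand with indices j and k = c_j. *)
exists (fun i k => z' i k + (if (i == j) && (k == c j) then z else 0)), h'; split=> //.
  move=> i k kI; have [c1 d1] := cz' i k kI.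
  split; first by apply: wcoch_sum c1 _; case: andP => [[/eqP-> _]|_] //; apply: wcoch0.
  by rewrite dwD d1 add0r; case: ifP => // _; rewrite dw0.
apply/eqP; rewrite -subr_eq; apply/eqP.
have -> : y = (y - dw (secw j (c j) z)) + dw (secw j (c j) z) by rewrite subrK.
rewrite e' addrAC addrK.
transitivity (\sum_(i < m) \sum_(1 <= k < I i) dw (secw i k (z' i k)) +
  \sum_(i < m) \sum_(1 <= k < I i)
    dw (secw i k (if (i == j) && (k == c j) then z else 0))); last first.
  rewrite -big_split; apply: eq_bigr => i _; rewrite -big_split; apply: eq_bigr => k _.
  by rewrite /= -dwD -secwD.
congr (_ + _); rewrite (bigD1 j) //= [X in _ + X]big1 ?addr0; last first.
  by move=> i /negPf ij; rewrite big1 // => k _; rewrite ij /= secw0 dw0.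
rewrite (bigD1_seq (c j)) ?iota_uniq ?mem_index_iota //= !eqxx /= big1 ?addr0 //.
by move=> k /negPf kc; rewrite kc secw0 dw0.
Qed.
End WordCochains.

(** * Values of bar cochains on words of monomials *)

Lemma sign_eq a b : odd a = odd b -> (-1) ^+ a = (-1) ^+ b :> int.
Proof. by move=> ab; rewrite -signr_odd ab signr_odd. Qed.

Section Inversions.
Variable m : nat.
Local Notation mon := 'X_{1..m}.
Local Notation word := (seq mon).
Implicit Types (x y : mon) (u v w : word).

(** The biadditive extension of [eps] from sets to multisets, see [eps_inversions]. *)
Definition inversions x y : nat := \sum_(i < m) \sum_(k < m | (k < i)%N) x i * y k.

Lemma inversionsDl x x' y : inversions (x + x') y = (inversions x y + inversions x' y)%N.
Proof.
rewrite /inversions -big_split; apply: eq_bigr => i _; rewrite -big_split.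
by apply: eq_bigr => k _; rewrite mnmDE mulnDl.
Qed.

Lemma inversionsDr x y y' : inversions x (y + y') = (inversions x y + inversions x y')%N.
Proof.
rewrite /inversions -big_split; apply: eq_bigr => i _; rewrite -big_split.
by apply: eq_bigr => k _; rewrite mnmDE mulnDr.
Qed.

Definition winversions x w : nat := \sum_(y <- w) inversions x y.

(* The sign (-1)^(wsign w) turns the signs of the bar construction of a ring with
   odd generators into the signs (-1)^i. *)
Fixpoint wsign w : nat :=
  if w is x :: u then (mdeg x * size u + winversions x u + wsign u)%N else 0%N.

Lemma winversions_cons x y u : winversions x (y :: u) = (inversions x y + winversions x u)%N.
Proof. exact: big_cons. Qed.

Lemma winversions_cat x u v :
  winversions x (u ++ v) = (winversions x u + winversions x v)%N.
Proof. exact: big_cat. Qed.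

Lemma winversionsDl x y u :
  winversions (x + y)%MM u = (winversions x u + winversions y u)%N.
Proof.
by rewrite /winversions -big_split; apply: eq_bigr => z _; rewrite inversionsDl.
Qed.

(** The reason for the form of [wsign]: the surplus is the sign exponent of [mg_par] x times y for
    odd generators. *)
Lemma wsign_merge x y v :
  wsign [:: x, y & v] = (wsign ((x + y)%MM :: v) + (mdeg x + inversions x y))%N.
Proof. by rewrite /= winversions_cons winversionsDl mdegD; ring. Qed.

Lemma wsign_cons x u :
  wsign (x :: u) = (mdeg x * size u + winversions x u + wsign u)%N.
Proof. by []. Qed.

Lemma d0E (g : word -> int) x y v :
  d0 g [:: x, y & v] = g ((x + y)%MM :: v) - d0 (shift x g) (y :: v).
Proof. by []. Qed.

(** All words obtained from u by one merge have the same length and total degree, so a sign that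
    depends on these alone can be pulled out. *)
Lemma d0_twist (r : word -> int) (c : int) (g : word -> int) u :
  (forall a x y b, u = a ++ x :: y :: b -> r (a ++ (x + y)%MM :: b) = c) ->
  d0 (fun w => r w * g w) u = c * d0 g u.
Proof.
elim: u r g => [|x u IH] r g hr; first by rewrite /= mulr0.
rewrite [LHS]/= [d0 g _]/= mulrBr; congr (_ - _).
  by case: u hr {IH} => [|y v] hr /=; rewrite ?mulr0 // (hr [::]).
have -> : shift x (fun w => r w * g w) = (fun w => r (x :: w) * shift x g w) by [].
by apply: (IH (fun w => r (x :: w))) => a y z b e; rewrite -cat_cons (hr (x :: a) y z) // e.
Qed.
End Inversions.

Section MultiAdditive.
Variable R : pzRingType.
Implicit Types (phi psi : seq R -> int) (a b : seq R).

Definition madd phi := forall a b x y,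
  phi (a ++ x + y :: b) = phi (a ++ x :: b) + phi (a ++ y :: b).

Definition rshift (x : R) phi : seq R -> int := fun a => phi (x :: a).

Lemma madd_rshift x phi : madd phi -> madd (rshift x phi).
Proof. by move=> hp a b y z; rewrite /rshift -!cat_cons hp. Qed.

Section Slot.
Variables (phi : seq R -> int) (a b : seq R).
Hypothesis hphi : madd phi.

Definition slot (x : R) := phi (a ++ x :: b).
Fact slot_zmod : zmod_morphism slot.
Proof. by move=> x y; apply/eqP; rewrite eq_sym subr_eq /slot -hphi subrK. Qed.
HB.instance Definition _ := GRing.isZmodMorphism.Build R int slot slot_zmod.

Lemma madd0 : phi (a ++ 0 :: b) = 0. Proof. exact: (raddf0 slot). Qed.
Lemma maddMz x (c : int) : phi (a ++ x *~ c :: b) = phi (a ++ x :: b) * c.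
Proof. by rewrite -mulrzz; exact: (raddfMz slot). Qed.
Lemma madd_sum (T : Type) (r : seq T) (F : T -> R) :
  phi (a ++ \sum_(i <- r) F i :: b) = \sum_(i <- r) phi (a ++ F i :: b).
Proof. exact: (raddf_sum slot). Qed.
End Slot.

End MultiAdditive.

(** * The bar differential on words of monomials *)

Section MonomialRing.
Variables (m : nat) (R : mgalg m).
Local Notation mon := 'X_{1..m}.
Local Notation word := (seq mon).
Implicit Types (phi psi : seq R -> int) (a b : seq R) (w u v : word) (x y d e : mon).

Lemma mg_mon0 : mg_mon R 0%MM = 1.
Proof. by rewrite /mg_mon big1 // => i _; rewrite mnm0E. Qed.

Lemma mg_aug_mon d : mg_aug R (mg_mon R d) = (d == 0%MM)%:R.
Proof.
rewrite /mg_mon rmorph_prod; case: (eqVneq d 0%MM) => [->|d0].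
  by rewrite big1 // => i _; rewrite mnm0E rmorph1.
have [i di] : exists i, (0 < d i)%N.
  apply/not_existsP => h; move/eqP: d0; apply; apply/mnmP => i; rewrite mnm0E.
  by move: (h i); lia.
by rewrite (bigD1 i) //= rmorphXn /= mg_augE expr0n; case: (d i) di => //= n _; rewrite mul0r.
Qed.

Lemma sign_mulrz (S : pzRingType) (x : S) n : (-1) ^+ n * x = x *~ (-1) ^+ n.
Proof. by rewrite -mulrzl rmorphXn rmorphN1. Qed.

Lemma mg_par_mon d :
  mg_par R (mg_mon R d) = mg_mon R d *~ (-1) ^+ (mg_odd R * mdeg d).
Proof.
rewrite /mg_mon rmorph_prod mdegE big_distrr /=.
elim: (index_enum _) => [|i r IH]; first by rewrite !big_nil.
rewrite !big_cons IH rmorphXn /= mg_parE exprMn_comm; last exact/commr_sym/commr_sign.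
by rewrite -exprM sign_mulrz mulrzAr mulrzAl -mulrzA -exprD.
Qed.

(** [cobound] without its first outer term, in a form suited to induction on the word; the base case
    is the last outer term. *)
Fixpoint cbar phi a : int :=
  if a is x :: u then
    if u is y :: v then phi (mg_par R x * y :: v) - cbar (rshift (mg_par R x) phi) u
    else phi [::] * mg_aug R x
  else 0.

Lemma cbarE phi (x y : R) (v : seq R) : cbar phi [:: x, y & v] =
  phi (mg_par R x * y :: v) - cbar (rshift (mg_par R x) phi) (y :: v).
Proof. by []. Qed.

Fact cbar_zmod : zmod_morphism cbar.
Proof.
move=> phi psi; apply/funext => a; elim: a phi psi => [|x [|y v] IH] phi psi //.
  by rewrite fctB /= fctB mulrBl.
rewrite fctB !cbarE.
have -> : rshift (mg_par R x) (phi - psi) =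
  rshift (mg_par R x) phi - rshift (mg_par R x) psi by [].
by rewrite IH !fctB; ring.
Qed.
HB.instance Definition _ := GRing.isZmodMorphism.Build _ _ cbar cbar_zmod.

Lemma cobound_cons phi (x : R) (u : seq R) :
  cobound phi (x :: u) = - (mg_aug R x * phi u) + cbar phi (x :: u).
Proof.
rewrite /cobound -addrA; congr (_ + _).
elim: u x phi => [|y v IH] x phi; first by rewrite big_ord0 /= expr0 add0r mul1r.
rewrite cbarE -IH big_ord_recl /= expr0 mul1r -addrA; rewrite drop0; congr (_ + _).
rewrite opprD exprS mulN1r mulNr; congr (_ + _).
rewrite -sumrN; apply: eq_bigr => i _.
by rewrite /bump /= exprS mulN1r mulNr.
Qed.

Lemma cbar_madd phi : madd phi -> madd (cbar phi).
Proof.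
move=> hp a b; elim: a phi hp => [|z a IH] phi hp x y.
  case: b => [|t b]; first by rewrite /= rmorphD mulrDr.
  rewrite !cat0s !cbarE rmorphD mulrDl (hp [::]) !cat0s.
  have -> : rshift (mg_par R x + mg_par R y) phi =
     rshift (mg_par R x) phi + rshift (mg_par R y) phi.
    by apply/funext => c; rewrite fctE; apply: (hp [::]).
  by rewrite (raddfD cbar) fctE; ring.
have := IH _ (madd_rshift (mg_par R z) hp) x y.
case: a {IH} => [|t a]; rewrite ?cat0s !cat_cons ?cat0s !cbarE => ->.
  by rewrite mulrDr (hp [::]) !cat0s; ring.
by rewrite -!cat_cons hp; ring.
Qed.

Lemma cobound_madd phi : madd phi -> madd (cobound phi).
Proof.
move=> hp [|z a] b x y; rewrite ?cat0s ?cat_cons !cobound_cons.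
  by have := cbar_madd hp [::] b x y; rewrite /= => ->; rewrite rmorphD; ring.
by have := cbar_madd hp (z :: a) b x y; rewrite /= => ->; rewrite hp; ring.
Qed.

Definition normalised phi := forall a b, phi (a ++ 1 :: b) = 0.

(** Merging the letter 1 with its left neighbour cancels against merging it with its right neighbour
    or, at the end of the word, against the last outer term. A leading 1 needs the first outer term,
    see [cobound_norm]. *)
Lemma cbar_norm phi (z : R) a b : normalised phi -> cbar phi (z :: a ++ 1 :: b) = 0.
Proof.
elim: a z phi => [|y a IH] z phi hp.
  have -> : cbar phi [:: z, 1 & b] =
      phi (mg_par R z * 1 :: b) - cbar (rshift (mg_par R z) phi) (1 :: b) by [].
  case: b => [|t b]; first by rewrite /= rmorph1 !mulr1 subrr.
  rewrite cbarE rmorph1 mulr1 mul1r.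
  have -> : rshift 1 (rshift (mg_par R z) phi) = 0.
    by apply/funext => c; apply: (hp [:: mg_par R z] c).
  by rewrite raddf0 subr0 subrr.
rewrite cat_cons cbarE [phi _](hp (mg_par R z * y :: a) b) (IH y) ?subr0 // => c e.
exact: (hp (_ :: c) e).
Qed.

Lemma cobound_norm phi : normalised phi -> normalised (cobound phi).
Proof.
move=> hp [|z a] b; rewrite ?cat0s ?cat_cons cobound_cons; last first.
  by rewrite hp mulr0 oppr0 add0r cbar_norm.
case: b => [|t b]; first by rewrite /= rmorph1 mul1r mulr1 addNr.
rewrite cbarE !rmorph1 !mul1r.
have -> : rshift 1 phi = 0 by apply/funext => c; apply: (hp [::] c).
by rewrite raddf0 subr0 addNr.
Qed.

Lemma cobound_size phi s : (forall a, size a != s -> phi a = 0) ->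
  forall a, size a != s.+1 -> cobound phi a = 0.
Proof.
move=> hp [//|x u] su; rewrite cobound_cons hp ?mulr0 ?oppr0 ?add0r; last by move: su => /=; lia.
elim: u x s phi hp su => [|y v IH] x s phi hp su.
  by rewrite /= hp ?mul0r //=; lia.
rewrite cbarE hp ?sub0r; last by move: su => /=; lia.
case: s hp su => [|s] hp su.
  have -> : rshift (mg_par R x) phi = 0 by apply/funext => c; rewrite /rshift hp.
  by rewrite (raddf0 cbar) oppr0.
rewrite (IH y s) ?oppr0 // => a sa.
by rewrite /rshift hp.
Qed.

Definition wval phi : word -> int :=
  fun w => (-1) ^+ (mg_odd R * wsign w) * phi (map (mg_mon R) w).

Hypothesis mg_mul : forall d e,
  mg_mon R d * mg_mon R e = mg_mon R (d + e)%MM *~ (-1) ^+ (mg_odd R * inversions d e).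

Lemma wval_cbar phi w : madd phi -> 0%MM \notin w ->
  (-1) ^+ (mg_odd R * wsign w) * cbar phi (map (mg_mon R) w) = d0 (wval phi) w.
Proof.
move=> hp; elim: w phi hp => [|x u IH] phi hp; first by rewrite mulr0.
rewrite inE negb_or eq_sym => /andP[x0 u0].
case: u u0 IH => [|y v] u0 IH.
  by rewrite /= mg_aug_mon (negPf x0) !mulr0 subrr.
have shE : rshift (mg_par R (mg_mon R x)) phi =
    rshift (mg_mon R x) phi *~ (-1) ^+ (mg_odd R * mdeg x).
  apply/funext => c; rewrite fct_mulrz /rshift mg_par_mon mulrzz.
  exact: (maddMz [::] c hp).
have IH' := IH _ (madd_rshift (mg_mon R x) hp) u0.
rewrite 2![map _ _]/= cbarE -[mg_mon R y :: _]/(map (mg_mon R) (y :: v)).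
rewrite shE (raddfMz cbar) fct_mulrz mulrzz mg_par_mon mulrzAl mg_mul -mulrzA -exprD.
have -> : forall t c, phi (t *~ c :: map (mg_mon R) v) = phi (t :: map (mg_mon R) v) * c.
  by move=> t c; apply: (maddMz [::] _ hp).
rewrite d0E mulrBr; congr (_ - _).
  rewrite /wval [map _ (_ :: _)]/= mulrCA mulrC -exprD; congr (_ * _).
  apply: sign_eq; rewrite wsign_merge; move: (wsign _) => n.
  case: (mg_odd R); rewrite ?mul0n // !mul1n !oddD.
  by case: (odd n); case: (odd (mdeg x)); case: (odd (inversions x y)).
have -> : shift x (wval phi) = fun u => (-1) ^+ (mg_odd R * (mdeg x * size u + winversions x u))
    * wval (rshift (mg_mon R x) phi) u.
  by apply/funext => u; rewrite /shift /wval mulrA -exprD -mulnDr.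
(* A merge shortens the tail by one letter, which changes the contribution of x to [wsign] by
   [mdeg x]; this is the sign of [mg_par] at x. *)
rewrite (d0_twist (c := (-1) ^+ (mg_odd R * (mdeg x * size v + winversions x (y :: v))))).
  rewrite -IH' [RHS]mulrA -exprD mulrCA -exprD mulrC; congr (_ * _).
  apply: sign_eq; rewrite (wsign_cons x); move: (wsign _) (winversions _ _) => n p.
  case: (mg_odd R); rewrite ?mul0n // !mul1n /= mulnS !oddD.
  by case: (odd n); case: (odd (mdeg x)); case: (odd p); case: (odd (_ * _)).
move=> a z t b e; rewrite (_ : size v = size (a ++ (z + t)%MM :: b)); last first.
  by move/(congr1 size): e; rewrite !size_cat /=; lia.
by rewrite e !winversions_cat !winversions_cons inversionsDr -!addnA.
Qed.

Lemma wval_cobound phi : madd phi -> normalised phi -> wval (cobound phi) = dw (wval phi).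
Proof.
move=> hp np; apply/funext => w; rewrite /dw /nzw; case: ifP => [w0|/negbT w0].
  have [u [v ->]] : exists u v, w = u ++ 0%MM :: v by case/splitPr: w0 => u v; exists u, v.
  by rewrite /wval map_cat /= mg_mon0 cobound_norm // mulr0.
rewrite -wval_cbar // /wval; case: w w0 => [|x u]; first by rewrite !mulr0.
rewrite inE negb_or eq_sym => /andP[x0 _].
by rewrite [map _ _]/= cobound_cons mg_aug_mon (negPf x0) mul0r oppr0 add0r.
Qed.
End MonomialRing.

(** * Ext of a ring with a basis of monomials *)

(** The monomials in [mb_mem] form a basis with the dual family [mb_coef], and the other monomials
    vanish. Additivity of [mb_coef] is asked for on [mb_mem] only: elsewhere the coefficient in a
    quotient ring depends on the representative. *)
Record monomial_basis m (R : mgalg m) := MonomialBasis {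
  mb_mem : pred 'X_{1..m};
  mb_coef : 'X_{1..m} -> R -> int;
  mb_memD : forall d e, mb_mem (d + e)%MM -> mb_mem d && mb_mem e;
  mb_coefD : forall d x y, mb_mem d -> mb_coef d (x + y) = mb_coef d x + mb_coef d y;
  mb_coef_mon : forall d e, mb_mem d -> mb_coef d (mg_mon R e) = (d == e)%:R;
  mb_out : forall e, ~~ mb_mem e -> mg_mon R e = 0;
  mb_span : forall x, exists t : seq ('X_{1..m} * int),
    x = \sum_(p <- t) mg_mon R p.1 *~ p.2;
  mb_mul : forall d e,
    mg_mon R d * mg_mon R e = mg_mon R (d + e)%MM *~ (-1) ^+ (mg_odd R * inversions d e) }.

Section WordCohomology.
Local Open Scope quotient_scope.
Variables (m : nat) (R : mgalg m) (B : monomial_basis R).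
Local Notation mon := 'X_{1..m}.
Local Notation word := (seq mon).
Implicit Types (phi psi : seq R -> int) (a b : seq R) (g h : word -> int) (w u v : word)
  (d e x : mon) (I : mon) (s n : nat).

Definition wcochain_pred s I g := forall w, g w != 0 ->
  [/\ (size w).+1 = s, forall j, cntw j w = I j, 0%MM \notin w & all (mb_mem B) w].

(** The multi-additive extension of g from words in the basis. The degree bound n makes the sums
    finite and loses nothing when g lives on letters of degree below n, see [wext_mon]. *)
Fixpoint wext n g a : int :=
  if a is x :: u then
    \sum_(d : 'X_{1..m < n} | mb_mem B d) mb_coef B d x * wext n (shift d g) u
  else g [::].

Fact wext_zmod n : zmod_morphism (wext n).
Proof.
move=> g h; apply/funext => a; elim: a g h => [|x u IH] g h //.
rewrite fctB /= -sumrB; apply: eq_bigr => d _.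
have -> : shift d (g - h) = shift d g - shift d h by [].
by rewrite IH fctB mulrBr.
Qed.
HB.instance Definition _ n := GRing.isZmodMorphism.Build _ _ (wext n) (wext_zmod n).

Lemma wext_madd n g : madd (wext n g).
Proof.
move=> a b x y; elim: a g => [|z a IH] g /=; rewrite -big_split /=.
  by apply: eq_bigr => d Bd; rewrite mb_coefD // mulrDl.
by apply: eq_bigr => d _; rewrite IH mulrDr.
Qed.

Lemma wext_eq0 n g a : (forall w, size w = size a -> g w = 0) -> wext n g a = 0.
Proof.
elim: a g => [|x u IH] g hg /=; first exact: hg.
by rewrite big1 // => d _; rewrite IH ?mulr0 // => w sw; apply: hg; rewrite /= sw.
Qed.

Lemma wext_cons_mon n g e a : (forall w, g (e :: w) != 0 -> mb_mem B e && (mdeg e < n)%N) ->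
  wext n g (mg_mon R e :: a) = wext n (shift e g) a.
Proof.
move=> he /=; have [/andP[Be ne]|he'] := boolP (mb_mem B e && (mdeg e < n)%N).
  rewrite (bigD1 (BMultinom ne)) //= mb_coef_mon // eqxx mul1r big1 ?addr0 //.
  move=> d /andP[Bd]; rewrite bmeqP /= => /negPf de.
  by rewrite mb_coef_mon // de mul0r.
rewrite big1 => [|d Bd]; last first.
  rewrite mb_coef_mon //; case: eqP => [de|_]; last by rewrite mul0r.
  by move: he'; rewrite -de Bd bmdeg.
apply/esym/wext_eq0 => w _; apply/eqP; apply: contraNT he'.
by move=> /he.
Qed.

Lemma wext_mon n g w :
  (forall w, g w != 0 -> all (fun x => mb_mem B x && (mdeg x < n)%N) w) ->
  wext n g (map (mg_mon R) w) = g w.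
Proof.
elim: w g => [//|x u IH] g hg; rewrite [map _ _]/= wext_cons_mon => [|w /hg /andP[] //].
by apply: IH => w /hg /andP[].
Qed.

Lemma wext_norm n g : (forall w, g w != 0 -> 0%MM \notin w) -> normalised (wext n g).
Proof.
move=> hg a b; elim: a g hg => [|x a IH] g hg.
  rewrite cat0s -mg_mon0 wext_cons_mon => [|w /hg]; last by rewrite inE eqxx.
  by apply: wext_eq0 => w _; apply/eqP/negPn/negP => /hg; rewrite inE eqxx.
rewrite /= big1 // => d _; rewrite IH ?mulr0 // => w /hg.
by rewrite inE negb_or => /andP[].
Qed.

Lemma madd_homog phi a (u : seq (mon * R)) : madd phi ->
  (forall p, p \in u -> mg_homog p.1 p.2) ->
  exists c, phi (a ++ [seq p.2 | p <- u]) =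
    phi (a ++ map (mg_mon R) [seq p.1 | p <- u]) * c.
Proof.
move=> hp; elim: u a => [|[x y] u IH] a hu; first by exists 1; rewrite mulr1.
have [c cE] : mg_homog x y by apply: (hu (x, y)); rewrite inE eqxx.
have [|c' c'E] := IH (rcons a (mg_mon R x)).
  by move=> p pu; apply: hu; rewrite inE pu orbT.
by exists (c' * c); rewrite /= cE maddMz // -!cat_rcons c'E mulrA.
Qed.

Lemma madd_ext s phi psi : madd phi -> madd psi ->
  (forall a, size a != s -> phi a = 0) -> (forall a, size a != s -> psi a = 0) ->
  (forall w, size w = s -> phi (map (mg_mon R) w) = psi (map (mg_mon R) w)) -> phi = psi.
Proof.
move=> hp hq sp sq pq; apply/funext => a.
have [sa|sa] := eqVneq (size a) s; last by rewrite sp ?sq.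
suff h w b : (size w + size b = s)%N ->
    phi (map (mg_mon R) w ++ b) = psi (map (mg_mon R) w ++ b) by apply: (h [::]).
elim: b w => [|x b IH] w swb; first by rewrite cats0 pq // -swb addn0.
have [t ->] := mb_span B x; rewrite !madd_sum //; apply: eq_bigr => p _.
rewrite !maddMz //; congr (_ * _); rewrite -!cat_rcons -map_rcons.
by apply: IH; rewrite size_rcons addSnnS.
Qed.

(** Inverse to [wval], the sign being its own inverse. A letter of a word of multi-degree I has
    degree at most |I|, whence the bound. *)
Definition wcochain I g : seq R -> int :=
  wext (mdeg I).+1 (fun w => (-1) ^+ (mg_odd R * wsign w) * g w).

Lemma wcochainB I g h : wcochain I (g - h) = wcochain I g - wcochain I h.
Proof.
rewrite -(raddfB (wext _)); congr wext.
by apply/funext => w; rewrite !fctB mulrBr.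
Qed.

Lemma wcochain0 I : wcochain I 0 = 0.
Proof. by rewrite -(subrr 0) wcochainB subrr. Qed.

Lemma wcochain_mdeg s I g w : wcochain_pred s I g -> g w != 0 ->
  all (fun x => mb_mem B x && (mdeg x < (mdeg I).+1)%N) w.
Proof.
move=> hg /hg[_ gI _ /allP gB]; apply/allP => x xw; rewrite gB //= ltnS !mdegE.
by apply: leq_sum => j _; rewrite -gI /cntw (big_rem x) //= leq_addr.
Qed.

Lemma signz_mulK n (c : int) : (-1) ^+ n * ((-1) ^+ n * c) = c.
Proof. by rewrite mulrA -signr_odd -expr2 sqrr_sign mul1r. Qed.

Lemma wval_wcochain s I g : wcochain_pred s I g -> wval (wcochain I g) = g.
Proof.
move=> hg; apply/funext => w; rewrite /wval /wcochain wext_mon ?signz_mulK //.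
move=> v; have [->|/(wcochain_mdeg hg) //] := eqVneq (g v) 0.
by rewrite mulr0 eqxx.
Qed.

Lemma cntw_sum I w : (\big[+%MM/0%MM]_(x <- w) x)%MM = I <-> forall j, cntw j w = I j.
Proof.
split=> [<- j|h]; first by rewrite mnm_sumE.
by apply/mnmP => j; rewrite mnm_sumE -h.
Qed.

Lemma is_cochain_wcochain s I g : wcochain_pred s.+1 I g -> is_cochain s I (wcochain I g).
Proof.
move=> hg; have hg' w : (-1) ^+ (mg_odd R * wsign w) * g w != 0 -> g w != 0.
  by apply: contra_neq => ->; rewrite mulr0.
split.
- move=> a sa; apply: wext_eq0 => w sw; apply/eqP; apply: contraNT sa.
  by move=> /hg' /hg[[<-] _ _ _]; rewrite -sw.
- exact: wext_madd.
- by apply: wext_norm => w /hg' /hg[].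
- move=> u hu uI; rewrite /wcochain; set g' := fun w => _ * _.
  have [c] := madd_homog [::] (@wext_madd (mdeg I).+1 g') hu; rewrite cat0s => ->.
  rewrite cat0s wext_mon; last by move=> w /hg'; apply: wcochain_mdeg hg.
  rewrite /g'; suff -> : g [seq p.1 | p <- u] = 0 by rewrite mulr0 mul0r.
  apply/eqP; apply: contraNT uI => /hg[_ /cntw_sum <- _ _].
  by rewrite big_map.
Qed.

Lemma wcochain_wval s I phi : is_cochain s I phi -> wcochain_pred s.+1 I (wval phi).
Proof.
move=> [p1 p2 p3 p4] w; rewrite /wval => pw.
have {}pw : phi (map (mg_mon R) w) != 0.
  by apply: contra_neq pw => ->; rewrite mulr0.
split.
- by congr S; apply/eqP; apply: contraNT pw => sw; rewrite p1 // size_map.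
- apply/cntw_sum/eqP; apply: contraNT pw => wI.
  have := p4 [seq (x, mg_mon R x) | x <- w]; rewrite -map_comp /= => ->//.
    by move=> _ /mapP[x _ ->]; exists 1.
  by rewrite big_map.
- apply: contraNN pw => /splitPr[u v].
  by rewrite map_cat /= mg_mon0 p3.
- apply: contraNT pw => /allPn[x /splitPr[u v] /(@mb_out _ _ B) x0].
  by rewrite map_cat /= x0 madd0.
Qed.

Lemma wval_inj s phi psi : madd phi -> madd psi ->
  (forall a, size a != s -> phi a = 0) -> (forall a, size a != s -> psi a = 0) ->
  wval phi = wval psi -> phi = psi.
Proof.
move=> hp hq sp sq e; apply: (madd_ext hp hq sp sq) => w _.
have := congr1 (fun f => f w) e; rewrite /wval.
by move=> /(congr1 (fun c => (-1) ^+ (mg_odd R * wsign w) * c)); rewrite !signz_mulK.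
Qed.

Lemma wvalK s I phi : is_cochain s I phi -> wcochain I (wval phi) = phi.
Proof.
move=> cp; have cw := is_cochain_wcochain (wcochain_wval cp).
apply: (@wval_inj s); rewrite ?(wval_wcochain (wcochain_wval cp)) //.
- exact: coch_add cw.
- exact: coch_add cp.
- exact: coch_size cw.
- exact: coch_size cp.
Qed.

Lemma wcochain_dw s I g : wcochain_pred s I g -> wcochain_pred s.+1 I (dw g).
Proof.
move=> hg w; rewrite /dw /nzw; case: ifP => [|w0]; first by rewrite eqxx.
move=> /d0_neq0[u [x [y [v [ew gw]]]]]; rewrite ew.
have [gs gI _ gB] := hg _ gw; split.
- by rewrite -gs !size_cat /=; lia.
- by move=> j; rewrite -gI !cntw_cat !cntw_cons mnmDE; lia.
- by [].
- by move: gB; rewrite !all_cat /= => /and3P[-> /mb_memD/andP[-> ->] ->].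
Qed.

Lemma wval_cobound_cochain s I phi : is_cochain s I phi ->
  wval (cobound phi) = dw (wval phi).
Proof. by move=> cp; apply: wval_cobound (coch_add cp) (coch_norm cp); apply: mb_mul B. Qed.

Lemma cobound_wcochain s I g : wcochain_pred s.+1 I g ->
  cobound (wcochain I g) = wcochain I (dw g).
Proof.
move=> hg; have cw := is_cochain_wcochain hg.
have cdw := is_cochain_wcochain (wcochain_dw hg).
apply: (@wval_inj s.+1).
- exact: cobound_madd (coch_add cw).
- exact: coch_add cdw.
- exact: cobound_size (coch_size cw).
- exact: coch_size cdw.
- by rewrite (wval_cobound_cochain cw) (wval_wcochain hg) (wval_wcochain (wcochain_dw hg)).
Qed.

Definition wcocycle s I g := wcochain_pred s.+1 I g /\ dw g = 0.

Lemma wcocycleP s I g : wcocycle s I g -> wcochain I g \in cocycle_pred s I.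
Proof.
move=> [hg dg]; apply/asboolP; split; first exact: is_cochain_wcochain.
by rewrite (cobound_wcochain hg) dg wcochain0.
Qed.

Lemma cocycle_wval s I phi : phi \in cocycle_pred s I -> wcocycle s I (wval phi).
Proof.
move=> /asboolP[cp dp]; split; first exact: wcochain_wval.
rewrite -(wval_cobound_cochain cp) dp; apply/funext => w.
by rewrite /wval mulr0.
Qed.

Definition wclass s I g : Ext R s I := Ext_class s I (wcochain I g).

Lemma Ext_classB s I phi psi : phi \in cocycle_pred s I -> psi \in cocycle_pred s I ->
  Ext_class s I (phi - psi) = Ext_class s I phi - Ext_class s I psi :> Ext R s I.
Proof.
move=> cp cq; rewrite /Ext_class -(raddfB (\pi_{ideal_quot (@coboundary m R s I)})) /=.
congr (\pi_{ideal_quot _} _); apply: val_inj.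
by rewrite raddfB /= !insubdK ?rpredB.
Qed.

Lemma Ext_class_eq0 s I phi : phi \in cocycle_pred s I ->
  (Ext_class s I phi = 0 :> Ext R s I) <->
  exists2 psi, is_prev_cochain s I psi & phi = cobound psi.
Proof.
move=> cp; rewrite /Ext_class; split.
  move=> /eqP; rewrite -(raddf0 (\pi_{ideal_quot (@coboundary m R s I)})).
  rewrite -Quotient.idealrBE subr0 => /asboolP[psi h1 h2]; exists psi => //.
  by rewrite -h2 /= insubdK.
move=> [psi h1 h2]; apply/eqP.
rewrite -(raddf0 (\pi_{ideal_quot (@coboundary m R s I)})) -Quotient.idealrBE subr0.
by apply/asboolP; exists psi; rewrite /= ?insubdK.
Qed.

Lemma Ext_repr_cocycle s I (x : Ext R s I) : Ext_repr x \in cocycle_pred s I.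
Proof. exact: valP. Qed.

Lemma Ext_reprK s I (x : Ext R s I) : Ext_class s I (Ext_repr x) = x.
Proof. by rewrite /Ext_class /Ext_repr valKd reprK. Qed.

Definition Ext_word s I (x : Ext R s I) : word -> int := wval (Ext_repr x).

Lemma Ext_wordP s I (x : Ext R s I) : wcocycle s I (Ext_word x).
Proof. exact/cocycle_wval/Ext_repr_cocycle. Qed.

Lemma Ext_class_wval s I phi : phi \in cocycle_pred s I ->
  Ext_class s I phi = wclass s I (wval phi).
Proof. by move=> /asboolP[cp _]; rewrite /wclass (wvalK cp). Qed.

Lemma Ext_wordK s I (x : Ext R s I) : wclass s I (Ext_word x) = x.
Proof. by rewrite -Ext_class_wval ?Ext_reprK ?Ext_repr_cocycle. Qed.

Lemma wclassB s I g h : wcocycle s I g -> wcocycle s I h ->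
  wclass s I (g - h) = wclass s I g - wclass s I h.
Proof. by move=> /wcocycleP cg /wcocycleP ch; rewrite -Ext_classB // -wcochainB. Qed.

Lemma wclass_eq0 s I g : wcocycle s I g ->
  wclass s I g = 0 <-> exists2 h, wcochain_pred s I h & g = dw h.
Proof.
move=> zg; have [hg dg] := zg; split.
  move=> /(Ext_class_eq0 (wcocycleP zg))[psi ppsi e].
  case: s zg hg ppsi e => [|s] zg hg /= ppsi e.
    exists 0; first by move=> w; rewrite eqxx.
    rewrite dw0 -(wval_wcochain hg) e ppsi cobound0.
    by apply/funext => w; rewrite /wval mulr0.
  exists (wval psi); first exact: wcochain_wval.
  by rewrite -(wval_cobound_cochain ppsi) -e (wval_wcochain hg).
move=> [h hh gE]; apply/(Ext_class_eq0 (wcocycleP zg)).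
case: s hh zg hg => [|s] hh zg hg.
  exists 0 => //; rewrite gE cobound0.
  have -> : h = 0 by apply/funext => w; apply/eqP/negPn/negP => /hh[].
  by rewrite dw0 wcochain0.
exists (wcochain I h); first exact: is_cochain_wcochain.
by rewrite gE (cobound_wcochain hh).
Qed.

Lemma Ext_word_wclass s I g : wcocycle s I g ->
  exists2 h, wcochain_pred s I h & Ext_word (wclass s I g) = g + dw h.
Proof.
move=> zg; have zw := Ext_wordP (wclass s I g).
have zB : wcocycle s I (Ext_word (wclass s I g) - g).
  split; last by rewrite dwB (proj2 zg) (proj2 zw) subr0.
  move=> w; rewrite fctB; case: (eqVneq (g w) 0) => [->|/(proj1 zg)//].
  by rewrite subr0 => /(proj1 zw).
have [h hh e] : exists2 h, wcochain_pred s I h & Ext_word (wclass s I g) - g = dw h.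
  by apply/(wclass_eq0 zB); rewrite wclassB // Ext_wordK subrr.
by exists h => //; rewrite -e addrC subrK.
Qed.

End WordCohomology.

(** * Monomial bases of the two face rings *)

Section Supports.
Variable m : nat.
Implicit Types (d e : 'X_{1..m}) (S T : {set 'I_m}).

Definition msupport d : {set 'I_m} := [set i | 0 < d i]%N.
Definition mindic S : 'X_{1..m} := [multinom (i \in S : nat) | i < m].
Definition squarefree d := [forall i, d i <= 1]%N.

Lemma msupportD d e : msupport (d + e)%MM = msupport d :|: msupport e.
Proof. by apply/setP => i; rewrite !inE mnmDE addn_gt0. Qed.

Lemma msupport_mindic S : msupport (mindic S) = S.
Proof. by apply/setP => i; rewrite inE mnmE; case: (i \in S). Qed.

Lemma squarefree_mindic S : squarefree (mindic S).
Proof. by apply/forallP => i; rewrite mnmE; case: (i \in S). Qed.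

Lemma mindic_msupport d : squarefree d -> mindic (msupport d) = d.
Proof.
move=> /forallP sd; apply/mnmP => i; rewrite mnmE inE.
by have := sd i; case: (d i) => [|[|]].
Qed.

Lemma squarefreeD d e : squarefree (d + e)%MM =
  [&& squarefree d, squarefree e & [disjoint msupport d & msupport e]].
Proof.
apply/forallP/and3P => [h|[/forallP hd /forallP he /pred0P dis] i].
  split; try by apply/forallP => i; move: (h i); rewrite mnmDE; lia.
  by apply/pred0P => i /=; rewrite !inE; move: (h i); rewrite mnmDE; lia.
by have := dis i; rewrite /= !inE mnmDE; move: (hd i) (he i); lia.
Qed.

Lemma eps_inversions d e : squarefree d -> squarefree e ->
  eps (msupport d) (msupport e) = inversions d e.
Proof.
move=> /forallP sd /forallP se; rewrite epsE /inversions big_mkcond /=.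
apply: eq_bigr => i _; rewrite inE.
case: posnP => [->|di]; first by rewrite big1 // => k _; rewrite mul0n.
have -> : d i = 1%N by have := sd i; lia.
rewrite big_mkcond [RHS]big_mkcond; apply: eq_bigr => k _; rewrite inE /= mul1n.
by have := se k; case: (k < i)%N; case: (e k) => [|[|]].
Qed.

Lemma mg_mon_mindic (R : mgalg m) S : mg_mon R (mindic S) = mg_sqf R S.
Proof.
rewrite /mg_sqf big_mkcond; apply: eq_bigr => i _.
by rewrite mnmE; case: (i \in S).
Qed.

Lemma mg_mon_face (R : mgalg m) (K : scomplex m) d :
  mg_mon (face_alg R K) d = rq_pi (sr_mon K) (mg_mon R d).
Proof. by rewrite /mg_mon rmorph_prod; apply: eq_bigr => i _; rewrite rmorphXn. Qed.

Lemma rq_pi_sqf (R : mgalg m) (K : scomplex m) S : S \notin sc_faces K ->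
  rq_pi (sr_mon (R := R) K) (mg_sqf R S) = 0.
Proof. by move=> SK; apply: (sr_sub (subxx _)); exists S. Qed.

Lemma face_memD (K : scomplex m) d e : msupport (d + e)%MM \in sc_faces K ->
  (msupport d \in sc_faces K) && (msupport e \in sc_faces K).
Proof.
rewrite msupportD => h; apply/andP.
by split; apply: sc_down h _; rewrite ?subsetUl ?subsetUr.
Qed.
End Supports.

Section PolynomialBasis.
Variables (m : nat) (K : scomplex m).
Local Notation pK := (polynomial_face K).
Local Notation pi := (rq_pi (sr_mon (R := polynomial_alg m) K)).
Implicit Types (d e : 'X_{1..m}) (p : {mpoly int[m]}).

Lemma mg_mon_polynomial d : mg_mon (polynomial_alg m) d = 'X_[d].
Proof. by rewrite [RHS]mpolyXE_id. Qed.

Definition poly_coef d (x : pK) : int := (rq_repr x : {mpoly int[m]})@_d.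

(** Each monomial of an element of the ideal has a non-face inside its support, so the coefficient
    at a face does not depend on the representative. *)
Lemma poly_coef_pi d p : msupport d \in sc_faces K -> poly_coef d (pi p) = p@_d.
Proof.
move=> dK; apply/eqP; rewrite -subr_eq0 -mcoeffB; apply/eqP.
have : rq_repr (pi p) - p \in ideal_gen (sr_mon (R := polynomial_alg m) K).
  by rewrite -rq_piE rq_reprK.
move=> /ideal_genP[t [Gt ->]]; rewrite raddf_sum big_seq big1 // => u /Gt[S SK ->] /=.
rewrite -mg_mon_mindic mg_mon_polynomial mulrAC memN_msupp_eq0 //.
rewrite (perm_mem (msuppMX _ _)); apply: contraNN SK => /mapP[e _ de].
by move: dK; rewrite de => /face_memD; rewrite msupport_mindic => /andP[].
Qed.

Fact poly_coefD d (x y : pK) : msupport d \in sc_faces K ->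
  poly_coef d (x + y) = poly_coef d x + poly_coef d y.
Proof.
move=> dK; elim/rq_ind: x => p; elim/rq_ind: y => q.
by rewrite -rq_piD !poly_coef_pi ?mcoeffD.
Qed.

Fact poly_coef_mon d e : msupport d \in sc_faces K ->
  poly_coef d (mg_mon pK e) = (d == e)%:R.
Proof.
by move=> dK; rewrite mg_mon_face poly_coef_pi // mg_mon_polynomial mcoeffX eq_sym.
Qed.

Fact poly_out e : msupport e \notin sc_faces K -> mg_mon pK e = 0.
Proof.
move=> eK; rewrite mg_mon_face mg_mon_polynomial.
(* Split off the square-free monomial of the support, which is a generator of the ideal. *)
have -> : e = (e - mindic (msupport e) + mindic (msupport e))%MM.
  by apply/mnmP => i; rewrite mnmDE mnmBE mnmE inE; lia.
by rewrite mpolyXD rq_piM -(mg_mon_polynomial (mindic _)) mg_mon_mindic rq_pi_sqf //; exact: mulr0.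
Qed.

Fact poly_span (x : pK) : exists t : seq ('X_{1..m} * int),
  x = \sum_(p <- t) mg_mon pK p.1 *~ p.2.
Proof.
elim/rq_ind: x => p; exists [seq (d, p@_d) | d <- msupp p].
have -> : pi p = \sum_(d <- msupp p) pi (p@_d *: 'X_[d]).
  by rewrite {1}(mpolyE p); apply: (raddf_sum (rq_pi _)).
rewrite [RHS]big_map; apply: eq_bigr => d _.
have -> : p@_d *: 'X_[d] = 'X_[d] *~ p@_d by rewrite -scaler_int intz.
rewrite mg_mon_face mg_mon_polynomial; exact: (raddfMz (rq_pi _)).
Qed.

Fact poly_mul d e : mg_mon pK d * mg_mon pK e =
  mg_mon pK (d + e)%MM *~ (-1) ^+ (mg_odd pK * inversions d e).
Proof. by rewrite !mg_mon_face !mg_mon_polynomial mpolyXD rmorphM. Qed.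

Definition poly_basis : monomial_basis pK :=
  @MonomialBasis m pK (fun d => msupport d \in sc_faces K) poly_coef (@face_memD m K)
    poly_coefD poly_coef_mon poly_out poly_span poly_mul.
End PolynomialBasis.

Section ExteriorBasis.
Variables (m : nat).
Implicit Types (d e : 'X_{1..m}) (S T U : {set 'I_m}).

Definition extalg_coef U (x : extalg m) : int := x U.
Fact extalg_coef_zmod U : zmod_morphism (extalg_coef U).
Proof. by move=> x y; rewrite /extalg_coef !ffunE. Qed.
HB.instance Definition _ U :=
  GRing.isZmodMorphism.Build (extalg m) int (extalg_coef U) (extalg_coef_zmod U).

Lemma extalg_monE S U : extalg_coef U (extalg_mon S) = (U == S)%:R.
Proof. exact: ffunE. Qed.

Lemma extalg_monM S T : extalg_mon S * extalg_mon T =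
  if [disjoint S & T] then extalg_mon (S :|: T) *~ (-1) ^+ eps S T else 0.
Proof.
have UE U : (extalg_mon S * extalg_mon T) U =
    if S \subset U then (-1) ^+ eps S (U :\: S) * (U :\: S == T)%:R else 0.
  rewrite extalgME; case: ifP => SU.
    rewrite (bigD1 S) //= big1 ?addr0; first by rewrite !ffunE eqxx mul1r.
    by move=> V /andP[_ /negPf VS]; rewrite ffunE VS mul0r mulr0.
  rewrite big1 // => V VU; rewrite ffunE; case: eqP => [VS|_]; last by rewrite mul0r mulr0.
  by rewrite -VS VU in SU.
apply/ffunP => U; rewrite UE -[RHS]/(extalg_coef U _).
case: (boolP [disjoint S & T]) => dST; last first.
  rewrite raddf0; case: ifP => // SU; case: eqP => [TE|_]; last by rewrite mulr0.
  by rewrite -TE -setI_eq0 setIDA setIC setDIl setDv setI0 eqxx in dST.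
rewrite raddfMz /= extalg_monE.
case: (boolP (S \subset U)) => SU; last first.
  case: eqP => [UST|_]; last by rewrite mul0rz.
  by rewrite UST subsetUl in SU.
case: (eqVneq U (S :|: T)) => [->|UST].
  by rewrite setDUl setDv set0U (setDidPl _) 1?disjoint_sym // eqxx mulr1 intz.
rewrite mul0rz; case: eqP => [TE|_]; last by rewrite mulr0.
by move: UST; rewrite -TE -{1}(setID U S) (setIidPr SU) eqxx.
Qed.
(** The factors come in increasing order, so there are no inversions and no sign. *)
Lemma mg_sqf_exterior S : mg_sqf (exterior_alg m) S = extalg_mon S.
Proof.
have h (r : seq 'I_m) : sorted (fun i k : 'I_m => i < k)%N r ->
    \prod_(i <- r) extalg_gen i = extalg_mon [set i in r].
  have tr : transitive (fun i k : 'I_m => i < k)%N by move=> i k l; apply: ltn_trans.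
  elim: r => [|i r IH] sr; first by rewrite big_nil set_nil.
  have /allP ir := order_path_min tr sr.
  rewrite big_cons IH ?(path_sorted sr) // extalg_monM set_cons.
  have -> : [disjoint [set i] & [set k in r]].
    by rewrite disjoints1 inE; apply/negP => /ir; rewrite ltnn.
  have -> : eps [set i] [set k in r] = 0%N; last by rewrite mulr1z.
  rewrite epsE big_set1 big1 // => k; rewrite inE => /ir; lia.
rewrite /mg_sqf -big_filter h; last first.
  apply: sorted_filter; first by move=> i k l; apply: ltn_trans.
  rewrite [index_enum _]unlock -enumT.
  by rewrite -[sorted _ _]/(sorted (relpre val ltn) _) -sorted_map val_enum_ord iota_ltn_sorted.
by congr extalg_mon; apply/setP => i; rewrite inE mem_filter mem_index_enum andbT.
Qed.

Lemma mg_mon_exterior d : mg_mon (exterior_alg m) d =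
  if squarefree d then extalg_mon (msupport d) else 0.
Proof.
case: ifP => [sd|]; first by rewrite -{1}(mindic_msupport sd) mg_mon_mindic mg_sqf_exterior.
move/negbT/forallPn => [i di].
have gg : extalg_gen i ^+ 2 = 0.
  rewrite expr2 extalg_monM; case: ifP => //.
  by rewrite disjoints1 inE eqxx.
have gn n : (1 < n)%N -> extalg_gen i ^+ n = 0.
  by move=> n1; rewrite -(subnK n1) exprD gg mulr0.
rewrite /mg_mon; elim: (index_enum _) (mem_index_enum i) => // k r IH.
rewrite inE big_cons => /orP[/eqP <-|/IH ->]; last by rewrite mulr0.
by rewrite [X in X * _]gn ?mul0r // ltnNge.
Qed.

Lemma extalg_sum (x : extalg m) : x = \sum_(S : {set 'I_m}) extalg_mon S *~ x S.
Proof.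
apply/ffunP => U; rewrite -[LHS]/(extalg_coef U _) -[RHS]/(extalg_coef U _) [RHS]raddf_sum.
rewrite (bigD1 U) //= big1 => [|S SU].
  by rewrite addr0 raddfMz /= extalg_monE eqxx intz.
by rewrite raddfMz /= extalg_monE eq_sym (negPf SU) mul0rz.
Qed.

Variable K : scomplex m.
Local Notation wK := (exterior_face K).
Local Notation pi := (rq_pi (sr_mon (R := exterior_alg m) K)).

Definition ext_mem d := (msupport d \in sc_faces K) && squarefree d.
Definition ext_coef d (x : wK) := face_coef (msupport d) x.

Fact ext_memD d e : ext_mem (d + e)%MM -> ext_mem d && ext_mem e.
Proof.
by rewrite /ext_mem squarefreeD => /and4P[/face_memD/andP[-> ->] -> ->].
Qed.

Fact ext_coefD d (x y : wK) : ext_mem d -> ext_coef d (x + y) = ext_coef d x + ext_coef d y.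
Proof.
move=> /andP[dK _]; elim/rq_ind: x => p; elim/rq_ind: y => q.
by rewrite -rq_piD /ext_coef !face_coef_pi // ffunE.
Qed.

Fact ext_coef_mon d e : ext_mem d -> ext_coef d (mg_mon wK e) = (d == e)%:R.
Proof.
move=> /andP[dK sd]; rewrite mg_mon_face /ext_coef face_coef_pi // mg_mon_exterior.
rewrite -[LHS]/(extalg_coef _ _); case: ifP => se; last first.
  by rewrite raddf0; case: eqP => // de; rewrite -de sd in se.
rewrite extalg_monE; congr (_ : bool)%:R; apply/eqP/eqP => [de|-> //].
by rewrite -(mindic_msupport sd) de mindic_msupport.
Qed.

Fact ext_out e : ~~ ext_mem e -> mg_mon wK e = 0.
Proof.
rewrite mg_mon_face mg_mon_exterior negb_and; case: ifP => se; last by rewrite raddf0.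
by rewrite orbF => eK; rewrite -mg_sqf_exterior rq_pi_sqf.
Qed.

Fact ext_span (x : wK) : exists t : seq ('X_{1..m} * int),
  x = \sum_(p <- t) mg_mon wK p.1 *~ p.2.
Proof.
elim/rq_ind: x => p; exists [seq (mindic V, p V) | V : {set 'I_m}].
rewrite [in LHS](extalg_sum p) (raddf_sum pi) big_map big_enum; apply: eq_bigr => S _.
rewrite mg_mon_face mg_mon_exterior squarefree_mindic msupport_mindic.
exact: (raddfMz pi).
Qed.

Fact ext_mul d e : mg_mon wK d * mg_mon wK e =
  mg_mon wK (d + e)%MM *~ (-1) ^+ (mg_odd wK * inversions d e).
Proof.
rewrite !mg_mon_face -rmorphM -(raddfMz pi) !mg_mon_exterior squarefreeD mul1n.
congr pi; case: ifP => sd; last by rewrite mul0r mul0rz.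
case: ifP => se; last by rewrite mulr0 mul0rz.
rewrite extalg_monM eps_inversions // msupportD /=.
by case: ifP; rewrite ?mul0rz.
Qed.

Definition ext_basis : monomial_basis wK :=
  @MonomialBasis m wK ext_mem ext_coef ext_memD ext_coefD ext_coef_mon ext_out ext_span ext_mul.
End ExteriorBasis.

(** * Products *)

Section WordProduct.
Variable m : nat.
Local Notation mon := 'X_{1..m}.
Local Notation word := (seq mon).
Implicit Types (g h : word -> int) (u v w : word) (x y : mon) (s t : nat).

Definition wcup s g h : word -> int := fun w => g (take s w) * h (drop s w).

(** Leibniz rule: the merges at the first s positions take place within the first s+1 letters, the
    others behind the first s letters. *)
Lemma d0_wcup s g h w : (forall u, size u != s -> g u = 0) ->
  d0 (wcup s g h) w = wcup s.+1 (d0 g) h w + (-1) ^+ s * wcup s g (d0 h) w.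
Proof.
elim: s g w => [|s IH] g [|x u] hg; try by rewrite /wcup /= !(mul0r, mulr0, addr0).
  have -> : wcup 0 g h = fun w => g [::] * h w.
    by apply/funext => w; rewrite /wcup take0 drop0.
  rewrite (@d0_twist _ (fun _ => g [::]) (g [::])) // mul1r.
  by rewrite /wcup /= take0 /= subrr mul0r add0r.
case: u => [|y v]; first by rewrite /wcup /= !(mul0r, mulr0, subrr, addr0).
rewrite d0E.
have -> : shift x (wcup s.+1 g h) = wcup s (shift x g) h by [].
rewrite IH => [|w sw]; last by rewrite /shift hg.
have -> : wcup s.+2 (d0 g) h [:: x, y & v] =
  wcup s.+1 g h ((x + y)%MM :: v) - wcup s.+1 (d0 (shift x g)) h (y :: v).
  by rewrite /wcup /= mulrBl.
by rewrite exprS mulN1r mulNr opprD addrA.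
Qed.

Lemma dw_wcup s g h : (forall u, size u != s -> g u = 0) -> nzw g = g -> nzw h = h ->
  dw (wcup s g h) = wcup s.+1 (dw g) h + wcup s g (dw h) *~ (-1) ^+ s.
Proof.
move=> sg ng nh; apply/funext => w; rewrite fctE fct_mulrz mulrzz mulrC.
have hw t : 0%MM \in w = (0%MM \in take t w) || (0%MM \in drop t w).
  by rewrite -mem_cat cat_take_drop.
rewrite {1}/dw /nzw; case: ifP => w0.
  have zg t : wcup t (dw g) h w = 0.
    rewrite /wcup -nh /dw /nzw; move: (hw t); rewrite w0.
    by case: (_ \in take t w) => /= [_|<-]; rewrite (mul0r, mulr0).
  have zh t : wcup t g (dw h) w = 0.
    rewrite /wcup -ng /dw /nzw; move: (hw t); rewrite w0.
    by case: (_ \in take t w) => /= [_|<-]; rewrite (mul0r, mulr0).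
  by rewrite zg zh mulr0 addr0.
rewrite d0_wcup // /wcup /dw /nzw.
move: (hw s) (hw s.+1); rewrite w0 => /esym/negbT/norP[_ /negPf->].
by move=> /esym/negbT/norP[/negPf-> _].
Qed.

Lemma wsign_cat u v : wsign (u ++ v) = (wsign u + wsign v +
   ((\sum_(x <- u) mdeg x) * size v + \sum_(x <- u) winversions x v))%N.
Proof.
elim: u => [|x u IH]; first by rewrite !big_nil mul0n !addn0.
rewrite cat_cons !wsign_cons IH !big_cons size_cat winversions_cat; ring.
Qed.
End WordProduct.

Section WordClassProduct.
Variables (m : nat) (R : mgalg m) (B : monomial_basis R).
Local Notation mon := 'X_{1..m}.
Local Notation word := (seq mon).
Local Notation wpred := (wcochain_pred B).
Implicit Types (g h : word -> int) (u v w : word) (x y I J : mon) (s t : nat).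

Lemma wpredD s I g h : wpred s I g -> wpred s I h -> wpred s I (g + h).
Proof.
move=> cg ch w; rewrite fctE; case: (eqVneq (g w) 0) => [->|/cg //].
by rewrite add0r => /ch.
Qed.

Lemma wpredMz s I g c : wpred s I g -> wpred s I (g *~ c).
Proof.
by move=> cg w; rewrite fct_mulrz mulrzz => h; apply: cg; apply: contra_neq h => ->; rewrite mul0r.
Qed.

Lemma wpred_nzw s I g : wpred s I g -> nzw g = g.
Proof.
move=> cg; apply/funext => w; rewrite /nzw; case: ifP => // w0.
by apply/esym/eqP/negPn/negP => /cg[_ _ /negP[]].
Qed.

Lemma wpred_size s I g : wpred s.+1 I g -> forall u, size u != s -> g u = 0.
Proof. by move=> cg u su; apply/eqP; apply: contraNT su => /cg[[->]]. Qed.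

Lemma wpred_wcup s t I J g h : wpred s.+1 I g -> wpred t J h ->
  wpred (s + t) (I + J)%MM (wcup s g h).
Proof.
move=> cg ch w; rewrite /wcup mulf_eq0 negb_or => /andP[/cg[[sg] gI g0 gB] /ch[sh hJ h0 hB]].
rewrite -(cat_take_drop s w); split.
- by rewrite size_cat sg -addnS sh.
- by move=> j; rewrite cntw_cat gI hJ mnmDE.
- by rewrite mem_cat negb_or g0.
- by rewrite all_cat gB.
Qed.

Lemma wcocycleD_dw s I g h : wcocycle B s I g -> wpred s I h -> wcocycle B s I (g + dw h).
Proof.
move=> [cg dg] ch; split; first exact: wpredD cg (wcochain_dw ch).
by rewrite dwD dg dw_dw addr0.
Qed.

Lemma wclassD_dw s I g h : wcocycle B s I g -> wpred s I h ->
  wclass B s I (g + dw h) = wclass B s I g.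
Proof.
move=> zg ch; have zh := wcocycleD_dw zg ch.
apply/eqP; rewrite -subr_eq0 -wclassB //; apply/eqP/wclass_eq0.
  split; last by rewrite dwB (proj2 zg) (proj2 zh) subr0.
  by rewrite addrC addKr; apply: wcochain_dw.
by exists h; rewrite // addrC addKr.
Qed.

Lemma wcocycleMz s I g c : wcocycle B s I g -> wcocycle B s I (g *~ c).
Proof.
move=> [cg dg]; split; first exact: wpredMz.
by rewrite (raddfMz (@dw m)) /= dg mul0rz.
Qed.

Lemma wcocycle0 s I : wcocycle B s I 0.
Proof. by split; [move=> w; rewrite eqxx|exact: dw0]. Qed.

Lemma wclass0 s I : wclass B s I 0 = 0.
Proof. by have z := wcocycle0 s I; rewrite -(subrr 0) wclassB ?subrr. Qed.

Lemma wclassN s I g : wcocycle B s I g -> wclass B s I (- g) = - wclass B s I g.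
Proof. by move=> zg; rewrite -sub0r wclassB ?wclass0 ?sub0r //; apply: wcocycle0. Qed.

Lemma wcocycleN s I g : wcocycle B s I g -> wcocycle B s I (- g).
Proof. by move=> zg; rewrite -[g]mulr1z -mulrNz; apply: wcocycleMz. Qed.

Lemma wcocycleD s I g h : wcocycle B s I g -> wcocycle B s I h -> wcocycle B s I (g + h).
Proof. by move=> [cg dg] [ch dh]; split; [apply: wpredD|rewrite dwD dg dh addr0]. Qed.

Lemma wclassD s I g h : wcocycle B s I g -> wcocycle B s I h ->
  wclass B s I (g + h) = wclass B s I g + wclass B s I h.
Proof.
by move=> zg zh; rewrite -{1}[h]opprK wclassB ?wclassN ?opprK //; apply: wcocycleN.
Qed.

Lemma wclass_sign s I g n : wcocycle B s I g ->
  wclass B s I (g *~ (-1) ^+ n) = wclass B s I g *~ (-1) ^+ n.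
Proof.
move=> zg; rewrite -signr_odd; case: (odd n); last by rewrite !mulr1z.
by rewrite expr1 !mulrNz !mulr1z wclassN.
Qed.

Lemma wcocycle_wcup s t I J g h : wcocycle B s I g -> wcocycle B t J h ->
  wcocycle B (s + t) (I + J)%MM (wcup s g h).
Proof.
move=> [cg dg] [ch dh]; split; first by rewrite -addnS; apply: wpred_wcup.
rewrite dw_wcup ?dg ?dh; [|exact: wpred_size cg|exact: wpred_nzw cg|exact: wpred_nzw ch].
by apply/funext => w; rewrite fctE fct_mulrz /wcup mul0r mulr0 mul0rz.
Qed.

Lemma wclass_wcup s t I J g g' h h' : wcocycle B s I g -> wcocycle B t J g' ->
  wpred s I h -> wpred t J h' ->
  wclass B (s + t) (I + J)%MM (wcup s (g + dw h) (g' + dw h')) =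
  wclass B (s + t) (I + J)%MM (wcup s g g').
Proof.
move=> zg zg' ch ch'; have [cg dg] := zg; have [cg' dg'] := zg'.
have zk := wcocycleD_dw zg' ch'; set k := g' + dw h' in zk *.
have [ck dk] := zk.
have e1 : wcup s g k = wcup s g g' + dw (wcup s g h' *~ (-1) ^+ s).
  rewrite (raddfMz (@dw m)) /= (dw_wcup (wpred_size cg) (wpred_nzw cg) (wpred_nzw ch')) dg.
  apply/funext => w; rewrite fctE fct_mulrz fctE fct_mulrz /wcup mul0r add0r.
  by rewrite -mulrzA -expr2 sqrr_sign mulr1z mulrDr.
transitivity (wclass B (s + t) (I + J)%MM (wcup s g k)); last first.
  rewrite e1 wclassD_dw //; first exact: wcocycle_wcup.
  by apply/wpredMz/wpred_wcup.
have -> : wcup s (g + dw h) k = wcup s g k + wcup s (dw h) k.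
  by apply/funext => w; rewrite /wcup !fctE mulrDl.
(* In degree 0 there are no coboundaries. Otherwise the words of h are one letter shorter, so its
   product with k is cut after s letters instead of s+1. *)
case: s g zg cg h ch e1 {dg} => [|s] g zg cg h ch e1.
  have -> : h = 0 by apply/funext => w; apply/eqP/negPn/negP => /ch[].
  rewrite dw0 (_ : wcup 0 0 k = 0) ?addr0 //.
  by apply/funext => w; rewrite /wcup mul0r.
have -> : wcup s.+1 (dw h) k = dw (wcup s h k).
  rewrite (dw_wcup (wpred_size ch) (wpred_nzw ch) (wpred_nzw ck)) dk.
  by apply/funext => w; rewrite fctE fct_mulrz /wcup mulr0 mul0rz addr0.
rewrite wclassD_dw //; first exact: wcocycle_wcup.
by rewrite addSnnS; apply: wpred_wcup.
Qed.

Lemma sum_mdeg w : (\sum_(x <- w) mdeg x)%N = mdeg (\big[+%MM/0%MM]_(x <- w) x)%MM.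
Proof. by rewrite mdeg_sum. Qed.

Lemma sum_winversions u v : (\sum_(x <- u) winversions x v)%N =
  inversions (\big[+%MM/0%MM]_(x <- u) x)%MM (\big[+%MM/0%MM]_(x <- v) x)%MM.
Proof.
have i0l y : inversions 0%MM y = 0%N.
  by apply: big1 => i _; apply: big1 => k _; rewrite mnm0E.
have i0r x : inversions x 0%MM = 0%N.
  by apply: big1 => i _; apply: big1 => k _; rewrite mnm0E muln0.
elim: u => [|x u IH]; first by rewrite !big_nil i0l.
rewrite !big_cons inversionsDl IH; congr (_ + _)%N.
elim: v {IH} => [|y v IH]; first by rewrite big_nil i0r /winversions big_nil.
by rewrite winversions_cons big_cons inversionsDr IH.
Qed.

(** Where the product is non-zero, the cross term of [wsign_cat] depends on I, J and t only. For
    even generators it disappears, and this discrepancy between the two rings is the sign in (1). *)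
Lemma wval_cup s t I J (phi psi : seq R -> int) :
  is_cochain s I phi -> is_cochain t J psi ->
  wval (cup s phi psi) = wcup s (wval phi) (wval psi)
    *~ (-1) ^+ (mg_odd R * (mdeg I * t + inversions I J)).
Proof.
move=> cp cq; have hp := wcochain_wval B cp; have hq := wcochain_wval B cq.
apply/funext => w; rewrite fct_mulrz mulrzz /wcup.
have [z|z] := eqVneq (wval phi (take s w) * wval psi (drop s w)) 0.
  rewrite z mul0r /wval /cup -map_take -map_drop.
  move/eqP: z; rewrite /wval mulrACA mulf_eq0 -exprD signr_eq0 /= => /eqP->.
  by rewrite mulr0.
move: (z); rewrite mulf_eq0 negb_or => /andP[/hp[[sp] /cntw_sum pI _ _] /hq[[sq] /cntw_sum qJ _ _]].
have rr (a b c d e : int) : a * b * (c * d) * e = a * c * e * (b * d) by ring.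
rewrite /wval /cup -map_take -map_drop rr -!exprD; congr (_ * _).
apply: sign_eq; rewrite -{1}(cat_take_drop s w) wsign_cat sum_mdeg sum_winversions.
by rewrite pI qJ sq !mulnDr !addnA.
Qed.

Lemma Ext_mulE s t I J (x : Ext R s I) (y : Ext R t J) :
  Ext_mul x y = wclass B (s + t) (I + J)%MM (wcup s (Ext_word x) (Ext_word y))
    *~ (-1) ^+ (mg_odd R * (mdeg I * t + inversions I J)).
Proof.
have cx := Ext_repr_cocycle x; have cy := Ext_repr_cocycle y.
rewrite /Ext_mul (Ext_class_wval B (cocycle_cup cx cy)).
move: cx cy => /asboolP[cx _] /asboolP[cy _].
rewrite (wval_cup cx cy) wclass_sign //.
by apply: wcocycle_wcup; apply: Ext_wordP.
Qed.

Lemma Ext_mul_wclass s t I J g h : wcocycle B s I g -> wcocycle B t J h ->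
  Ext_mul (wclass B s I g) (wclass B t J h) =
  wclass B (s + t) (I + J)%MM (wcup s g h) *~ (-1) ^+ (mg_odd R * (mdeg I * t + inversions I J)).
Proof.
move=> zg zh; rewrite Ext_mulE; congr (_ *~ _).
have [k ck ->] := Ext_word_wclass zg; have [l cl ->] := Ext_word_wclass zh.
exact: wclass_wcup.
Qed.
End WordClassProduct.

(** * The operations mu *)

Local Arguments d0 : simpl never.

(** * The connecting map on square-free words *)

Section SplitDoubled.
Variable m : nat.
Local Notation mon := 'X_{1..m}.
Local Notation word := (seq mon).
Implicit Types (g : word -> int) (a b u v w : word) (x y : mon) (j : 'I_m) (k : nat).

Lemma secw_adm0 j k g w : adm j 0 w -> secw j k g w = 0.
Proof.
rewrite adm0; elim: w k g => //= x u IH k g /andP[x1 u1].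
by rewrite IH // ifN //; lia.
Qed.

(* When u contains j at most once in each letter, x and y are the letters of its k-th
   and (k+1)-st occurrences of j, and they are adjacent. *)
Definition split_at j k u a x y b :=
  [/\ u = a ++ x :: y :: b, (cntw j a).+1 = k, (0 < x j)%N & (0 < y j)%N].

(** In u no letter contains j twice, so [secw] sees only the merge that puts the k-th and (k+1)-st
    occurrences into one letter, namely that of x and y at position [size a]. *)
Lemma d0_secw_at j k g u a x y b : adm j 0 u -> split_at j k u a x y b ->
  d0 (secw j k g) u = (-1) ^+ size a * g (a ++ (x + y - U_(j))%MM :: b).
Proof.
rewrite adm0 => + [eu]; rewrite eu {u eu}.
elim: a k g => [|z a IH] k g.
  rewrite !cat0s /cntw big_nil => /= /and3P[x1 y1 b1] <- xj yj; rewrite d0E expr0 mul1r.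
  rewrite /= mnmDE.
  rewrite ifT; last by lia.
  have -> : shift x (secw j 1 g) = secw j 0 (shift x g).
    apply/funext => v; rewrite /shift /=; have -> : (1 - x j = 0)%N by lia.
    by case: ifP => //; lia.
  have s0 h v : secw j 0 h v = 0 by elim: v h => //= t v IHv h; rewrite IHv.
  have -> : secw j 0 (shift x g) = 0 by apply/funext => v; apply: s0.
  by rewrite (raddf0 (@d0 m)) subr0.
rewrite !cat_cons => /= /andP[z1 hw]; rewrite cntw_cons => ck xj yj; have ck' : (z j < k)%N by lia.
have -> : d0 (secw j k g) (z :: a ++ [:: x, y & b]) =
    - d0 (secw j (k - z j) (shift z g)) (a ++ [:: x, y & b]).
  have -> : secw j (k - z j) (shift z g) = shift z (secw j k g).
    by apply/funext => v; rewrite /shift /=; case: ifP => //; lia.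
  have secw_tail (t : mon) (v : word) : (t j <= 1)%N && all (fun x => (x j <= 1)%N) v ->
      secw j k g ((z + t)%MM :: v) = 0.
    move=> /andP[t1 v1] /=; rewrite mnmDE ifN ?secw_adm0 ?adm0 //; lia.
  case: a {IH} hw ck => [|t a] hw ck; rewrite ?cat0s ?cat_cons d0E secw_tail ?sub0r //.
rewrite IH //; last by lia.
by rewrite exprS mulN1r mulNr.
Qed.

Lemma d0_secw_neq0 j k g u : adm j 0 u -> d0 (secw j k g) u != 0 ->
  exists a x y b, split_at j k u a x y b.
Proof.
rewrite adm0 => hu /d0_neq0[a [x [y [b [eu]]]]].
move=> /secw_neq0[a' [z [b' [e c _]]]].
have h t : t \in a ++ b -> (t j <= 1)%N.
  rewrite mem_cat => ht; apply: (allP hu); rewrite eu mem_cat !inE.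
  by case/orP: ht => ->; rewrite ?orbT.
have x1 : (x j <= 1)%N by apply: (allP hu); rewrite eu mem_cat !inE eqxx orbT.
have y1 : (y j <= 1)%N by apply: (allP hu); rewrite eu mem_cat !inE eqxx !orbT.
have z2 : (1 < z j)%N by lia.
(* Only the merged letter contains j more than once, which makes the decomposition unique. *)
have cat_eq (p q : word) r s p' : p ++ r :: p' = q ++ s :: b' -> (1 < s j)%N ->
    (forall t, t \in p ++ p' -> (t j <= 1)%N) -> p = q /\ r = s.
  elim: p q => [|t p IH] [|t' q] //= [] // -> ee s2 hh.
  - by exfalso; have := hh s; rewrite ee mem_cat inE eqxx orbT => /(_ isT); lia.
  - by exfalso; have := hh s; rewrite inE eqxx => /(_ isT); lia.
  have [|-> ->//] := IH q ee s2.
  by move=> r0 hr; apply: hh; rewrite inE hr orbT.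
have [ea ez] := cat_eq a a' _ _ _ e z2 h.
exists a, x, y, b; split=> //; move: c; rewrite -ea -ez mnmDE; lia.
Qed.
End SplitDoubled.

(** * The sign between mu_(j,k) and the connecting map *)

Section SignOfMu.
Variable m : nat.
Local Notation mon := 'X_{1..m}.
Local Notation word := (seq mon).
Implicit Types (a b : word) (x y p : mon) (j : 'I_m).

(** The variables of p lie before, at or after j. In [wsign_split] this trades degrees for
    inversions with U_(j). *)
Lemma mdeg_inversions j p :
  mdeg p = (inversions U_(j) p + p j + inversions p U_(j))%N.
Proof.
rewrite mdegE /inversions.
have -> : (\sum_(i < m) \sum_(k < m | (k < i)%N) U_(j)%MM i * p k = \sum_(k < m | (k < j)%N) p k)%N.
  rewrite (bigD1 j) //= [X in (_ + X)%N]big1 ?addn0 => [|i /negPf ij].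
    by apply: eq_bigr => k _; rewrite mnm1E eqxx mul1n.
  by rewrite big1 // => k _; rewrite mnm1E eq_sym ij.
have -> : (\sum_(i < m) \sum_(k < m | (k < i)%N) p i * U_(j)%MM k = \sum_(i < m | (j < i)%N) p i)%N.
  rewrite [RHS]big_mkcond; apply: eq_bigr => i _; case: ifP => ji.
    rewrite (bigD1 j) //= big1 ?addn0 => [|k /andP[_ /negPf kj]].
      by rewrite mnm1E eqxx muln1.
    by rewrite mnm1E eq_sym kj muln0.
  rewrite big1 // => k ki; rewrite mnm1E; case: eqP => [jk|_]; last by rewrite muln0.
  by rewrite jk ki in ji.
rewrite (bigD1 j) //= (bigID (fun k : 'I_m => (k < j)%N)) /= addnCA addnA; congr (_ + _ + _)%N.
  by apply: eq_bigl => k; rewrite -val_eqE /=; lia.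
by apply: eq_bigl => k; rewrite -val_eqE /=; lia.
Qed.

Lemma odd_congr2 (n n' q q' : nat) : (n + q.*2 = n' + q'.*2)%N -> odd n = odd n'.
Proof. by move/(congr1 odd); rewrite !oddD !odd_double !addbF. Qed.

(** On the left is the sign of the split word together with that of the term of mu. On the right,
    the lone [size a] is the sign of [d0_secw_at]; the rest, apart from the sign of the unsplit
    word, depends on j, k, I and the total length only. *)
Lemma wsign_split j a x y b (I : mon) : (forall i, cntw i (a ++ x :: y :: b) = I i) ->
  x j = 1%N -> y j = 1%N ->
  odd (wsign (a ++ x :: y :: b) + inversions (x - U_(j)) (y - U_(j))) =
  odd ((cntw j a).+1 + inversions U_(j) I + (size a + size b) +
       size a + wsign (a ++ (x + y - U_(j))%MM :: b)).
Proof.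
move=> /cntw_sum hI xj yj.
set x' := (x - U_(j))%MM; set y' := (y - U_(j))%MM.
have xE : x = (x' + U_(j))%MM by rewrite /x' mnm_subUK ?xj.
have yE : y = (y' + U_(j))%MM by rewrite /y' mnm_subUK ?yj.
have zE : (x + y - U_(j) = x' + y' + U_(j))%MM.
  by apply/mnmP => i; rewrite xE yE !(mnmDE, mnmBE); lia.
have xj' : x' j = 0%N by rewrite /x' mnmBE mnm1E eqxx xj.
have yj' : y' j = 0%N by rewrite /y' mnmBE mnm1E eqxx yj.
have ejj : inversions U_(j) U_(j) = 0%N.
  by have := mdeg_inversions j U_(j)%MM; rewrite mdeg1 mnm1E eqxx; lia.
rewrite zE xE yE -/x' -/y' -hI big_cat !big_cons /=.
rewrite !wsign_cat !sum_mdeg !sum_winversions !wsign_cons /=.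
have wE z v : winversions z v = inversions z (\big[+%MM/0%MM]_(t <- v) t)%MM.
  by have := sum_winversions [:: z] v; rewrite !big_seq1.
rewrite !wE !big_cons xE yE.
rewrite -[cntw j a]/(\sum_(t <- a) t j)%N -mnm_sumE.
set A := (\big[_/_]_(t <- a) t)%MM; set C := (\big[_/_]_(t <- b) t)%MM.
rewrite !(inversionsDl, inversionsDr, mdegD, mdeg1) ejj.
have := mdeg_inversions j A; have := mdeg_inversions j x'; rewrite xj' addn0.
move=> -> ->; apply: (@odd_congr2 _ _.+1 (size a)
  (inversions x' y' + inversions x' U_(j) + inversions A U_(j))%N).
rewrite -!addnn; ring.
Qed.
End SignOfMu.

Section FreegLift.
Variables (T : choiceType) (M : lmodType int) (f : T -> M).

HB.instance Definition _ :=
  GRing.isZmodMorphism.Build {freeg T / int} M (fglift f) (lift_is_additive f).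

Lemma fglift_dom t : fglift f t = \sum_(w <- dom t) coeff w t *: f w.
Proof. by rewrite -{1}(Freeg_dom t) fglift_Freeg /prelift big_map. Qed.

Lemma fglift_sum (J : Type) (r : seq J) (P : pred J) F :
  fglift f (\sum_(i <- r | P i) F i) = \sum_(i <- r | P i) fglift f (F i).
Proof. exact: (raddf_sum (fglift f)). Qed.

Lemma fgliftZ (c : int) t : fglift f (c *: t) = c *: fglift f t.
Proof. by rewrite -[c]intz !scaler_int; exact: (raddfMz (fglift f)). Qed.
End FreegLift.

(** * The two face rings as first and last stage *)

Section FaceCochains.
Variables (m : nat) (K : scomplex m).
Implicit Types (s : nat) (I : 'X_{1..m}) (g : seq 'X_{1..m} -> int).

Definition face_supp : pred 'X_{1..m} := fun d => msupport d \in sc_faces K.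

Lemma face_supp_sub (x y : 'X_{1..m}) : (forall i, 0 < x i -> 0 < y i)%N ->
  face_supp y -> face_supp x.
Proof. by move=> xy yK; apply: sc_down yK _; apply/subsetP => i; rewrite !inE; apply: xy. Qed.

Lemma wcoch_ext s I g : wcochain_pred (ext_basis K) s I g <-> wcoch face_supp 0%MM s I g.
Proof.
split=> hg w gw; have [gs gI g0] := hg w gw.
  move=> /allP gB; split=> // [|i]; first by apply/allP => z /gB/andP[].
  by rewrite mnm0E adm0; apply/allP => z /gB/andP[_ /forallP].
move=> /allP gK ga; split=> //; apply/allP => t tw /=; rewrite /ext_mem [_ \in _]gK //=.
by apply/forallP => i; have := ga i; rewrite mnm0E adm0 => /allP; apply.
Qed.

(** The polynomial complex is the stage c = I, whose bounds are vacuous in multi-degree I. *)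
Lemma wcoch_poly s I g : wcochain_pred (poly_basis K) s I g <-> wcoch face_supp I s I g.
Proof.
split=> hg w gw; have [gs gI g0] := hg w gw; last by split.
by move=> gB; split=> // i; apply: adm_total; rewrite gI.
Qed.

Lemma wcoch_ext_poly s I g :
  wcochain_pred (ext_basis K) s I g -> wcochain_pred (poly_basis K) s I g.
Proof.
move=> /wcoch_ext hg; apply/wcoch_poly; apply: wcoch_mono hg => i.
by rewrite mnm0E.
Qed.

Lemma wcocycle_dw_secw s I j k g : (0 < k < I j)%N ->
  wcocycle (ext_basis K) s (I - U_(j))%MM g -> wcocycle (ext_basis K) s.+1 I (dw (secw j k g)).
Proof.
move=> kI [/wcoch_ext hg dg]; split; last exact: dw_dw.
by apply/wcoch_ext; apply: (wcoch_dw_secw face_supp_sub kI hg dg).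
Qed.
End FaceCochains.

(** * The operations mu_(j,k) on bar cochains *)

Section MuWord.
Variables (m : nat) (K : scomplex m).
Local Notation mon := 'X_{1..m}.
Local Notation wK := (exterior_face K).
Implicit Types (S T X Y : {set 'I_m}) (A B w : seq {set 'I_m}) (j : 'I_m) (k s : nat)
  (u v : seq mon) (a b : seq wK).

Definition scount j w := count (fun S : {set 'I_m} => j \in S) w.

Lemma scount_mindic j w : cntw j (map (@mindic m) w) = scount j w.
Proof.
rewrite /cntw big_map /scount; elim: w => [|S w IH]; first by rewrite big_nil.
by rewrite big_cons IH /= mnmE.
Qed.

Lemma kth_split j k w : (k < scount j w)%N ->
  exists A S B, [/\ w = A ++ S :: B, j \in S & scount j A = k].
Proof.
elim: w k => [|S w IH] k //=; case: (boolP (j \in S)) => jS /=; last first.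
  rewrite add0n => /IH[A [S' [B [-> jS' <-]]]].
  by exists (S :: A), S', B; rewrite /= (negPf jS).
case: k => [|k]; first by exists [::], S, w.
rewrite add1n ltnS => /IH[A [S' [B [-> jS' <-]]]].
by exists (S :: A), S', B; rewrite /= jS.
Qed.

(** Evaluates the q of [mu_word]: letters being numbered from 1, the letter after A has number
    [(size A).+1]. *)
Lemma find_kth j A S B : j \in S ->
  find (fun p => scount j (take p (A ++ S :: B)) == (scount j A).+1)
    (iota 0 (size (A ++ S :: B)).+1) = (size A).+1.
Proof.
move=> jS; set P := fun p => _; set n := (size _).+1.
have sA : (size A).+1 = size (rcons A S) by rewrite size_rcons.
have PA : P (size A).+1.
  by rewrite /P -cat_rcons sA take_size_cat // /scount -cats1 count_cat /= jS addn0 addn1.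
have An : ((size A).+1 < n)%N by rewrite /n size_cat /=; lia.
have hasP : has P (iota 0 n).
  by apply/hasP; exists (size A).+1; rewrite // mem_iota.
apply/eqP; rewrite eqn_leq; apply/andP; split; rewrite leqNgt; apply/negP => fA.
  by have := before_find 0%N fA; rewrite nth_iota // add0n PA.
have := nth_find 0%N hasP; rewrite nth_iota ?add0n; last by lia.
move: fA; set p := find _ _ => fA; rewrite /P takel_cat // => /eqP h.
have : (scount j (take p A) <= scount j A)%N.
  by rewrite -{2}(cat_take_drop p A) /scount count_cat leq_addr.
by rewrite h ltnn.
Qed.

Lemma mu_word_cat j A S B : j \in S ->
  mu_word j (scount j A).+1 (A ++ S :: B) = \sum_(T in powerset (S :\ j))
    << (-1) ^+ eps T ((S :\ j) :\: T) *g A ++ [:: j |: T; j |: ((S :\ j) :\: T)] ++ B >>.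
Proof.
move=> jS; rewrite /mu_word find_kth //=.
rewrite nth_cat ltnn subnn /= take_size_cat //.
by rewrite -cat_rcons drop_size_cat ?size_rcons.
Qed.

(** The cochain dual to the word w; [cochain_of_T] is its linear extension in w, see
    [cochain_of_TE]. *)
Definition word_coef w a : int :=
  if size w == size a then \prod_(p <- zip w a) face_coef p.1 p.2 else 0.

Lemma word_coef_cons S w x a : word_coef (S :: w) (x :: a) = face_coef S x * word_coef w a.
Proof. by rewrite /word_coef /= eqSS; case: ifP; rewrite ?mulr0 // big_cons. Qed.

Lemma face_coefD S (x y : wK) : S \in sc_faces K ->
  face_coef S (x + y) = face_coef S x + face_coef S y.
Proof.
move=> SK; elim/rq_ind: x => p; elim/rq_ind: y => q.
by rewrite -rq_piD !face_coef_pi // ffunE.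
Qed.

Lemma word_coef_madd w : all (mem (sc_faces K)) w -> madd (word_coef w).
Proof.
move=> wF a b x y; elim: a w wF => [|z a IH] [|S w] /=; try by rewrite /word_coef /= addr0.
  by move=> /andP[SK _]; rewrite !word_coef_cons face_coefD // mulrDl.
by move=> /andP[_ /IH e]; rewrite !word_coef_cons e mulrDr.
Qed.

Lemma word_coef_mon w u : all (mem (sc_faces K)) w -> all (ext_mem K) u ->
  word_coef w (map (mg_mon wK) u) = (w == map (@msupport m) u)%:R.
Proof.
elim: w u => [|S w IH] [|x u] //; try by rewrite /word_coef.
  by rewrite /word_coef /= big_nil.
rewrite [map _ _]/= word_coef_cons /= => /andP[SK wK'] /andP[/andP[xK sx] uK].
rewrite IH // mg_mon_face face_coef_pi // mg_mon_exterior sx eqseq_cons.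
rewrite -[extalg_mon _ _]/(extalg_coef _ _) extalg_monE.
by case: (S == _); rewrite ?mul1r ?mul0r.
Qed.

Lemma cochain_of_TE t a : cochain_of_T (K := K) t a =
  fglift (fun w => word_coef w a : int^o) t.
Proof.
rewrite fglift_dom /cochain_of_T big_mkcond; apply: eq_bigr => w _.
by rewrite /word_coef; case: ifP; rewrite ?scaler0.
Qed.

Definition mu_term j k w a : int := fglift (fun w' => word_coef w' a : int^o) (mu_word j k w).

Lemma cochain_of_mu s j k (phi : seq wK -> int) a :
  cochain_of_T (K := K) (mu_T j k (T_of_cochain s phi)) a =
  \sum_(w : s.-tuple {set 'I_m} | all (simplex K) w)
    phi (map (@mg_sqf m wK) w) * mu_term j k w a.
Proof.
rewrite cochain_of_TE /T_of_cochain /mu_T !fglift_sum; apply: eq_bigr => w _.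
by rewrite liftU fgliftZ.
Qed.

Lemma mu_term_cat j A S B a : j \in S ->
  mu_term j (scount j A).+1 (A ++ S :: B) a = \sum_(T in powerset (S :\ j))
    (-1) ^+ eps T ((S :\ j) :\: T) *
      word_coef (A ++ [:: j |: T; j |: ((S :\ j) :\: T)] ++ B) a.
Proof.
move=> jS; rewrite /mu_term mu_word_cat // fglift_sum; apply: eq_bigr => T _.
by rewrite liftU.
Qed.

Lemma all_simplex_split j A S B T : j \in S -> all (simplex K) (A ++ S :: B) ->
  T \subset S :\ j -> all (mem (sc_faces K)) (A ++ [:: j |: T; j |: ((S :\ j) :\: T)] ++ B).
Proof.
move=> jS; rewrite !all_cat /= => /and3P[hA /andP[SK _] hB] TS.
have h w : all (simplex K) w -> all (mem (sc_faces K)) w.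
  by move=> /allP hw; apply/allP => X /hw/andP[].
rewrite (h _ hA) (h _ hB) andbT /=; apply/and3P.
by split=> //; apply: (sc_down SK); rewrite subUset sub1set jS /=;
  [apply: subset_trans TS _|apply: subset_trans (subsetDl _ _) _]; apply: subsetDl.
Qed.

Variables (s k : nat) (j : 'I_m) (I : mon) (phi : seq wK -> int).
Hypotheses (kI : (0 < k < I j)%N) (cphi : is_cochain s (I - U_(j))%MM phi).
Local Notation extB := (ext_basis K).

(** In multi-degree I - e_j there are I_j - 1 >= k occurrences of j, so the search in [mu_word]
    succeeds on every word that counts. *)
Lemma phi_split w : phi (map (@mg_sqf m wK) w) != 0 ->
  exists A S B, [/\ w = A ++ S :: B, j \in S & (scount j A).+1 = k].
Proof.
have -> : map (@mg_sqf m wK) w = map (mg_mon wK) (map (@mindic m) w).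
  by rewrite -map_comp; apply: eq_map => S /=; rewrite mg_mon_mindic.
move=> pw; have [|_ /(_ j) + _ _] := wcochain_wval extB cphi (w := map (@mindic m) w).
  by rewrite /wval mulf_eq0 signr_eq0.
rewrite scount_mindic mnmBE mnm1E eqxx => sw.
have [|A [S [B [-> jS sA]]]] := @kth_split j k.-1 w; first by lia.
by exists A, S, B; rewrite sA; split=> //; lia.
Qed.

Lemma phi_simplex w : phi (map (@mg_sqf m wK) w) != 0 -> all (simplex K) w.
Proof.
have -> : map (@mg_sqf m wK) w = map (mg_mon wK) (map (@mindic m) w).
  by rewrite -map_comp; apply: eq_map => S /=; rewrite mg_mon_mindic.
move=> pw; have [|_ _ w0 wB] := wcochain_wval extB cphi (w := map (@mindic m) w).
  by rewrite /wval mulf_eq0 signr_eq0.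
apply/allP => S Sw; have := allP wB _ (map_f _ Sw).
move=> /andP[]; rewrite msupport_mindic /simplex => -> _ /=.
apply: contraNneq w0 => S0; apply/mapP; exists S => //.
by apply/mnmP => i; rewrite S0 mnm0E mnmE inE.
Qed.

Definition mu_cochain a : int := cochain_of_T (K := K) (mu_T j k (T_of_cochain s phi)) a.

Lemma mu_cochain_size a : size a != s.+1 -> mu_cochain a = 0.
Proof.
move=> sa; rewrite /mu_cochain cochain_of_mu big1 // => w _.
have [->|/phi_split[A [S [B [ew jS kE]]]]] := eqVneq (phi (map (@mg_sqf m wK) w)) 0.
  by rewrite mul0r.
rewrite ew -kE mu_term_cat // big1 ?mulr0 // => T _.
rewrite /word_coef; case: eqP => [e|_]; last by rewrite mulr0.
have := size_tuple w; rewrite ew; move: sa e; rewrite !size_cat /=; lia.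
Qed.

Lemma mu_cochain_madd : madd mu_cochain.
Proof.
move=> a b x y; rewrite /mu_cochain !cochain_of_mu -big_split; apply: eq_bigr => w wK'.
have [->|/phi_split[A [S [B [ew jS kE]]]]] /= := eqVneq (phi (map (@mg_sqf m wK) w)) 0.
  by rewrite !mul0r addr0.
rewrite -mulrDr; congr (_ * _); rewrite ew -kE !mu_term_cat // -big_split.
apply: eq_bigr => T; rewrite inE => TS /=; rewrite -mulrDr; congr (_ * _).
by apply: word_coef_madd; apply: all_simplex_split TS; rewrite // -ew.
Qed.

(** The additional disjointness says that x and y share no vertex but j, as in every term of mu;
    without it the letter x + y - U_(j) is not square-free. *)
Definition mu_split (u a : seq mon) (x y : mon) (b : seq mon) :=
  split_at j k u a x y b /\ [disjoint msupport (x - U_(j))%MM & msupport (y - U_(j))%MM].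

Lemma mu_cochain_none u : all (ext_mem K) u ->
  (forall (a : seq mon) x y (b : seq mon), ~ mu_split u a x y b) ->
  mu_cochain (map (mg_mon wK) u) = 0.
Proof.
move=> uK hu; rewrite /mu_cochain cochain_of_mu big1 // => w wK'.
have [->|/phi_split[A [S [B [ew jS kE]]]]] := eqVneq (phi (map (@mg_sqf m wK) w)) 0.
  by rewrite mul0r.
rewrite ew -kE mu_term_cat // big1 ?mulr0 // => T; rewrite inE => TS.
rewrite word_coef_mon //; last by apply: all_simplex_split TS; rewrite // -ew.
case: eqP => [e|_]; last by rewrite mulr0.
exfalso; have uE : u = map (@mindic m) (map (@msupport m) u).
  rewrite -map_comp -[LHS]map_id; apply/eq_in_map => x /(allP uK)/andP[_ sx] /=.
  by rewrite mindic_msupport.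
rewrite -e !map_cat /= in uE.
apply: (hu _ _ _ _ (conj (And4 uE _ _ _) _)).
- by rewrite scount_mindic.
- by rewrite mnmE !inE eqxx.
- by rewrite mnmE !inE eqxx.
have supp X : j \notin X -> msupport (mindic (j |: X) - U_(j))%MM = X.
  move=> jX; apply/setP => i; rewrite !inE mnmBE mnm1E mnmE !inE (eq_sym j).
  by case: (eqVneq i j) => [->|_] /=; [rewrite (negPf jX)|case: (i \in X)].
rewrite !supp ?inE ?eqxx ?andbF //.
  by rewrite -setI_eq0 setIDA setIC setDIl setDv setI0.
by apply/negP => /(subsetP TS); rewrite !inE eqxx.
Qed.

Lemma mu_cochain_at u (a : seq mon) (x y : mon) (b : seq mon) :
  size u = s.+1 -> all (ext_mem K) u -> mu_split u a x y b ->
  mu_cochain (map (mg_mon wK) u) = (-1) ^+ inversions (x - U_(j))%MM (y - U_(j))%MM *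
    phi (map (mg_mon wK) (a ++ (x + y - U_(j))%MM :: b)).
Proof.
move=> su uK [[eu ka xj yj] dis].
have uS : all (@squarefree m) u by apply/allP => t /(allP uK)/andP[].
rewrite eu all_cat /= in uS; have /and4P[aS xS yS bS] := uS.
have sub_sqf (t : mon) : squarefree t -> squarefree (t - U_(j))%MM.
  by move=> /forallP h; apply/forallP => i; rewrite mnmBE; apply: leq_trans (h i); lia.
have subj (t : mon) : squarefree t -> (t - U_(j))%MM j = 0%N.
  by move=> /forallP/(_ j); rewrite mnmBE mnm1E eqxx; lia.
have suppB (t : mon) : squarefree t -> msupport (t - U_(j))%MM = msupport t :\ j.
  move=> /forallP h; apply/setP => i; rewrite !inE mnmBE mnm1E eq_sym.
  by have := h i; case: eqP => /= _; lia.
set z := (x + y - U_(j))%MM.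
have zE : z = (x - U_(j) + (y - U_(j)) + U_(j))%MM.
  by apply/mnmP => i; rewrite /z !(mnmDE, mnmBE, mnm1E); case: eqP => [<-|_] /=; lia.
have zS : squarefree z.
  rewrite zE !squarefreeD !sub_sqf // dis /=; apply/andP; split.
    by apply/forallP => i; rewrite mnm1E; case: eqP.
  apply/pred0P => i /=; rewrite !inE !mnmDE mnm1E.
  by case: eqP => [<-|_]; rewrite ?andbF // !subj.
have vE : map (mg_mon wK) (a ++ z :: b) =
    map (@mg_sqf m wK) (map (@msupport m) (a ++ z :: b)).
  rewrite -map_comp; apply/eq_in_map => t; rewrite mem_cat inE => tv /=.
  rewrite -mg_mon_mindic mindic_msupport //.
  by case/or3P: tv => [/(allP aS)|/eqP->|/(allP bS)].
set A := map (@msupport m) a; set B := map (@msupport m) b.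
set X := msupport x; set Y := msupport y.
have supz : msupport z = X :|: Y.
  apply/setP => i; rewrite !inE /z mnmBE mnmDE mnm1E.
  by case: eqP => [<-|_] /=; lia.
have sA : scount j A = cntw j a.
  rewrite -scount_mindic -map_comp; congr cntw.
  rewrite -[RHS]map_id; apply/eq_in_map => t /(allP aS) st /=.
  by rewrite mindic_msupport.
have jX : j \in X by rewrite inE.
have jY : j \in Y by rewrite inE.
have sv : size (A ++ (X :|: Y) :: B) == s.
  by rewrite size_cat /= !size_map; move: su; rewrite eu size_cat /=; lia.
rewrite vE [map _ (a ++ _)]map_cat /= supz -/A -/B.
set v := A ++ _; pose v0 : s.-tuple {set 'I_m} := Tuple sv.
(* The word u determines where it comes from: join the letters that hold the k-th and (k+1)-st
   occurrences of j. *)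
have other (w : s.-tuple {set 'I_m}) : all (simplex K) w -> w != v0 ->
    phi (map (@mg_sqf m wK) w) * mu_term j k w (map (mg_mon wK) u) = 0.
  move=> wK' wv.
  have [->|/phi_split[A' [S [B' [ew jS kE]]]]] := eqVneq (phi (map (@mg_sqf m wK) w)) 0.
    by rewrite mul0r.
  rewrite ew -kE mu_term_cat // big1 ?mulr0 // => T; rewrite inE => TS.
  rewrite word_coef_mon //; last by apply: all_simplex_split TS; rewrite // -ew.
  case: eqP => [e|_]; last by rewrite mulr0.
  exfalso; move/eqP: wv; apply; apply: val_inj; rewrite /= ew /v.
  move: e; rewrite eu map_cat /= -/A -/B -/X -/Y.
  have cat_inj (p q p' q' : seq {set 'I_m}) (r r' : {set 'I_m}) :
      scount j p = scount j q -> j \in r -> j \in r' ->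
      p ++ r :: p' = q ++ r' :: q' -> [/\ p = q, r = r' & p' = q'].
    elim: p q => [|t p IH] [|t' q] //=.
    - by move=> _ _ _ [-> ->].
    - by move=> h jr _ [e _]; move: h; rewrite -e /scount /= jr.
    - by move=> h _ jr' [e _]; move: h; rewrite e /scount /= jr'.
    by move=> h jr jr' [et e]; move: h; rewrite et => /addnI/IH/(_ jr jr' e)[-> -> ->].
  move=> /cat_inj[]; rewrite ?in_setU1 ?eqxx //; first by rewrite sA; lia.
  move=> -> <- [<- ->]; congr (_ ++ _ :: _).
  apply/setP => i; rewrite !inE; have := subsetP TS i; rewrite !inE.
  by case: eqP => [->|_] /=; [rewrite jS|case: (i \in T) => //= /(_ isT) ->].
rewrite /mu_cochain cochain_of_mu.
have [vK|vK] := boolP (all (simplex K) v); last first.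
  rewrite big1 => [|w wK']; last first.
    by apply: other => //; apply: contraNneq vK => e; move: wK'; rewrite e.
  have [->|/phi_simplex pv] := eqVneq (phi (map (@mg_sqf m wK) v)) 0; first by rewrite mulr0.
  by rewrite pv in vK.
rewrite (bigD1 v0) //= big1 ?addr0 => [|w /andP[]]; last exact: other.
rewrite mulrC; congr (_ * _); rewrite /v -ka -sA mu_term_cat ?in_setU ?jX //.
have XY : ((X :|: Y) :\ j) :\: (X :\ j) = Y :\ j.
  move: dis; rewrite !suppB // -/X -/Y => /pred0P dis; apply/setP => i.
  have := dis i; rewrite /= !inE.
  by case: (i == j); case: (0 < x i)%N; case: (0 < y i)%N.
have XS : X :\ j \in powerset ((X :|: Y) :\ j) by rewrite inE setSD // subsetUl.
have jXY : j \in X :|: Y by rewrite inE jX.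
have vS T : T \in powerset ((X :|: Y) :\ j) ->
    all (mem (sc_faces K)) (A ++ [:: j |: T; j |: (((X :|: Y) :\ j) :\: T)] ++ B).
  by rewrite inE; apply: all_simplex_split jXY vK.
rewrite (bigD1 (X :\ j)) //= big1 ?addr0 => [|T /andP[TS TX]].
  rewrite word_coef_mon //; last exact: vS.
  rewrite XY !setD1K // eu map_cat /= eqxx mulr1.
  by rewrite -!suppB // eps_inversions // sub_sqf.
rewrite word_coef_mon //; last exact: vS.
rewrite eu map_cat /= eqseq_cat // eqxx /= eqseq_cons; case: eqP => [e|_]; last by rewrite mulr0.
exfalso; move/eqP: TX; apply; rewrite -/X in e; rewrite -e.
apply/setP => i; rewrite !inE; move: TS; rewrite inE => /subsetP/(_ i); rewrite !inE.
by case: eqP => [->|_] //= h; case: (boolP (j \in T)) => // /h.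
Qed.

(** Both sides live on the words of [mu_split]. There each is a single term, up to sign the value of
    [wval phi] at the word with x and y joined, and [wsign_split] compares the signs. *)
Lemma wval_mu_cochain : dw (wval phi) = 0 -> wval mu_cochain =
  dw (secw j k (wval phi)) *~ (-1) ^+ (k + inversions U_(j)%MM I + s.-1).
Proof.
move=> dphi; have hphi := wcochain_wval extB cphi.
set g := wval phi in hphi dphi *; set N := (_ + _ + _)%N.
have g_sqf v : g v != 0 -> all (@squarefree m) v.
  by move=> /hphi[_ _ _ /allP h]; apply/allP => t /h/andP[].
(* This uses the cocycle condition: it makes the right-hand side exterior, so that only square-free
   words u have to be compared. *)
have dg_pred := proj1 (wcocycle_dw_secw kI (conj hphi dphi)).
apply/funext => u; rewrite fct_mulrz mulrzz.
have [/andP[/eqP su uK]|nu] := boolP ((size u == s.+1) && all (ext_mem K) u); last first.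
  have -> : dw (secw j k g) u = 0.
    by apply/eqP; apply: contraNT nu => /dg_pred[[->] _ _ ->]; rewrite eqxx.
  rewrite mul0r /wval; move: nu; rewrite negb_and => /orP[su|].
    by rewrite mu_cochain_size ?mulr0 // size_map.
  move=> /allPn[x /splitPr[a b] /(@ext_out _ K) x0].
  by rewrite map_cat /= x0 madd0 ?mulr0 //; apply: mu_cochain_madd.
have usq i : adm i 0 u.
  by rewrite adm0; apply/allP => t /(allP uK)/andP[_ /forallP].
have zE (x y : mon) : (0 < x j)%N -> (0 < y j)%N ->
    (x + y - U_(j) = x - U_(j) + (y - U_(j)) + U_(j))%MM.
  by move=> xj yj; apply/mnmP => i; rewrite !(mnmDE, mnmBE, mnm1E); case: eqP => [<-|_] /=; lia.
have [[a [x [y [b D]]]]|nD] :=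
  pselect (exists (a : seq mon) x y (b : seq mon), mu_split u a x y b); last first.
  rewrite [LHS]/wval mu_cochain_none ?mulr0 //; last first.
    by move=> a x y b D; apply: nD; exists a, x, y, b.
  suff -> : dw (secw j k g) u = 0 by rewrite mul0r.
  rewrite /dw /nzw; case: ifP => // _.
  apply/eqP/negPn/negP => du; have [a [x [y [b D]]]] := d0_secw_neq0 (usq j) du.
  move: du; rewrite (d0_secw_at _ (usq j) D) mulf_eq0 signr_eq0 /= => /g_sqf.
  have [_ _ xj yj] := D.
  rewrite all_cat /= zE // !squarefreeD => /and3P[_ /and3P[/and3P[_ _ dis] _ _] _].
  by apply: nD; exists a, x, y, b.
have [S _] := D; have [eu ka xj yj] := S.
rewrite [LHS]/wval (mu_cochain_at su uK D).
set v := a ++ _.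
have gE : phi (map (mg_mon wK) v) = (-1) ^+ wsign v * g v.
  by rewrite /g /wval /= mul1n signz_mulK.
have -> : dw (secw j k g) u = (-1) ^+ size a * g v.
  rewrite /dw /nzw; case: ifP => [u0|_]; last exact: d0_secw_at (usq j) S.
  suff -> : g v = 0 by rewrite mulr0.
  apply/eqP; apply: contraTT u0 => /hphi[_ _ + _].
  rewrite eu /v !mem_cat !inE !negb_or => /and3P[-> _ ->] /=.
  by apply/and3P; split=> //; apply/eqP => /mnmP/(_ j); rewrite mnm0E; lia.
rewrite gE /= mul1n.
have [->|gv] := eqVneq (g v) 0; first by rewrite !(mulr0, mul0r).
have [gs gI _ _] := hphi _ gv.
have uI i : cntw i u = I i.
  have := gI i; rewrite eu /v !cntw_cat !cntw_cons !mnmBE mnmDE mnm1E.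
  by case: eqP => [<-|_] /=; lia.
have xj1 : x j = 1%N by have := usq j; rewrite adm0 eu all_cat /= => /and4P[_ + _ _]; lia.
have yj1 : y j = 1%N by have := usq j; rewrite adm0 eu all_cat /= => /and4P[_ _ + _]; lia.
have sE : s.-1 = (size a + size b)%N by move: su; rewrite eu size_cat /=; lia.
have par : odd (wsign u + inversions (x - U_(j))%MM (y - U_(j))%MM + wsign v) =
    odd (size a + N).
  have hI : forall i, cntw i (a ++ [:: x, y & b]) = I i by rewrite -eu.
  rewrite oddD {1}eu (wsign_split hI xj1 yj1) ka /N sE -/v -oddD.
  by apply: (@odd_congr2 _ _ 0 (wsign v)); rewrite -!addnn; ring.
move: (g v) => c; rewrite !mulrA [RHS]mulrAC -!exprD; congr (_ * _).
exact: sign_eq.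
Qed.


End MuWord.

Lemma Ext_muE m (K : scomplex m) s (I : 'X_{1..m}) j k
    (x : Ext (exterior_face K) s (I - U_(j))%MM) :
  (0 < k < I j)%N -> Ext_mu k x =
    wclass (ext_basis K) s.+1 I (dw (secw j k (Ext_word x)))
      *~ (-1) ^+ (k + inversions U_(j)%MM I + s.-1).
Proof.
move=> kI; have /asboolP[cx _] := Ext_repr_cocycle x; have [hx dx] := Ext_wordP (ext_basis K) x.
have zx := wcocycle_dw_secw kI (conj hx dx).
rewrite -wclass_sign //; congr Ext_class.
have zs := wcocycleMz ((-1) ^+ (k + inversions U_(j)%MM I + s.-1)) zx.
have cw := is_cochain_wcochain (proj1 zs).
apply: (@wval_inj _ _ (ext_basis K) s.+1).
- exact: mu_cochain_madd kI cx.
- exact: coch_add cw.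
- exact: mu_cochain_size kI cx.
- exact: coch_size cw.
- by rewrite (wval_wcochain (proj1 zs)); apply: wval_mu_cochain.
Qed.

(** * The comparison map *)

Section Comparison.
Variable m : nat.
Implicit Types (K L : scomplex m) (s t k : nat) (I J : 'X_{1..m}) (j : 'I_m)
  (g h : seq 'X_{1..m} -> int).

Definition Ext_comp K s I (x : Ext (exterior_face K) s I) : Ext (polynomial_face K) s I :=
  wclass (poly_basis K) s I (Ext_word x).

Lemma wcocycle_ext_poly K s I g :
  wcocycle (ext_basis K) s I g -> wcocycle (poly_basis K) s I g.
Proof. by move=> [/wcoch_ext_poly]. Qed.

Lemma Ext_comp_wclass K s I g : wcocycle (ext_basis K) s I g ->
  Ext_comp (wclass (ext_basis K) s I g) = wclass (poly_basis K) s I g.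
Proof.
move=> zg; have [h hh e] := Ext_word_wclass zg.
by rewrite /Ext_comp e wclassD_dw //; [apply: wcocycle_ext_poly|apply: wcoch_ext_poly].
Qed.

Fact Ext_comp_zmod K s I : zmod_morphism (@Ext_comp K s I).
Proof.
move=> x y; have zx := Ext_wordP (ext_basis K) x; have zy := Ext_wordP (ext_basis K) y.
rewrite -{1}(Ext_wordK (ext_basis K) x) -{1}(Ext_wordK (ext_basis K) y) -wclassB //.
rewrite Ext_comp_wclass.
  by rewrite wclassB //; apply: wcocycle_ext_poly.
by rewrite addrC; move: zy => /wcocycleN [hy dy]; move: zx => [hx dx];
  split; [apply: wpredD|rewrite dwD dx dy addr0].
Qed.
HB.instance Definition _ K s I :=
  GRing.isZmodMorphism.Build (Ext (exterior_face K) s I) (Ext (polynomial_face K) s I)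
    (@Ext_comp K s I) (@Ext_comp_zmod K s I).

Lemma Ext_comp_surj K s I (z : Ext (polynomial_face K) s I) : exists y, Ext_comp y = z.
Proof.
have [/wcoch_poly hg dg] := Ext_wordP (poly_basis K) z.
have [g [h [/wcoch_ext cg zg /wcoch_poly ch e]]] := cocycle_descent (@face_supp_sub m K) hg dg.
have zg' : wcocycle (ext_basis K) s I g by [].
exists (wclass (ext_basis K) s I g); rewrite Ext_comp_wclass //.
by rewrite -(Ext_wordK (poly_basis K) z) e wclassD_dw //; apply: wcocycle_ext_poly.
Qed.

Lemma face_proj_mon (R : mgalg m) K L (KL : sc_faces K \subset sc_faces L) d :
  face_proj R KL (mg_mon (face_alg R L) d) = mg_mon (face_alg R K) d.
Proof. by rewrite !mg_mon_face; exact: rq_lift_pi. Qed.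

(** The projection sends monomials to monomials, so the pull-back leaves the function on words
    unchanged. *)
Lemma Ext_mapE (R : mgalg m) K L (KL : sc_faces K \subset sc_faces L)
    (B : monomial_basis (face_alg R L)) s I (x : Ext (face_alg R K) s I) :
  Ext_map (face_proj R KL) x = wclass B s I (Ext_word x).
Proof.
have cx := cocycle_face_proj KL (Ext_repr_cocycle x).
rewrite /Ext_map (Ext_class_wval B cx); congr wclass.
apply/funext => w; rewrite /Ext_word /wval; congr (_ * Ext_repr x _).
by rewrite -map_comp; apply: eq_map => d /=; apply: face_proj_mon.
Qed.

Lemma ext_pred_sub K L (KL : sc_faces K \subset sc_faces L) s I g :
  wcochain_pred (ext_basis K) s I g -> wcochain_pred (ext_basis L) s I g.
Proof.
move=> hg w /hg[gs gI g0 /allP gB]; split=> //; apply/allP => t /gB /andP[tK st].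
by rewrite /= /ext_mem st (subsetP KL).
Qed.

Lemma poly_pred_sub K L (KL : sc_faces K \subset sc_faces L) s I g :
  wcochain_pred (poly_basis K) s I g -> wcochain_pred (poly_basis L) s I g.
Proof.
move=> hg w /hg[gs gI g0 /allP gB]; split=> //; apply/allP => t /gB /= tK.
by rewrite (subsetP KL).
Qed.

Lemma Ext_comp_natural K L (KL : sc_faces K \subset sc_faces L) s I
    (y : Ext (exterior_face K) s I) :
  Ext_comp (Ext_map (face_proj (exterior_alg m) KL) y) =
  Ext_map (face_proj (polynomial_alg m) KL) (Ext_comp y).
Proof.
have [hy dy] := Ext_wordP (ext_basis K) y.
rewrite (Ext_mapE KL (ext_basis L)) (Ext_mapE KL (poly_basis L)).
have zL : wcocycle (ext_basis L) s I (Ext_word y) by split=> //; apply: ext_pred_sub hy.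
rewrite Ext_comp_wclass //.
have [h hh ->] := Ext_word_wclass (wcocycle_ext_poly (conj hy dy)).
by rewrite wclassD_dw //; [apply: wcocycle_ext_poly|apply: poly_pred_sub hh].
Qed.

(** As |I||I'| is the sum over j <= k plus the inversions, the two exponents differ by twice
    [inversions I I']. *)
Lemma sign_exponent s' I I' :
  let n' : int := (mdeg I')%:Z - s'%:Z in
  let e : int := (\sum_(j < m) \sum_(k < m | (j <= k)%N) I j * I' k)%N%:Z
    - n' * (\sum_(j < m) I j)%N%:Z in
  (-1) ^ e = (-1) ^+ (mdeg I * s' + inversions I I') :> int.
Proof.
set p := (\sum_(j < m) _)%N => /=.
have mE : (mdeg I * mdeg I' = p + inversions I I')%N.
  rewrite /p /inversions -big_split !mdegE big_distrl; apply: eq_bigr => j _ /=.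
  rewrite big_distrr (bigID (fun k : 'I_m => (j <= k)%N)) /=; congr (_ + _)%N.
  by apply: eq_bigl => k; rewrite ltnNge.
rewrite -mdegE -[p]/p.
have -> : p%:Z - ((mdeg I')%:Z - s'%:Z) * (mdeg I)%:Z =
    (mdeg I * s' + inversions I I')%N%:Z - 2 * (inversions I I')%:Z.
  by move: mE; lia.
rewrite exprzDr ?unitrN1 // -mulrN -exprz_exp.
by rewrite (_ : (-1) ^ 2 = 1) // exp1rz mulr1.
Qed.

Lemma Ext_comp_mul K s s' I I' (y : Ext (exterior_face K) s I)
    (y' : Ext (exterior_face K) s' I') :
  Ext_comp (Ext_mul y y') =
  Ext_mul (Ext_comp y) (Ext_comp y') *~ (-1) ^+ (mdeg I * s' + inversions I I').
Proof.
have zy := Ext_wordP (ext_basis K) y; have zy' := Ext_wordP (ext_basis K) y'.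
rewrite (Ext_mulE (ext_basis K)) (raddfMz (@Ext_comp K _ _)) /= mul1n.
rewrite Ext_comp_wclass; last exact: wcocycle_wcup.
rewrite /Ext_comp Ext_mul_wclass; try exact: wcocycle_ext_poly.
by rewrite mul0n mulr1z.
Qed.

Lemma wcoch_any_poly K c s I g : wcoch (face_supp K) c s I g ->
  wcochain_pred (poly_basis K) s I g.
Proof. by move=> hg w /hg[]. Qed.

Lemma wclass_dw_secw K s I j k g h : (0 < k < I j)%N ->
  wcocycle (ext_basis K) s (I - U_(j))%MM g -> wcochain_pred (ext_basis K) s (I - U_(j))%MM h ->
  wclass (ext_basis K) s.+1 I (dw (secw j k (g + dw h))) =
  wclass (ext_basis K) s.+1 I (dw (secw j k g)).
Proof.
move=> kI zg /wcoch_ext hh.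
have [h' /wcoch_ext ch' e] := dw_secw_dw (@face_supp_sub m K) kI hh.
by rewrite secwD dwD e wclassD_dw //; apply: wcocycle_dw_secw.
Qed.

(** In the polynomial complex [secw j k] of an exterior cochain is itself a cochain, so the class
    becomes a coboundary. *)
Lemma Ext_comp_mu K s I j k (x : Ext (exterior_face K) s (I - U_(j))%MM) :
  (0 < k < I j)%N -> Ext_comp (Ext_mu k x) = 0.
Proof.
move=> kI; have zx := Ext_wordP (ext_basis K) x; have [hx dx] := zx.
have zD := wcocycle_dw_secw kI zx.
rewrite Ext_muE // (raddfMz (@Ext_comp K _ _)) /= Ext_comp_wclass //.
have -> : wclass (poly_basis K) s.+1 I (dw (secw j k (Ext_word x))) = 0; last exact: mul0rz.
apply/(wclass_eq0 (wcocycle_ext_poly zD)).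
exists (secw j k (Ext_word x)) => //; apply: wcoch_any_poly.
exact: proj1 (wcoch_secw0 (@face_supp_sub m K) kI (proj1 (wcoch_ext _ _ _ _) hx)).
Qed.

Lemma wclass_sum K s I (T : eqType) (r : seq T) (F : T -> seq 'X_{1..m} -> int) :
  (forall i, i \in r -> wcocycle (ext_basis K) s I (F i)) ->
  wcocycle (ext_basis K) s I (\sum_(i <- r) F i) /\
  wclass (ext_basis K) s I (\sum_(i <- r) F i) = \sum_(i <- r) wclass (ext_basis K) s I (F i).
Proof.
elim: r => [|i r IH] hF; first by rewrite !big_nil wclass0; split=> //; apply: wcocycle0.
have zi : wcocycle (ext_basis K) s I (F i) by apply: hF; rewrite inE eqxx.
have [|zr er] := IH; first by move=> l lr; apply: hF; rewrite inE lr orbT.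
rewrite !big_cons -er; split; first exact: wcocycleD.
exact: wclassD.
Qed.

Lemma Ext_comp_ker K s I (y : Ext (exterior_face K) s I) :
  Ext_comp y = 0 <-> in_mu_span y.
Proof.
split; last first.
  case: s y => [|s] y /=; first by move=> ->; exact: (raddf0 (@Ext_comp K _ _)).
  move=> [z ->]; rewrite (raddf_sum (@Ext_comp K _ _)) big1 // => j Ij.
  rewrite (raddf_sum (@Ext_comp K _ _)) big_nat big1 // => k kI.
  exact: Ext_comp_mu.
have zy := Ext_wordP (ext_basis K) y.
move=> /(wclass_eq0 (wcocycle_ext_poly zy))[h hh e].
case: s y zy hh e => [|s] y zy hh e /=.
  rewrite -(Ext_wordK (ext_basis K) y) e (_ : h = 0) ?dw0 ?wclass0 //.
  by apply/funext => w; apply/eqP/negPn/negP => /hh[].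
have [z [h' [cz ch' e']]] := coboundary_descent (@face_supp_sub m K)
  (proj1 (wcoch_ext _ _ _ _) (proj1 zy)) (proj1 (wcoch_poly _ _ _ _) hh) e.
pose sg j k := (k + inversions U_(j)%MM I + s.-1)%N.
have zz j k : (0 < k < I j)%N -> wcocycle (ext_basis K) s (I - U_(j))%MM (z j k).
  by move=> kI; have [/wcoch_ext hz dz] := cz j k kI.
(* The sign, being its own inverse, cancels that of [Ext_muE]. *)
pose Y j k : Ext (exterior_face K) s (I - U_(j))%MM :=
  wclass (ext_basis K) s (I - U_(j))%MM (z j k) *~ (-1) ^+ sg j k.
have muY j k : (0 < k < I j)%N ->
    Ext_mu k (Y j k) = wclass (ext_basis K) s.+1 I (dw (secw j k (z j k))).
  move=> kI; have zjk := zz j k kI; have zs := wcocycleMz ((-1) ^+ sg j k) zjk.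
  have -> : Y j k = wclass (ext_basis K) s (I - U_(j))%MM (z j k *~ (-1) ^+ sg j k).
    by rewrite wclass_sign.
  rewrite Ext_muE //; have [t ht ->] := Ext_word_wclass zs; rewrite wclass_dw_secw //.
  rewrite (raddfMz (@secw m j k)) (raddfMz (@dw m)) /= wclass_sign; last exact: wcocycle_dw_secw.
  by rewrite -mulrzA -expr2 sqrr_sign mulr1z.
exists Y; rewrite -(Ext_wordK (ext_basis K) y) e' wclassD_dw; last exact/wcoch_ext.
- have zD j k : k \in index_iota 1 (I j) ->
      wcocycle (ext_basis K) s.+1 I (dw (secw j k (z j k))).
    by rewrite mem_index_iota => kI; apply: wcocycle_dw_secw => //; apply: zz.
  have zS j := proj1 (wclass_sum (zD j)).
  rewrite (proj2 (wclass_sum (fun j (_ : j \in index_enum _) => zS j))) [RHS]big_mkcond.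
  apply: eq_bigr => j _; rewrite (proj2 (wclass_sum (zD j))); case: ifP => Ij.
    by rewrite [LHS]big_nat [RHS]big_nat; apply: eq_bigr => k kI; rewrite muY.
  by rewrite big_geq // leqNgt Ij.
- apply: (proj1 (wclass_sum _)) => j _; apply: (proj1 (wclass_sum _)) => k.
  by rewrite mem_index_iota => kI; apply: wcocycle_dw_secw => //; apply: zz.
Qed.
End Comparison.

Theorem corollary5p4 (m : nat) :
  exists f : forall (K : scomplex m) (s : nat) (I : 'X_{1..m}),
    {additive Ext (exterior_face K) s I -> Ext (polynomial_face K) s I},
  [/\ (* surjectivity *)
      forall K s I (z : Ext (polynomial_face K) s I), exists y, f K s I y = z,
      (* naturality *)
      forall K L (KL : sc_faces K \subset sc_faces L) s I
             (y : Ext (exterior_face K) s I),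
        f L s I (Ext_map (face_proj (exterior_alg m) KL) y) =
        Ext_map (face_proj (polynomial_alg m) KL) (f K s I y),
      (* (1) *)
      forall K s s' I I' (y : Ext (exterior_face K) s I)
             (y' : Ext (exterior_face K) s' I'),
        let n' : int := (mdeg I')%:Z - s'%:Z in
        let e : int :=
          (\sum_(j < m) \sum_(k < m | (j <= k)%N) I j * I' k)%N%:Z
          - n' * (\sum_(j < m) I j)%N%:Z in
        f K (s + s')%N (I + I')%MM (Ext_mul y y') =
        Ext_mul (f K s I y) (f K s' I' y') *~ (-1) ^ e
    & (* (2) *)
      forall K s I (y : Ext (exterior_face K) s I),
        f K s I y = 0 <-> in_mu_span y].
Proof.
exists (fun K s I => @Ext_comp m K s I); split.
- exact: Ext_comp_surj.
- exact: Ext_comp_natural.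
- by move=> K s s' I I' y y' n' e; rewrite /= Ext_comp_mul -(sign_exponent s' I I').
- exact: Ext_comp_ker.
Qed.
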